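(* Let $B$ be a standard one-dimensional Brownian motion started at $0$ and let $K$ be its concave majorant on $[0,\infty)$. Then for each $t>0$ the random variable $2K(t)-B(t)$ has the same distribution as $R_5(t)$, where $R_5$ is a five-dimensional Bessel process with $R_5(0)=0$. In particular, $2K(1)-B(1)$ has the distribution of $\chi_5$.
   Context: The concave majorant $K$ of $B$ on $[0,\infty)$ is the minimal concave function with $K(t)\ge B(t)$ for all $t\ge 0$; almost surely it exists and is unique. $\chi_5$ denotes the positive square root of a chi-squared random variable with $5$ degrees of freedom. A five-dimensional Bessel process started at $0$ is the Euclidean norm of a standard five-dimensional Brownian motion started at the origin. *)

(* Defs.v *)
From HB Require Import structures.
From mathcomp Require Import all_boot all_order all_algebra finmap.
From mathcomp Require Import all_classical all_reals all_analysis.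

Set Implicit Arguments.
Unset Strict Implicit.
Unset Printing Implicit Defensive.

Import Order.TTheory GRing.Theory Num.Theory.
Import numFieldNormedType.Exports.

Local Open Scope classical_set_scope.
Local Open Scope ring_scope.

(* Throughout, a real-valued process on [0, oo) is a map X : R -> T -> R (time,
   then sample point) of which only the values at times t >= 0 are relevant. *)

Section probability_notions.
Context (R : realType) (d : measure_display) (T : measurableType d).
Variable P : probability T R.

Definition mutual_independence (I : choiceType) (F : I -> set (set T)) : Prop :=
  forall (J : {fset I}) (E : I -> set T),
    (forall i, i \in J -> F i (E i)) ->
    P (\big[setI/setT]_(i <- J) E i) = (\prod_(i <- J) P (E i))%E.

Definition sigma_of_fun (X : T -> R) : set (set T) :=
  preimage_set_system setT X measurable.

Definition sigma_of_process (X : R -> T -> R) : set (set T) :=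
  <<s \bigcup_(t in `[0, +oo[) sigma_of_fun (X t) >>.

Definition independent_functions (I : choiceType) (X : I -> T -> R) : Prop :=
  mutual_independence (fun i => sigma_of_fun (X i)).

(* The second argument of [normal_prob] is the standard deviation; [normal_prob]
   is not a Dirac mass when it is 0, whence s < t. Finitely many increments are
   covered by sequences t that are eventually constant. *)
Definition brownian_motion (B : R -> T -> R) : Prop :=
  [/\ forall t, 0 <= t -> measurable_fun setT (B t),
      {ae P, forall w, B 0 w = 0},
      forall t : nat -> R, 0 <= t 0%N -> nondecreasing_seq t ->
        independent_functions (fun (i : nat) w => B (t i.+1) w - B (t i) w),
      forall s t, 0 <= s -> s < t -> forall A : set R, measurable A ->
        P ((fun w => B t w - B s w) @^-1` A) =
        normal_prob 0 (Num.sqrt (t - s)) A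
    & {ae P, forall w, {within `[0, +oo[, continuous (B ^~ w)}}].

Definition brownian_motion_nd (n : nat) (W : 'I_n -> R -> T -> R) : Prop :=
  (forall i, brownian_motion (W i)) /\
  mutual_independence (fun i => sigma_of_process (W i)).

Definition bessel_process (n : nat) (Z : R -> T -> R) : Prop :=
  exists2 W : 'I_n -> R -> T -> R, brownian_motion_nd W &
    forall t w, 0 <= t -> Z t w = Num.sqrt (\sum_(i < n) W i t w ^+ 2).

Definition iid_std_normal (n : nat) (G : 'I_n -> T -> R) : Prop :=
  [/\ forall i, measurable_fun setT (G i),
      independent_functions G
    & forall i (A : set R), measurable A -> P (G i @^-1` A) = normal_prob 0 1 A].

End probability_notions.

(* Equality in law for random variables that are only defined almost surely:
   each function need only agree almost surely with a measurable one, and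
   this is part of what is asserted. *)
Definition eq_in_law (R : realType)
    (d : measure_display) (T : measurableType d) (P : probability T R)
    (X : T -> R)
    (d' : measure_display) (T' : measurableType d') (P' : probability T' R)
    (X' : T' -> R) : Prop :=
  exists (Y : {RV P >-> R}) (Y' : {RV P' >-> R}),
    [/\ {ae P, forall w, Y w = X w},
        {ae P', forall w, Y' w = X' w}
      & forall A : set R, measurable A ->
          distribution P Y A = distribution P' Y' A].

(* The space carrying the normal variables need not be the one carrying V. *)
Definition chi_squared (R : realType) (d : measure_display)
    (T : measurableType d) (P : probability T R) (n : nat) (V : T -> R) : Prop :=
  exists (d0 : measure_display) (T0 : measurableType d0)
         (P0 : probability T0 R) (G : 'I_n -> T0 -> R),
    iid_std_normal P0 G /\
    eq_in_law P V P0 (fun w => \sum_(i < n) G i w ^+ 2).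

Section concave_majorant.
Context (R : realType).

Definition concave_on_nonneg (f : R -> R) : Prop :=
  @convex_function R R^o `[0, +oo[ (\- f).

Definition is_concave_majorant (b k : R -> R) : Prop :=
  [/\ concave_on_nonneg k,
      forall t, 0 <= t -> b t <= k t
    & forall f, concave_on_nonneg f -> (forall t, 0 <= t -> b t <= f t) ->
        forall t, 0 <= t -> k t <= f t].

(* Uniquely determined on [0, oo) if it exists; the default value 0 is used
   only for functions b that no concave function dominates. *)
Definition concave_majorant (b : R -> R) : R -> R :=
  xget (fun=> 0) [set k | is_concave_majorant b k].

End concave_majorant.

(* Main.v *)
Require Import Defs.
From HB Require Import structures.
From mathcomp Require Import all_boot all_order all_algebra finmap.
From mathcomp Require Import all_classical all_reals all_analysis.
From mathcomp Require Import measurable_realfun ring lra zify.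

Import Order.TTheory GRing.Theory Num.Theory.
Import numFieldNormedType.Exports.

Local Open Scope classical_set_scope.
Local Open Scope ring_scope.

Set Implicit Arguments.
Unset Strict Implicit.
Unset Printing Implicit Defensive.

(* Fix t > 0.  K(t) <= k holds if and only if some line through (t, k) dominates
   the whole path.  By reflection, given B(t) = b < k, the path stays below the
   line of slope a through (t, k) up to time t with probability
   1 - exp(- 2 (k - a t) (k - b) / t); hence the largest slope admissible for
   the past has the law of the positive part of k / t - E2 / (4 t (k - b)), where
   E2 is the sum of the squares of two independent N(0, t) variables, so that
   P(E2 > q) = exp(- q / (2 t)).  After time t the path stays below a line of
   slope a with probability 1 - exp(- 2 a (k - b)).  As the past and the future
   are independent, this gives
     P(K(t) <= k, B(t) in A) = P(N in A, N < k, E1 + E2 <= 4 k (k - N))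
   with N of law N(0, t) and E1 an independent copy of E2.  The condition on the
   right says (N + R) / 2 <= k, where R = sqrt (N^2 + E1 + E2) has the law of
   R5(t); so (K(t), B(t)) and ((N + R) / 2, N) have the same law. *)

(** * Independence and laws of pairs *)

(** The five squares split as 1 + 2 + 2: [N] stands for the path at [t], [E2] for the past, [E1] for
    the future. If a is the largest slope admissible for the past, the future complies with
    probability 1 - exp(- 2 a (k - N)), which is the probability that E1 <= 4 t a (k - N). Inserting
    a = k / t - E2 / (4 t (k - N)) gives E1 + E2 <= 4 k (k - N), that is N^2 + E1 + E2 <= (2 k -
    N)^2. Reflection is carried out on grids at fixed times, without stopping times. A path seen on
    a grid jumps over the line instead of meeting it, and the reflection identity for one normal
    variable becomes an inequality whose direction depends on the side of the line. Upper bounds use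
    the first grid point above the line. Lower bounds use the first grid point above the line
    lowered by e, which on a fine grid is still below the line itself, by uniform continuity. Events
    are written with dyadic times so as to be measurable; continuity carries them to all times off a
    null set. *)

Lemma measurable_preimage d d' (T : measurableType d) (T' : measurableType d')
    (f : T -> T') (A : set T') :
  measurable_fun setT f -> measurable A -> measurable (f @^-1` A).
Proof. by move=> mf mA; rewrite -[X in measurable X]setTI; exact: mf. Qed.

Section independence.
Context (R : realType) (d : measure_display) (T : measurableType d).
Variable P : probability T R.
Implicit Types G : set (set T).

Definition independent_systems G1 G2 := forall A B, G1 A -> G2 B ->
  P (A `&` B) = (P A * P B)%E.

Lemma independent_systems_sym G1 G2 :
  independent_systems G1 G2 -> independent_systems G2 G1.
Proof. by move=> h A B GA GB; rewrite setIC h// muleC. Qed.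

(** The sets independent of a fixed [B] form a Dynkin system. Only one side is extended, so two
    applications, one on each side, give [independent_systems_sigma]. *)
Lemma independent_systems_sigma_l G1 G2 : G1 `<=` measurable ->
  G2 `<=` measurable -> setI_closed G1 -> independent_systems G1 G2 ->
  independent_systems <<s G1 >> G2.
Proof.
move=> G1m G2m G1I h A B + GB; have mB := G2m _ GB.
suff : <<s G1 >> `<=` [set A | measurable A /\ P (A `&` B) = (P A * P B)%E].
  by move=> /[apply] -[].
apply: lambda_system_subset => //; last first.
  by move=> C GC; split; [exact: G1m|exact: h].
apply/dynkin_lambda_system; split.
- by split; [exact: measurableT|rewrite setTI probability_setT mul1e].
- move=> C [mC PC]; split; first exact: measurableC.
  rewrite setIC -setDE measureD//; last by rewrite -ge0_fin_numE ?fin_num_measure.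
  transitivity (P B - P C * P B)%E; first by congr (_ - _)%E; rewrite setIC.
  have fA := fin_num_measure P _ mC.
  have fB := fin_num_measure P _ mB.
  transitivity ((1 - P C) * P B)%E; last by congr (_ * _)%E; rewrite probability_setC.
  by rewrite muleBl ?mul1e// fin_num_adde_defr.
- move=> F tF HF; have mF n := (HF n).1.
  split; first exact: bigcupT_measurable.
  rewrite setI_bigcupl !measure_bigcup//=; last 2 first.
  + by move=> n _; exact: measurableI.
  + exact: trivIset_setIr.
  have fB := fin_num_measure P _ mB.
  rewrite -(fineK fB) muleC -nneseriesZl; last by move=> *; exact: measure_ge0.
  by apply: eq_eseriesr => n _; rewrite muleC fineK//; exact: (HF n).2.
Qed.

Lemma independent_systems_sigma G1 G2 : G1 `<=` measurable ->
  G2 `<=` measurable -> setI_closed G1 -> setI_closed G2 ->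
  independent_systems G1 G2 -> independent_systems <<s G1 >> <<s G2 >>.
Proof.
move=> G1m G2m G1I G2I h.
apply: independent_systems_sigma_l => //.
  by apply: smallest_sub => //; exact: sigma_algebra_measurable.
apply/independent_systems_sym/independent_systems_sigma_l => //.
exact: independent_systems_sym.
Qed.

Lemma mutual_independence_systems (I : choiceType) (F : I -> set (set T))
    (J1 J2 : set I) :
  (forall i, F i `<=` measurable) -> (forall i, setI_closed (F i)) ->
  (forall i, F i setT) ->
  mutual_independence P F -> J1 `&` J2 = set0 ->
  independent_systems <<s \bigcup_(i in J1) F i >> <<s \bigcup_(i in J2) F i >>.
Proof.
move=> Fm FI FT ind J12.
(* Finite intersections over indices in [J] form a pi-system. [E] is a total family lying in [F]
   everywhere, so two families can be merged after padding each with [setT] outside its index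
   set. *)
pose G (J : set I) := [set A | exists (K : {fset I}) (E : I -> set T),
  [/\ forall i, i \in K -> J i, forall i, F i (E i) &
      A = \big[setI/setT]_(i <- K) E i]].
have GE (J : set I) : \bigcup_(i in J) F i `<=` G J.
  move=> A [i Ji FiA]; exists [fset i]%fset, (fun j => if j == i then A else setT).
  split.
  - by move=> j; rewrite inE => /eqP ->.
  - by move=> j; case: eqP => [->|].
  - by rewrite big_seq_fset1 eqxx.
have Gm J : G J `<=` measurable.
  move=> _ [K [E [_ FE ->]]].
  by apply: bigsetI_measurable => i _; exact: Fm.
have big_ext (K L : {fset I}) (E : I -> set T) : (K `<=` L)%fset ->
    \big[setI/setT]_(i <- K) E i =
    \big[setI/setT]_(i <- L) (if i \in K then E i else setT).
  move=> KL; rewrite -!bigcap_fset; apply/seteqP; split => w /= Ew i /=.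
    by move=> iL; case: ifPn => // iK; exact: Ew.
  by move=> iK; have /= := Ew i (fsubsetP KL _ iK); rewrite iK.
have GI J : setI_closed (G J).
  move=> _ _ [K [E [KJ FE ->]]] [L [D [LJ FD ->]]].
  exists (K `|` L)%fset, (fun i => (if i \in K then E i else setT) `&`
      (if i \in L then D i else setT)); split.
  - by move=> i; rewrite inE => /orP[/KJ|/LJ].
  - by move=> i; apply: FI; case: ifP.
  - by rewrite big_split/= -!big_ext// ?fsubsetUl ?fsubsetUr.
suff GG : independent_systems (G J1) (G J2).
  move=> A B sA sB.
  have S J : <<s \bigcup_(i in J) F i >> `<=` <<s G J >>.
    apply: smallest_sub; first exact: smallest_sigma_algebra.
    by move=> C /GE; exact: sub_sigma_algebra.
  by apply: (independent_systems_sigma (@Gm J1) (@Gm J2) (@GI J1) (@GI J2) GG); exact: S.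
move=> _ _ [K [E [KJ FE ->]]] [L [D [LJ FD ->]]].
have KL : [disjoint K & L]%fset.
  apply/fdisjointP => i iK; apply/negP => iL.
  by have : (J1 `&` J2) i; [split; [exact: KJ|exact: LJ]|rewrite J12].
(* As [K] and [L] are disjoint, one family [C] restricts to both, and mutual independence over the
   union of the index sets yields the product. *)
pose C i := if i \in K then E i else D i.
rewrite (_ : \big[setI/setT]_(i <- K) E i = \big[setI/setT]_(i <- K) C i); last first.
  by apply: eq_big_seq => i iK; rewrite /C iK.
rewrite (_ : \big[setI/setT]_(i <- L) D i = \big[setI/setT]_(i <- L) C i); last first.
  apply: eq_big_seq => i iL; rewrite /C; case: ifPn => // iK.
  by have /fdisjointP/(_ _ iK) := KL; rewrite iL.
have FC i : F i (C i) by rewrite /C; case: ifP.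
have KLp : perm_eq (K `|` L)%fset (K ++ L).
  apply: uniq_perm; first exact: fset_uniq.
    rewrite cat_uniq !fset_uniq andbT/=; apply/hasPn => i iL; apply/negP => iK.
    by have /fdisjointP/(_ _ iK) := KL; rewrite iL.
  by move=> i; rewrite mem_cat inE.
have := ind (K `|` L)%fset C (fun i _ => FC i).
by rewrite !(perm_big _ KLp) !big_cat/= => ->; rewrite !ind.
Qed.

Lemma independent_functions_systems (I : choiceType) (X : I -> T -> R) (J1 J2 : set I) :
  (forall i, measurable_fun setT (X i)) -> independent_functions P X ->
  J1 `&` J2 = set0 ->
  independent_systems <<s \bigcup_(i in J1) sigma_of_fun (X i) >>
    <<s \bigcup_(i in J2) sigma_of_fun (X i) >>.
Proof.
move=> mX iX; apply: mutual_independence_systems => //.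
- by move=> i _ [C mC <-]; rewrite setTI; exact: measurable_preimage.
- move=> i _ _ [C mC <-] [D mD <-]; exists (C `&` D); first exact: measurableI.
  by rewrite !setTI preimage_setI.
- by move=> i; exists setT => //; rewrite setTI preimage_setT.
Qed.

End independence.

Lemma measure_integral_indic d (T : measurableType d) (R : realType)
    (mu : {measure set T -> \bar R}) (A : set T) :
  measurable A -> (mu A = \int[mu]_w (\1_A w)%:E)%E.
Proof. by move=> mA; rewrite integral_indic// setIT. Qed.

Section fubini_independence.
Context (R : realType) (d : measure_display) (T : measurableType d).
Variable P : probability T R.

(** The pair has the product of the two laws, so Tonelli applies. Both integrals stay over [P]: [w']
    acts as an independent copy of the sample point. The targets are arbitrary, in particular [T]
    itself with a smaller sigma-algebra, which makes conditioning on a past a plain double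
    integral. *)
Lemma integral_independent_pair d1 d2 (T1 : measurableType d1)
    (T2 : measurableType d2) (X : T -> T1) (Z : T -> T2) (f : T1 * T2 -> \bar R) :
  measurable_fun setT X -> measurable_fun setT Z ->
  (forall A C, measurable A -> measurable C ->
    P (X @^-1` A `&` Z @^-1` C) = (P (X @^-1` A) * P (Z @^-1` C))%E) ->
  measurable_fun setT f -> (forall x, (0 <= f x)%E) ->
  (\int[P]_w f (X w, Z w) = \int[P]_w \int[P]_w' f (X w, Z w'))%E.
Proof.
move=> mX mZ XZ mf f0.
pose X_ : {mfun T >-> T1} := HB.pack X (isMeasurableFun.Build _ _ _ _ _ mX).
pose Z_ : {mfun T >-> T2} := HB.pack Z (isMeasurableFun.Build _ _ _ _ _ mZ).
have mXZ : measurable_fun setT (fun w => (X w, Z w)) by exact: measurable_fun_pair.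
pose XZ_ : {mfun T >-> (T1 * T2)%type} :=
  HB.pack (fun w => (X w, Z w)) (isMeasurableFun.Build _ _ _ _ _ mXZ).
transitivity (\int[distribution P XZ_]_x f x)%E.
  by rewrite ge0_integral_pushforward.
transitivity (\int[distribution P X_ \x distribution P Z_]_x f x)%E.
  apply: eq_measure_integral => A mA _; apply/esym/product_measure_unique => //.
rewrite fubini_tonelli1// ge0_integral_pushforward//=; last 2 first.
- exact: measurable_fun_fubini_tonelli_F.
- by move=> x _; exact: integral_ge0.
apply: eq_integral => w _ /=.
rewrite /fubini_F ge0_integral_pushforward//.
exact: measurableT_comp.
Qed.

Lemma probability_independent_pair d1 d2 (T1 : measurableType d1)
    (T2 : measurableType d2) (X : T -> T1) (Z : T -> T2) (S : set (T1 * T2)) :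
  measurable_fun setT X -> measurable_fun setT Z ->
  (forall A C, measurable A -> measurable C ->
    P (X @^-1` A `&` Z @^-1` C) = (P (X @^-1` A) * P (Z @^-1` C))%E) ->
  measurable S ->
  (P [set w | S (X w, Z w)] = \int[P]_w P [set w' | S (X w, Z w')])%E.
Proof.
move=> mX mZ XZ mS.
have mXZ : measurable_fun setT (fun w => (X w, Z w)) by exact: measurable_fun_pair.
have mSX w : measurable [set w' | S (X w, Z w')].
  by apply: (@measurable_preimage _ _ _ _ (fun w' => (X w, Z w'))) => //; exact: measurable_fun_pair.
rewrite measure_integral_indic; last exact: (measurable_preimage mXZ mS).
rewrite (integral_independent_pair mX mZ XZ (f := fun x => (\1_S x)%:E))//; last first.
  by apply/measurable_EFinP; exact: measurable_indic.
by apply: eq_integral => w _; rewrite measure_integral_indic.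
Qed.

End fubini_independence.

Section pair_law.
Context (R : realType) (d : measure_display) (T : measurableType d).
Context (d' : measure_display) (T' : measurableType d').
Variables (P : probability T R) (P' : probability T' R).

(** Two uniqueness arguments on pi-systems: first half-lines, with [A] fixed and the measures
    restricted to the event that the second variable is in [A]; then rectangles. *)
Lemma eq_pair_law (X Y : T -> R) (X' Y' : T' -> R) :
  measurable_fun setT X -> measurable_fun setT Y ->
  measurable_fun setT X' -> measurable_fun setT Y' ->
  (forall x A, measurable A -> P ([set w | x <= X w] `&` Y @^-1` A) =
    P' ([set w | x <= X' w] `&` Y' @^-1` A)) ->
  forall S : set (R * R), measurable S ->
    P [set w | S (X w, Y w)] = P' [set w | S (X' w, Y' w)].
Proof.
move=> mX mY mX' mY' XY.
have mXY : measurable_fun setT (fun w => (X w, Y w)) by exact: measurable_fun_pair.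
have mXY' : measurable_fun setT (fun w => (X' w, Y' w)) by exact: measurable_fun_pair.
have XY1 C A : measurable C -> measurable A ->
    P (X @^-1` C `&` Y @^-1` A) = P' (X' @^-1` C `&` Y' @^-1` A).
  move=> mC mA.
  have mYA : measurable (Y @^-1` A) by exact: measurable_preimage.
  have mYA' : measurable (Y' @^-1` A) by exact: measurable_preimage.
  pose X_ : {mfun T >-> R} := HB.pack X (isMeasurableFun.Build _ _ _ _ _ mX).
  pose X'_ : {mfun T' >-> R} := HB.pack X' (isMeasurableFun.Build _ _ _ _ _ mX').
  pose m1 := pushforward (mrestr P mYA) X_.
  pose m2 := pushforward (mrestr P' mYA') X'_.
  apply: (measure_unique (@RGenCInfty.G R) (fun n => `[(- n%:R), +oo[%classic) _ _ _ _ m1 m2) => //.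
  - exact: RGenCInfty.measurableE.
  - move=> _ _ [x ->] [y ->]; exists (Order.max x y).
    by apply/seteqP; split => z /=; rewrite !in_itv/= !andbT ge_max => /andP.
  - by move=> i; eexists.
  - apply/seteqP; split => // x _; exists (Num.truncn `|x|).+1 => //=.
    rewrite in_itv/= andbT lerNl (le_trans (ler_norm _))// normrN.
    by rewrite ltW// truncnS_gt.
  - move=> _ [x ->]; rewrite /m1 /m2 /pushforward /mrestr /=.
    have := XY x A mA; congr (P (_ `&` _) = P' (_ `&` _)).
    + by apply/seteqP; split => z /=; rewrite in_itv/= andbT.
    + by apply/seteqP; split => z /=; rewrite in_itv/= andbT.
  - move=> k; apply: (@le_lt_trans _ _ 1%E); last exact: ltry.
    apply: probability_le1; apply: measurableI => //.
    by apply: measurable_preimage => //; exact: measurable_itv.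
pose XY_ : {mfun T >-> (R * R)%type} :=
  HB.pack (fun w => (X w, Y w)) (isMeasurableFun.Build _ _ _ _ _ mXY).
pose XY'_ : {mfun T' >-> (R * R)%type} :=
  HB.pack (fun w => (X' w, Y' w)) (isMeasurableFun.Build _ _ _ _ _ mXY').
move=> S mS.
apply: (measure_unique [set A `*` B | A in @measurable _ R & B in @measurable _ R]
   (fun=> setT) _ _ _ _ (distribution P XY_) (distribution P' XY'_)) => //.
- by rewrite measurable_prod_measurableType.
- move=> _ _ [A mA [B mB <-]] [C mC [D mD <-]]; rewrite -setXI.
  by exists (A `&` C); [exact: measurableI|exists (B `&` D) => //; exact: measurableI].
- by move=> _; exists setT => //; exists setT => //; rewrite setXTT.
- by rewrite bigcup_const.
- by move=> _ [A mA [B mB <-]]; exact: XY1.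
- move=> _; apply: (@le_lt_trans _ _ 1%E); last exact: ltry.
  exact: probability_le1.
Qed.

Lemma eq_pair_integral (X Y : T -> R) (X' Y' : T' -> R) (h : R * R -> \bar R) :
  measurable_fun setT X -> measurable_fun setT Y ->
  measurable_fun setT X' -> measurable_fun setT Y' ->
  (forall x A, measurable A -> P ([set w | x <= X w] `&` Y @^-1` A) =
    P' ([set w | x <= X' w] `&` Y' @^-1` A)) ->
  measurable_fun setT h -> (forall z, (0 <= h z)%E) ->
  (\int[P]_w h (X w, Y w) = \int[P']_w h (X' w, Y' w))%E.
Proof.
move=> mX mY mX' mY' XY mh h0.
have mXY : measurable_fun setT (fun w => (X w, Y w)) by exact: measurable_fun_pair.
have mXY' : measurable_fun setT (fun w => (X' w, Y' w)) by exact: measurable_fun_pair.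
pose XY_ : {mfun T >-> (R * R)%type} :=
  HB.pack (fun w => (X w, Y w)) (isMeasurableFun.Build _ _ _ _ _ mXY).
pose XY'_ : {mfun T' >-> (R * R)%type} :=
  HB.pack (fun w => (X' w, Y' w)) (isMeasurableFun.Build _ _ _ _ _ mXY').
transitivity (\int[distribution P XY_]_z h z)%E.
  by rewrite ge0_integral_pushforward.
transitivity (\int[distribution P' XY'_]_z h z)%E.
  by apply: eq_measure_integral => S mS _; exact: eq_pair_law mS.
by rewrite ge0_integral_pushforward.
Qed.

End pair_law.

(** * Affine substitution and integration against a density *)

Lemma ge0_integral_affine (R : realType) (a b : R) (f : R -> \bar R) :
  a != 0 -> measurable_fun setT f -> (forall x, (0 <= f x)%E) ->
  (\int[lebesgue_measure]_x f x =
   `|a|%:E * \int[lebesgue_measure]_x f (a * x + b)%R)%E.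
Proof.
move=> a0 mf f0.
have mg : measurable_fun setT (fun x : R => a * x + b).
  by apply: measurable_funD => //; exact: mulrl_measurable.
have mg' : @measurable_fun _ _ (measurableTypeR R) (measurableTypeR R) setT
  (fun x : R => a * x + b) by exact: mg.
pose g : {mfun measurableTypeR R >-> measurableTypeR R} :=
  HB.pack (fun x : R => a * x + b) (isMeasurableFun.Build _ _ _ _ _ mg').
pose m_ : {measure set (measurableTypeR R) -> \bar R} :=
  mscale (NngNum (normr_ge0 a)) (pushforward (@lebesgue_measure R) g).
pose m := m_ mg'.
(* It is enough to compare the measures on intervals []u, v]]; for [a < 0] the preimage is half-open
   on the other side, with the same length. *)
have mE A : measurable A -> lebesgue_measure A = m A.
  apply: lebesgue_measure_unique => _ [[u v]] _ <- /=.
  rewrite /m /mscale /= /pushforward /g/=.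
  have [a_gt0|a_lt0] : 0 < a \/ a < 0 by case: ltgtP a0 => // *; [left|right].
    rewrite (_ : _ @^-1` _ = `](u - b) / a, (v - b) / a]%classic); last first.
      apply/seteqP; split => x /=; rewrite !in_itv/=;
      by rewrite ltr_pdivrMr// ler_pdivlMr// ltrBlDr lerBrDr (mulrC x).
    rewrite !lebesgue_measure_itv/= !lte_fin ltr_pM2r ?invr_gt0// ltrD2r.
    case: ifPn => uv; last by rewrite mule0.
    by rewrite -!EFinB -EFinM gtr0_norm//; congr EFin; field.
  rewrite (_ : _ @^-1` _ = `[(v - b) / a, (u - b) / a[%classic); last first.
    apply/seteqP; split => x /=; rewrite !in_itv/=;
    by rewrite ltr_ndivlMr// ler_ndivrMr// lerBrDr ltrBlDr (mulrC x) andbC.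
  rewrite !lebesgue_measure_itv/= !lte_fin ltr_nM2r ?invr_lt0// ltrD2r.
  case: ifPn => uv; last by rewrite mule0.
  by rewrite -!EFinB -EFinM ltr0_norm//; congr EFin; field.
transitivity (\int[m]_x f x)%E.
  by apply: eq_measure_integral => A mA _; exact: mE.
by rewrite ge0_integral_mscale// ge0_integral_pushforward.
Qed.

Section density.
Context d (T : measurableType d) (R : realType).
Variables (nu mu : {measure set T -> \bar R}) (p : T -> R).
Hypotheses (mp : measurable_fun setT p) (p0 : forall x, 0 <= p x).
Hypothesis nuE : forall A, measurable A -> (nu A = \int[mu]_(x in A) (p x)%:E)%E.

Import HBNNSimple.

Let integral_density_nnsfun (f : {nnsfun T >-> R}) :
  (\int[nu]_x (f x)%:E = \int[mu]_x ((f x)%:E * (p x)%:E))%E.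
Proof.
under [LHS]eq_integral do rewrite fimfunE -fsumEFin//.
rewrite [LHS]ge0_integral_fsum//; last 2 first.
- by move=> r; exact/measurable_EFinP/measurableT_comp.
- by move=> n x _; rewrite EFinM nnfun_muleindic_ge0.
under [RHS]eq_integral.
  move=> x xD; rewrite fimfunE -fsumEFin// muleC ge0_mule_fsumr; last first.
    by move=> r; rewrite EFinM nnfun_muleindic_ge0.
  over.
rewrite [RHS]ge0_integral_fsum//; last 2 first.
- move=> r; apply/measurable_EFinP; apply: measurable_funM => //.
  exact/measurableT_comp.
- move=> n x _; rewrite mule_ge0 ?lee_fin//.
  by rewrite -lee_fin EFinM nnfun_muleindic_ge0.
apply: eq_fsbigr => r _.
rewrite integralZl_indic_nnsfun//= integral_indic//= setIT nuE//.
have [r0|r0] := ltP r 0.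
  rewrite preimage_nnfun0// integral_set0 mule0.
  by rewrite integral0_eq// => x _; rewrite indic0/= mulr0 mule0.
rewrite integral_mkcond -ge0_integralZl//; last 2 first.
- by apply/(measurable_restrictT _ _).1 => //; exact/measurable_EFinP/measurable_funTS.
- by move=> x _; rewrite erestrict_ge0// => y _; rewrite lee_fin.
apply: eq_integral => x _; rewrite patchE indicE EFinM.
by case: ifPn => _; rewrite ?mulr1 ?mulr0 ?mule1 ?mule0// muleC.
Qed.

Lemma ge0_integral_density (f : T -> \bar R) :
  measurable_fun setT f -> (forall x, 0 <= f x)%E ->
  (\int[nu]_x f x = \int[mu]_x (f x * (p x)%:E))%E.
Proof.
move=> mf f0.
pose f_ := nnsfun_approx measurableT mf.
have fE x : f x = limn (fun n => (f_ n x)%:E).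
  by apply/esym/cvg_lim => //; exact: cvg_nnsfun_approx.
have f_nd x : {homo (fun n => (f_ n x)%:E) : m n / (m <= n)%N >-> (m <= n)%E}.
  by move=> m n mn; rewrite lee_fin; exact/lefP/nd_nnsfun_approx.
transitivity (limn (fun n => \int[nu]_x (f_ n x)%:E))%E.
  rewrite -monotone_convergence//=.
  - by apply: eq_integral => x _; exact: fE.
  - by move=> n; exact/measurable_EFinP/measurable_funTS.
  - by move=> n ? _; rewrite lee_fin.
transitivity (limn (fun n => \int[mu]_x ((f_ n x)%:E * (p x)%:E)))%E.
  by apply: congr_lim; apply/funext => n /=; exact: integral_density_nnsfun.
rewrite -monotone_convergence//=.
- apply: eq_integral => x _; rewrite [in RHS]fE muleC -limeMl//.
    by apply: congr_lim; apply/funext => n /=; rewrite muleC.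
  exact/ereal_nondecreasing_is_cvgn.
- by move=> n; apply/measurable_EFinP; apply: measurable_funM => //; exact: measurable_funTS.
- by move=> n x _; rewrite mule_ge0 ?lee_fin.
- by move=> x _ m n mn; apply: lee_wpmul2r; rewrite ?lee_fin//; exact/lefP/nd_nnsfun_approx.
Qed.

End density.

Lemma ge0_integral_normal_law (R : realType) d (T : measurableType d)
    (P : probability T R) (X : T -> R) (m s : R) (f : R -> \bar R) :
  measurable_fun setT X ->
  (forall A, measurable A -> P (X @^-1` A) = normal_prob m s A) ->
  measurable_fun setT f -> (forall x, (0 <= f x)%E) ->
  (\int[P]_w f (X w) =
   \int[lebesgue_measure]_x (f x * (normal_pdf m s x)%:E))%E.
Proof.
move=> mX XE mf f0.
have mX' : @measurable_fun _ _ T (measurableTypeR R) setT X by exact: mX.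
pose X_ : {mfun T >-> measurableTypeR R} :=
  HB.pack X (isMeasurableFun.Build _ _ _ _ _ mX').
transitivity (\int[distribution P X_]_x f x)%E.
  by rewrite ge0_integral_pushforward.
rewrite (@ge0_integral_density _ _ _ _ lebesgue_measure (normal_pdf m s))//.
- exact: measurable_normal_pdf.
- by move=> x; exact: normal_pdf_ge0.
Qed.

(** * Reflection and the crossing of a line on [0, t] *)

Lemma measurable_indic_comp d d' (T : measurableType d) (T' : measurableType d')
    (R : realType) (A : set T') (g : T -> T') :
  measurable A -> measurable_fun setT g ->
  measurable_fun setT (fun x => \1_A (g x) : R).
Proof. by move=> mA mg; apply: (measurableT_comp (measurable_indic mA) mg). Qed.

Section reflection.
Context (R : realType).
Implicit Types (A : set R) (a k x s : R).

(** Reflection at the line of slope [a] ending at height [k] sends the end point [b] to [2 * k - b].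
    For nonzero [a] it changes the drift, and the exponential is the Girsanov density that makes up
    for this. *)
Definition reflected A a k (b : R) : R := \1_A (2 * k - b) * expR (2 * a * (b - k)).

Lemma measurable_reflected A a k : measurable A -> measurable_fun setT (reflected A a k).
Proof.
move=> mA; apply: measurable_funM.
  apply: measurable_indic_comp => //.
  by apply: measurable_funB => //; exact: measurable_cst.
apply: measurableT_comp => //; apply: measurable_funM => //.
by apply: measurable_funB => //; exact: measurable_cst.
Qed.

Lemma reflected_ge0 A a k b : 0 <= reflected A a k b.
Proof. by rewrite mulr_ge0 ?expR_ge0// indicE ler0n. Qed.

(** The last exponent is the defect of the reflection principle for a path at [x] with time [s ^+ 2]
    left. It vanishes when [x] is on the line, at height [k - a * s ^+ 2], and for end points below
    [k] it has the sign of [x - (k - a * s ^+ 2)]; hence the two inequalities below. *)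
Lemma normal_pdf_reflect s a k x z : s != 0 ->
  normal_pdf 0 s (2 * (k - x) - z) * expR (2 * a * (k - x - z)) =
  normal_pdf 0 s z * expR (2 / s ^+ 2 * (k - (x + z)) * (a * s ^+ 2 - (k - x))).
Proof.
move=> s0; rewrite !normal_pdfE// /normal_fun -!mulrA -!expRD.
by congr (_ * expR _); field.
Qed.

Lemma integral_reflected A s a k x : measurable A -> s != 0 ->
  (\int[lebesgue_measure]_z ((reflected A a k (x + z))%:E * (normal_pdf 0 s z)%:E) =
   \int[lebesgue_measure]_z ((\1_A (x + z))%:E * (normal_pdf 0 s z *
     expR (2 / s ^+ 2 * (k - (x + z)) * (a * s ^+ 2 - (k - x))))%R%:E))%E.
Proof.
move=> mA s0.
rewrite (@ge0_integral_affine _ (-1) (2 * (k - x))) ?oppr_eq0 ?oner_eq0//; last 2 first.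
- apply/measurable_EFinP; apply: measurable_funM; last exact: measurable_normal_pdf.
  apply: measurableT_comp; first exact: measurable_reflected.
  by apply: measurable_funD => //; exact: measurable_cst.
- by move=> z; rewrite -EFinM lee_fin mulr_ge0 ?reflected_ge0 ?normal_pdf_ge0.
rewrite normrN1 mul1e; apply: eq_integral => z _.
rewrite -normal_pdf_reflect// -!EFinM; congr EFin.
rewrite /reflected (_ : 2 * k - _ = x + z); last by ring.
rewrite (_ : -1 * z + 2 * (k - x) = 2 * (k - x) - z); last by ring.
rewrite (_ : x + (2 * (k - x) - z) - k = k - x - z); last by ring.
by ring.
Qed.

Lemma integral_reflected_ge A s a k x : measurable A -> s != 0 ->
  (forall b, A b -> b < k) -> k - a * s ^+ 2 <= x ->
  (\int[lebesgue_measure]_z ((\1_A (x + z))%:E * (normal_pdf 0 s z)%:E) <=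
   \int[lebesgue_measure]_z ((reflected A a k (x + z))%:E * (normal_pdf 0 s z)%:E))%E.
Proof.
move=> mA s0 Ak xk; rewrite integral_reflected//.
have mAx : measurable_fun setT (fun z : R => \1_A (x + z) : R).
  apply: measurable_indic_comp => //.
  by apply: measurable_funD => //; exact: measurable_cst.
apply: ge0_le_integral => //.
- by move=> z _; rewrite -EFinM lee_fin mulr_ge0 ?normal_pdf_ge0// indicE ler0n.
- apply/measurable_EFinP; apply: measurable_funM => //; exact: measurable_normal_pdf.
- apply/measurable_EFinP; apply: measurable_funM => //.
  apply: measurable_funM; first exact: measurable_normal_pdf.
  apply: measurableT_comp => //; apply: measurable_funM => //; apply: measurable_funM => //.
  by apply: measurable_funB => //; apply: measurable_funD.
- move=> z _; rewrite -!EFinM lee_fin indicE; case: (boolP (x + z \in A)) => [|_];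
    last by rewrite !mul0r.
  rewrite inE => /Ak xz; rewrite !mul1r ler_peMr ?normal_pdf_ge0//.
  rewrite -expR0 ler_expR mulr_ge0//; last by rewrite subr_ge0 lerBlDr addrC -lerBlDr.
  by rewrite mulr_ge0 ?subr_ge0 ?ltW// divr_gt0// exprn_even_gt0.
Qed.

Lemma integral_reflected_le A s a k x : measurable A -> s != 0 ->
  (forall b, A b -> b < k) -> x <= k - a * s ^+ 2 ->
  (\int[lebesgue_measure]_z ((reflected A a k (x + z))%:E * (normal_pdf 0 s z)%:E) <=
   \int[lebesgue_measure]_z ((\1_A (x + z))%:E * (normal_pdf 0 s z)%:E))%E.
Proof.
move=> mA s0 Ak xk; rewrite integral_reflected//.
have mAx : measurable_fun setT (fun z : R => \1_A (x + z) : R).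
  apply: measurable_indic_comp => //.
  by apply: measurable_funD => //; exact: measurable_cst.
apply: ge0_le_integral => //.
- move=> z _; rewrite -EFinM lee_fin mulr_ge0 ?indicE ?ler0n//.
  by rewrite mulr_ge0 ?normal_pdf_ge0 ?expR_ge0.
- apply/measurable_EFinP; apply: measurable_funM => //.
  apply: measurable_funM; first exact: measurable_normal_pdf.
  apply: measurableT_comp => //; apply: measurable_funM => //; apply: measurable_funM => //.
  by apply: measurable_funB => //; apply: measurable_funD.
- apply/measurable_EFinP; apply: measurable_funM => //; exact: measurable_normal_pdf.
- move=> z _; rewrite -!EFinM lee_fin indicE; case: (boolP (x + z \in A)) => [|_];
    last by rewrite !mul0r.
  rewrite inE => /Ak xz; rewrite !mul1r ler_piMr ?normal_pdf_ge0//.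
  rewrite -[leRHS]expR0 ler_expR mulr_ge0_le0//; last by rewrite subr_le0 lerBrDr addrC -lerBrDr.
  by rewrite mulr_ge0 ?subr_ge0 ?ltW// divr_gt0// exprn_even_gt0.
Qed.

End reflection.

Lemma within_nonneg_continuousP (R : realType) (f : R -> R) :
  {within `[0, +oo[, continuous f} <->
  (forall x : R, 0 <= x -> forall e : R, 0 < e -> exists2 r : R, 0 < r &
     forall y : R, 0 <= y -> `|y - x| < r -> `|f y - f x| < e).
Proof.
split=> [cf x x0 e e0|cf].
  have /subspace_continuousP/(_ x) := cf.
  have x0' : `[0, +oo[%classic x by rewrite /= in_itv/= x0.
  move=> /(_ x0')/cvgrPdist_lt/(_ e e0).
  rewrite near_withinE => /nbhs_ballP[r /= r0 xr]; exists r => // y y0 yx.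
  rewrite distrC; apply: xr; last by rewrite /= in_itv/= y0.
  by rewrite /ball/= distrC.
apply/subspace_continuousP => x /=; rewrite in_itv/= andbT => x0.
apply/cvgrPdist_lt => e e0; rewrite near_withinE.
have [r r0 xr] := cf x x0 e e0.
apply/nbhs_ballP; exists r => // y /=; rewrite /ball/= => xy.
by rewrite in_itv/= andbT => y0; rewrite distrC; apply: xr => //; rewrite distrC.
Qed.

Section brownian_increments.
Context (R : realType) (d : measure_display) (T : measurableType d).
Variables (P : probability T R) (B : R -> T -> R).
Hypothesis hB : brownian_motion P B.
Implicit Types (t : nat -> R) (D : set nat).

Definition increment t (i : nat) (w : T) : R := B (t i.+1) w - B (t i) w.

Definition increment_system t D : set (set T) :=
  \bigcup_(i in D) sigma_of_fun (increment t i).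

Lemma brownian_measurable s : 0 <= s -> measurable_fun setT (B s).
Proof. by case: hB => + _ _ _ _; apply. Qed.

Lemma increment_measurable t i : (forall i, 0 <= t i) ->
  measurable_fun setT (increment t i).
Proof. by move=> t0; apply: measurable_funB; exact: brownian_measurable. Qed.

Lemma increment_system_measurable t D : (forall i, 0 <= t i) ->
  <<s increment_system t D >> `<=` measurable.
Proof.
move=> t0; apply: smallest_sub; first exact: sigma_algebra_measurable.
move=> _ [i Di [C mC <-]]; rewrite setTI.
by apply: measurable_preimage => //; exact: increment_measurable.
Qed.

Lemma increment_systems_independent t D1 D2 : 0 <= t 0%N ->
  nondecreasing_seq t -> D1 `&` D2 = set0 ->
  independent_systems P <<s increment_system t D1 >> <<s increment_system t D2 >>.
Proof.
move=> t0 nt D12; have ti i : 0 <= t i by apply: (le_trans t0); exact: nt.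
case: hB => _ _ ind _ _; apply: independent_functions_systems => //; last exact: ind.
by move=> i; exact: increment_measurable.
Qed.

Lemma measurable_increments t D m n : (m <= n)%N ->
  (forall i, (m <= i < n)%N -> D i) ->
  @measurable_fun _ _ (g_sigma_algebraType (increment_system t D)) R setT
    (fun w => B (t n) w - B (t m) w).
Proof.
elim: n => [|n ih].
  rewrite leqn0 => /eqP -> _.
  by rewrite (_ : (fun _ => _) = cst 0)//; apply/funext => w; rewrite subrr.
rewrite leq_eqVlt => /predU1P[-> _|].
  by rewrite (_ : (fun _ => _) = cst 0)//; apply/funext => w; rewrite subrr.
rewrite ltnS => mn Dmn.
rewrite (_ : (fun _ => _) = (fun w => (B (t n) w - B (t m) w) + increment t n w)); last first.
  by apply/funext => w; rewrite /increment; ring.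
apply: measurable_funD.
  by apply: ih => // i /andP[mi ni]; apply: Dmn; rewrite mi ltnS ltnW.
move=> _ C mC; apply: sub_sigma_algebra; exists n; last by exists C.
by apply: Dmn; rewrite mn ltnSn.
Qed.

(** Applied at [t] to get the path after [t], and at 0 to pass to a version that starts at 0
    everywhere and not only almost surely. *)
Lemma brownian_shift s : 0 <= s -> brownian_motion P (fun u w => B (s + u) w - B s w).
Proof.
move=> s0; case: (hB) => mB B0 ind law cB; split.
- by move=> u u0; apply: measurable_funB; apply: mB => //; rewrite addr_ge0.
- by apply: aeW => w; rewrite addr0 subrr.
- move=> t t0 nt; have := ind (fun i => s + t i).
  have -> : (fun (i : nat) w => B (s + t i.+1) w - B s w - (B (s + t i) w - B s w)) =
            (fun (i : nat) w => B (s + t i.+1) w - B (s + t i) w).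
    by apply/funext => i; apply/funext => w; ring.
  apply; first exact: addr_ge0.
  by move=> i j ij; rewrite lerD2l; exact: nt.
- move=> u v u0 uv A mA.
  rewrite (_ : v - u = (s + v) - (s + u)); last by ring.
  rewrite -law ?addr_ge0 ?ltrD2l//; congr (P (_ @^-1` A)).
  by apply/funext => w; ring.
- apply: filterS cB => w /within_nonneg_continuousP cw.
  apply/within_nonneg_continuousP => x x0 e e0.
  have [r r0 xr] := cw (s + x) (addr_ge0 s0 x0) e e0; exists r => // y y0 yx.
  rewrite (_ : _ - _ = B (s + y) w - B (s + x) w); last by ring.
  by apply: xr; rewrite ?addr_ge0// (_ : _ - _ = y - x)//; ring.
Qed.

End brownian_increments.

Section brownian_markov.
Context (R : realType) (d : measure_display) (T : measurableType d).
Variables (P : probability T R) (B : R -> T -> R).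
Hypothesis hB : brownian_motion P B.
Hypothesis B0 : forall w, B 0 w = 0.

(** The Markov property at the fixed time [t j]: [E] and [B (t j)] depend on the increments before
    [j], and [B (t N) - B (t j)] is normal and independent of them. The inequality [t j < t N] is
    strict because [normal_prob] with deviation 0 is no Dirac mass. *)
Lemma brownian_restart (t : nat -> R) (j N : nat) (E : set T) (g : R -> \bar R) :
  t 0%N = 0 -> nondecreasing_seq t -> (j <= N)%N -> t j < t N ->
  <<s increment_system B t [set i | (i < j)%N] >> E ->
  measurable_fun setT g -> (forall x, (0 <= g x)%E) ->
  (\int[P]_w ((\1_E w)%:E * g (B (t N) w)) =
   \int[P]_w ((\1_E w)%:E * \int[lebesgue_measure]_z
     (g (B (t j) w + z)%R * (normal_pdf 0 (Num.sqrt (t N - t j)) z)%:E)))%E.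
Proof.
move=> t00 nt jN tjN sE mg g0.
have ti i : 0 <= t i by rewrite -t00; exact: nt.
pose past := increment_system B t [set i | (i < j)%N].
pose Z w := B (t N) w - B (t j) w.
have mZ : measurable_fun setT Z by apply: measurable_funB; exact: (brownian_measurable hB).
(* The past as a random variable: the identity into [T] equipped with the sigma-algebra of the
   increments before [j]. *)
have mX : @measurable_fun _ _ T (g_sigma_algebraType past) setT id.
  by move=> _ A sA; rewrite setTI; exact: (increment_system_measurable hB) sA.
have mBj : @measurable_fun _ _ (g_sigma_algebraType past) R setT (B (t j)).
  have := @measurable_increments _ _ _ B t [set i | (i < j)%N] 0 j.
  rewrite t00 => /(_ isT (fun i => id)).
  by congr measurable_fun; apply/funext => w; rewrite B0 subr0.
pose f (x : g_sigma_algebraType past * R) := ((\1_E x.1)%:E * g (B (t j) x.1 + x.2)%R)%E.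
have mf : measurable_fun setT f.
  apply: emeasurable_funM.
    apply/measurable_EFinP.
    by apply: (@measurable_indic_comp _ _ _ (g_sigma_algebraType past) R E fst).
  have m2 : measurable_fun setT
      (fun x : g_sigma_algebraType past * R => B (t j) x.1 + x.2).
    by apply: measurable_funD => //; apply: (measurableT_comp mBj).
  exact: (measurableT_comp mg m2).
have f0 x : (0 <= f x)%E by rewrite /f mule_ge0// lee_fin indicE ler0n.
have ind A C : measurable A -> measurable C ->
    P ((id : T -> g_sigma_algebraType past) @^-1` A `&` Z @^-1` C) =
    (P ((id : T -> g_sigma_algebraType past) @^-1` A) * P (Z @^-1` C))%E.
  move=> mA mC.
  apply: (@increment_systems_independent _ _ _ _ _ hB t
    [set i | (i < j)%N] [set i | (j <= i)%N]) => //.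
  - by apply/seteqP; split => // i /= [ij ji]; have := leq_trans ij ji; rewrite ltnn.
  - have := @measurable_increments _ _ _ B t [set i | (j <= i)%N] j N jN.
    move=> /(_ (fun i ij => proj1 (andP ij)))/(_ measurableT C mC).
    by rewrite setTI.
transitivity (\int[P]_w f (w, Z w))%E.
  by apply: eq_integral => w _; rewrite /f/= /Z addrC subrK.
rewrite (integral_independent_pair mX mZ ind mf f0).
apply: eq_integral => w _.
have mgw : measurable_fun setT (fun z => g (B (t j) w + z)%R).
  by apply: (measurableT_comp mg); apply: measurable_funD => //; exact: measurable_cst.
rewrite /f/= ge0_integralZl//; last exact: (measurableT_comp mgw mZ).
congr (_ * _)%E.
apply: (ge0_integral_normal_law (f := fun z => g (B (t j) w + z)%R)) => //.
by case: hB => _ _ _ law _ A mA; rewrite -law.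
Qed.

Lemma measurable_normal_convolution (g : R -> \bar R) (s : R) :
  measurable_fun setT g -> (forall x, (0 <= g x)%E) ->
  measurable_fun setT (fun x : R => \int[lebesgue_measure]_z
     (g (x + z)%R * (normal_pdf 0 s z)%:E))%E.
Proof.
move=> mg g0.
apply: (@measurable_fun_fubini_tonelli_F _ _ R (measurableTypeR R) R lebesgue_measure
  (fun x => g (x.1 + x.2)%R * (normal_pdf 0 s x.2)%:E)%E) => /=.
- apply: emeasurable_funM.
    have m2 : measurable_fun setT (fun x : R * measurableTypeR R => x.1 + x.2 : R).
      by apply: measurable_funD; [exact: measurable_fst|exact: measurable_snd].
    exact: (measurableT_comp mg m2).
  apply/measurable_EFinP.
  by apply: (measurableT_comp (measurable_normal_pdf _ _)); exact: measurable_snd.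
- by move=> x; rewrite mule_ge0// lee_fin normal_pdf_ge0.
Qed.

Section crossing_event.
Variables (t : nat -> R) (j N : nat) (E : set T) (A : set R) (a k : R).
Hypotheses (t00 : t 0%N = 0) (nt : nondecreasing_seq t) (jN : (j <= N)%N).
Hypothesis sE : <<s increment_system B t [set i | (i < j)%N] >> E.
Hypotheses (mA : measurable A) (Ak : forall b, A b -> b < k).

Let ti i : 0 <= t i. Proof. by rewrite -t00; exact: nt. Qed.

Let mE : measurable E. Proof. exact: (increment_system_measurable hB) sE. Qed.

Let mBA : measurable (B (t N) @^-1` A).
Proof. by apply: measurable_preimage => //; exact: (brownian_measurable hB). Qed.

Let sqrt_neq0 : t j < t N -> Num.sqrt (t N - t j) != 0.
Proof. by move=> jNt; rewrite gt_eqF// sqrtr_gt0 subr_gt0. Qed.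

Let PE : (P (E `&` B (t N) @^-1` A) =
  \int[P]_w ((\1_E w)%:E * (\1_A (B (t N) w))%:E))%E.
Proof.
rewrite measure_integral_indic; last exact: measurableI.
by apply: eq_integral => w _; rewrite indicI.
Qed.

Let measurable_restart (g : R -> R) : measurable_fun setT g -> (forall x, 0 <= g x) ->
  measurable_fun setT (fun w => (\1_E w)%:E * \int[lebesgue_measure]_z
     ((g (B (t j) w + z))%:E * (normal_pdf 0 (Num.sqrt (t N - t j)) z)%:E))%E.
Proof.
move=> mg g0; apply: emeasurable_funM; first exact/measurable_EFinP/measurable_indic.
have mc := @measurable_normal_convolution (EFin \o g) (Num.sqrt (t N - t j)).
apply: (measurableT_comp (mc _ _)).
- exact/measurable_EFinP.
- by move=> x; rewrite lee_fin.
- exact: (brownian_measurable hB).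
Qed.

Lemma crossing_event_le :
  (forall w, E w -> k - a * (t N - t j) <= B (t j) w) ->
  (P (E `&` B (t N) @^-1` A) <=
   \int[P]_w ((\1_E w)%:E * (reflected A a k (B (t N) w))%:E))%E.
Proof.
move=> Ek.
(* If [t j = t N] no normal density is at hand; but then [E] forces [B (t N) >= k], and the event on
   the left is empty. *)
have [jNt|] := ltP (t j) (t N); last first.
  move=> Njt; rewrite (_ : _ `&` _ = set0) ?measure0.
    by apply: integral_ge0 => w _; rewrite mule_ge0// lee_fin ?reflected_ge0// indicE ler0n.
  apply/seteqP; split => // w [Ew /= Aw].
  have tjN : t j = t N by apply/eqP; rewrite eq_le Njt andbT; exact: nt.
  have := Ek w Ew; rewrite tjN subrr mulr0 subr0 => kB.
  by have := lt_le_trans (Ak Aw) kB; rewrite ltxx.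
have mref := measurable_reflected a k mA.
rewrite PE (brownian_restart (g := fun b => (\1_A b)%:E) t00 nt jN jNt sE); last 2 first.
- exact/measurable_EFinP/measurable_indic.
- by move=> x; rewrite lee_fin indicE ler0n.
rewrite (brownian_restart (g := fun b => (reflected A a k b)%:E) t00 nt jN jNt sE); last 2 first.
- exact/measurable_EFinP.
- by move=> x; rewrite lee_fin reflected_ge0.
apply: ge0_le_integral => //.
- move=> w _; rewrite mule_ge0 ?lee_fin ?indicE ?ler0n// integral_ge0// => z _.
  by rewrite mule_ge0// lee_fin ?normal_pdf_ge0// ?indicE ler0n.
- by apply: measurable_restart; [exact: measurable_indic|move=> x; rewrite indicE ler0n].
- by apply: measurable_restart => // x; exact: reflected_ge0.
- move=> w _; rewrite indicE; case: (boolP (w \in E)) => [|_]; last by rewrite !mul0e.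
  rewrite inE => /Ek Ekw; rewrite !mul1e; apply: integral_reflected_ge => //.
  exact: sqrt_neq0.
  by rewrite sqr_sqrtr// subr_ge0 ltW.
Qed.

Lemma crossing_event_ge :
  (forall w, E w -> B (t j) w <= k - a * (t N - t j)) ->
  (\int[P]_w ((\1_E w)%:E * (reflected A a k (B (t N) w))%:E) <=
   P (E `&` B (t N) @^-1` A))%E.
Proof.
move=> Ek.
(* If [t j = t N], then [B (t N) <= k] on [E], so [2 * k - B (t N) >= k] is outside [A] and the
   integrand vanishes. *)
have [jNt|] := ltP (t j) (t N); last first.
  move=> Njt; rewrite integral0_eq// => w _; rewrite indicE.
  case: (boolP (w \in E)) => [|_]; last by rewrite mul0e.
  rewrite inE => /Ek; rewrite mul1e => kB.
  have tjN : t j = t N by apply/eqP; rewrite eq_le Njt andbT; exact: nt.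
  congr EFin; rewrite /reflected indicE memNset ?mul0r// => /Ak.
  by move: kB; rewrite tjN; lra.
have mref := measurable_reflected a k mA.
rewrite PE (brownian_restart (g := fun b => (\1_A b)%:E) t00 nt jN jNt sE); last 2 first.
- exact/measurable_EFinP/measurable_indic.
- by move=> x; rewrite lee_fin indicE ler0n.
rewrite (brownian_restart (g := fun b => (reflected A a k b)%:E) t00 nt jN jNt sE); last 2 first.
- exact/measurable_EFinP.
- by move=> x; rewrite lee_fin reflected_ge0.
apply: ge0_le_integral => //.
- move=> w _; rewrite mule_ge0 ?lee_fin ?indicE ?ler0n// integral_ge0// => z _.
  by rewrite mule_ge0// lee_fin ?normal_pdf_ge0// reflected_ge0.
- by apply: measurable_restart => // x; exact: reflected_ge0.
- by apply: measurable_restart; [exact: measurable_indic|move=> x; rewrite indicE ler0n].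
- move=> w _; rewrite indicE; case: (boolP (w \in E)) => [|_]; last by rewrite !mul0e.
  rewrite inE => /Ek Ekw; rewrite !mul1e; apply: integral_reflected_le => //.
  exact: sqrt_neq0.
  by rewrite sqr_sqrtr// subr_ge0 ltW.
Qed.

End crossing_event.

End brownian_markov.

(** * Dyadic times and continuous paths *)

Section dyadic_grid.
Context (R : realType).
Implicit Types (a k t r e : R) (f : R -> R).

(** The index is not limited to [2 ^ n]: the grid of level [n] runs over the whole half-line and has
    [t] among its points, so one family serves both the past and the future of [t]. *)
Definition dyadic t (n i : nat) : R := t * i%:R / 2 ^+ n.

Lemma dyadic0 t n : dyadic t n 0 = 0.
Proof. by rewrite /dyadic mulr0 mul0r. Qed.

Lemma dyadic_last t n : dyadic t n (2 ^ n) = t.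
Proof. by rewrite /dyadic natrX mulfK// expf_neq0// pnatr_eq0. Qed.

Lemma dyadicS t n i : dyadic t n.+1 (2 * i) = dyadic t n i.
Proof. by rewrite /dyadic natrM exprS; field; rewrite expf_neq0// pnatr_eq0. Qed.

Lemma dyadicB t n i : dyadic t n i.+1 - dyadic t n i = t / 2 ^+ n.
Proof. by rewrite /dyadic -natr1; field; rewrite expf_neq0// pnatr_eq0. Qed.

Lemma dyadic_nondecreasing t n : 0 <= t -> nondecreasing_seq (dyadic t n).
Proof.
move=> t0 i j ij; rewrite /dyadic ler_pM2r ?invr_gt0 ?exprn_gt0//.
by rewrite ler_wpM2l// ler_nat.
Qed.

Lemma dyadic_ge0 t n i : 0 <= t -> 0 <= dyadic t n i.
Proof. by move=> t0; rewrite -(dyadic0 t n) dyadic_nondecreasing. Qed.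

Lemma dyadic_le t n i : 0 <= t -> (i <= 2 ^ n)%N -> dyadic t n i <= t.
Proof. by move=> t0 i2; rewrite -[leRHS](dyadic_last t n) dyadic_nondecreasing. Qed.

Lemma dyadic_lt t n i : 0 < t -> (i < 2 ^ n)%N -> dyadic t n i < t.
Proof.
move=> t0 i2; rewrite -[ltRHS](dyadic_last t n) /dyadic.
by rewrite ltr_pM2r ?invr_gt0 ?exprn_gt0// ltr_pM2l// ltr_nat.
Qed.

Lemma dyadic_mesh t r : 0 <= t -> 0 < r ->
  exists m, forall n, (m <= n)%N -> t / 2 ^+ n < r.
Proof.
move=> t0 r0; exists (Num.truncn (t / r)).+1 => n mn.
rewrite ltr_pdivrMr ?exprn_gt0// mulrC -ltr_pdivrMr//.
apply: (lt_le_trans (truncnS_gt _)).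
rewrite -natrX ler_nat (leq_trans mn)// ltnW// ltn_expl//.
Qed.

(** Approximation from the right keeps the dyadic time nonnegative and, when [r = t - x], before
    [t]. *)
Lemma dyadic_right_dense t x r : 0 < t -> 0 <= x -> 0 < r ->
  exists n i, x <= dyadic t n i < x + r.
Proof.
move=> t0 x0 r0; have [m /(_ m (leqnn m)) tm] := dyadic_mesh (ltW t0) r0.
have c0 : 0 < t / 2 ^+ m by rewrite divr_gt0// exprn_gt0.
have [->|x_neq0] := eqVneq x 0.
  by exists 0%N, 0%N; rewrite dyadic0 lexx add0r.
pose i := Num.truncn (x / (t / 2 ^+ m)).
have xc0 : 0 <= x / (t / 2 ^+ m) by rewrite divr_ge0// ltW.
exists m, i.+1; apply/andP; split.
  have := truncnS_gt (x / (t / 2 ^+ m)).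
  by rewrite ltr_pdivrMr// => /ltW /le_trans; apply; rewrite /dyadic -/i mulrAC mulrC.
have := truncn_le (x / (t / 2 ^+ m)); rewrite xc0 ler_pdivlMr// -/i => ix.
rewrite -(subrK (dyadic t m i) (dyadic t m i.+1)) dyadicB addrC ler_ltD//.
by rewrite /dyadic mulrAC mulrC.
Qed.

Lemma dyadic_uniform f t e : {within `[0, +oo[, continuous f} -> 0 <= t -> 0 < e ->
  exists m, forall n, (m <= n)%N -> forall i, (i < 2 ^ n)%N ->
    `|f (dyadic t n i.+1) - f (dyadic t n i)| < e.
Proof.
move=> /within_nonneg_continuousP cf t0 e0.
have := @segment_compact R 0 t; move/compact_near_coveringP.
(* Uniform continuity by compactness of [[0, t]]: around each point a single mesh serves all nearby
   centres, hence a single mesh serves the segment. *)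
move=> /(_ nat \oo (fun n x => 0 <= x -> forall y, 0 <= y -> `|y - x| <= t / 2 ^+ n -> `|f y - f x| < e)).
case=> [x|m _ Hm].
  rewrite /= in_itv/= => /andP[x0 _].
  have e20 : 0 < e / 2 by rewrite divr_gt0.
  have [r r0 xr] := cf x x0 (e / 2) e20.
  have r20 : 0 < r / 2 by rewrite divr_gt0.
  have [m Hm] := dyadic_mesh t0 r20.
  exists (ball x (r / 2), [set n | (m <= n)%N]).
    by split; [exact: nbhsx_ballx|exists m].
  move=> [x' n] [/= xx' mn] x'0 y y0 yx'; have {}xx' : `|x - x'| < r / 2 := xx'.
  have fx' : `|f x' - f x| < e / 2 by apply: xr => //; move: xx'; rewrite distrC; lra.
  have fy : `|f y - f x| < e / 2.
    apply: xr => //; rewrite -(subrK x' y) -addrA.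
    rewrite (le_lt_trans (ler_normD _ _))//.
    by have := Hm n mn; move: xx' yx'; rewrite distrC; lra.
  rewrite -(subrK (f x) (f y)) -addrA (le_lt_trans (ler_normD _ _))// (distrC (f x)).
  by lra.
exists m => n mn i i2.
have := Hm n mn (dyadic t n i); rewrite /= in_itv/= dyadic_ge0//= dyadic_le//; last exact: ltnW.
move=> /(_ isT isT (dyadic t n i.+1)); rewrite dyadic_ge0// dyadicB ger0_norm ?lexx; first exact.
by rewrite divr_ge0// exprn_ge0.
Qed.

Lemma subr_affine_continuous f a k t : {within `[0, +oo[, continuous f} ->
  {within `[0, +oo[, continuous (fun u => f u - (k - a * (t - u)))}.
Proof.
move/within_nonneg_continuousP => cw; apply/within_nonneg_continuousP.
move=> x x0 e e0; have e20 : 0 < e / 2 by rewrite divr_gt0.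
have [r r0 xr] := cw x x0 _ e20.
have a0 : 0 < `|a| + 1 by rewrite ltr_wpDl.
exists (Num.min r (e / 2 / (`|a| + 1))); first by rewrite lt_min r0 divr_gt0.
move=> y y0; rewrite lt_min => /andP[yr yea].
rewrite (_ : _ - _ = (f y - f x) - a * (y - x)); last by ring.
apply: (le_lt_trans (ler_normB _ _)); rewrite (splitr e) ltrD//; first exact: xr.
rewrite normrM (@le_lt_trans _ _ ((`|a| + 1) * `|y - x|))//.
  by rewrite ler_wpM2r// lerDl.
by rewrite mulrC -ltr_pdivlMr.
Qed.

Lemma dyadic_positive f t x r : {within `[0, +oo[, continuous f} -> 0 < t ->
  0 <= x -> 0 < r -> 0 < f x -> exists n i, x <= dyadic t n i < x + r /\ 0 < f (dyadic t n i).
Proof.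
move=> /within_nonneg_continuousP cf t0 x0 r0 fx0.
have [r' r'0 xr'] := cf x x0 (f x) fx0.
have m0 : 0 < Num.min r r' by rewrite lt_min r0.
have [n [i /andP[xi ir]]] := dyadic_right_dense t0 x0 m0.
exists n, i; split.
  by rewrite xi (lt_le_trans ir)// lerD2l ge_min lexx.
have := xr' (dyadic t n i) (le_trans x0 xi).
have -> : `|dyadic t n i - x| < r'.
  by rewrite ger0_norm ?subr_ge0// ltrBlDl (lt_le_trans ir)// lerD2l ge_min lexx orbT.
by move=> /(_ isT); rewrite ltr_norml => /andP[+ _]; rewrite ltrBrDl addrN.
Qed.

Lemma crossed_dyadic f a k t : {within `[0, +oo[, continuous f} -> 0 < t ->
  (exists s, 0 <= s <= t /\ k - a * (t - s) < f s) ->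
  exists n j, (j <= 2 ^ n)%N /\ k - a * (t - dyadic t n j) < f (dyadic t n j).
Proof.
move=> cf t0 [s [/andP[s0 st] ks]].
move: st; rewrite le_eqVlt => /predU1P[st|st].
  exists 0%N, 1%N; split => //; have := dyadic_last t 0; rewrite expn0 => ->.
  by rewrite -st in ks *.
have cX := @subr_affine_continuous f a k t cf.
have [||n [i [/andP[sd ds] Bd]]] := dyadic_positive cX t0 s0 (r := t - s).
- by rewrite subr_gt0.
- by rewrite subr_gt0.
exists n, i; split; last by rewrite subr_gt0 in Bd.
rewrite leqNgt; apply/negP => ni; move: ds; rewrite addrC subrK; apply/negP.
by rewrite -leNgt -[leLHS](dyadic_last t n); apply: (dyadic_nondecreasing n (ltW t0)); exact: ltnW.
Qed.

End dyadic_grid.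

Arguments subr_affine_continuous {R f} a k t.

Section measure_extra.
Context (R : realType) (d : measure_display) (T : measurableType d).
Implicit Types (mu : {measure set T -> \bar R}) (C S : set T).

Lemma le_measure_ae mu C S : measurable C -> measurable S ->
  {ae mu, forall w, C w -> S w} -> (mu C <= mu S)%E.
Proof.
move=> mC mS [N [mN N0 CN]].
apply: (@le_trans _ _ (mu (S `|` N))).
  apply: le_measure; rewrite ?inE//; first exact: measurableU.
  move=> w Cw; have [Sw|nSw] := pselect (S w); first by left.
  by right; apply: CN => /= /(_ Cw).
by rewrite measureU0.
Qed.

Lemma eq_measure_ae mu C S : measurable C -> measurable S ->
  {ae mu, forall w, C w <-> S w} -> mu C = mu S.
Proof.
move=> mC mS CS; apply/eqP; rewrite eq_le !le_measure_ae//.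
- by apply: filterS CS => w [].
- by apply: filterS CS => w [].
Qed.

Lemma measure_bigcup_le mu (F : (set T)^nat) (c : \bar R) :
  nondecreasing_seq F -> (forall n, measurable (F n)) ->
  (forall n, mu (F n) <= c)%E -> (mu (\bigcup_n F n) <= c)%E.
Proof.
move=> nF mF Fc.
have := nondecreasing_cvg_mu (mu := mu) mF (bigcupT_measurable _ mF) nF.
move=> Fcvg; rewrite -(cvg_lim _ Fcvg)//.
by apply: lime_le; [exact: cvgP Fcvg|exact: nearW].
Qed.

Lemma integral_bigcup_le mu (F : (set T)^nat) (f : T -> \bar R) (c : \bar R) :
  nondecreasing_seq F -> (forall n, measurable (F n)) ->
  measurable_fun setT f -> (forall x, 0 <= f x)%E ->
  (forall n, \int[mu]_(x in F n) f x <= c)%E ->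
  (\int[mu]_(x in \bigcup_n F n) f x <= c)%E.
Proof.
move=> nF mF mf f0 Fc.
have Fcvg : (\int[mu]_(x in F i) f x @[i --> \oo] --> \int[mu]_(x in \bigcup_i F i) f x)%E.
  by apply: ge0_nondecreasing_set_cvg_integral => // i; exact: measurable_funTS.
rewrite -(cvg_lim _ Fcvg)//.
by apply: lime_le; [exact: cvgP Fcvg|exact: nearW].
Qed.

Lemma integral_indicM mu C (g : T -> \bar R) : measurable C ->
  (\int[mu]_w ((\1_C w)%:E * g w) = \int[mu]_(w in C) g w)%E.
Proof.
move=> mC; rewrite [RHS]integral_mkcond; apply: eq_integral => w _.
by rewrite patchE indicE; case: ifPn; rewrite ?mul1e ?mul0e.
Qed.

End measure_extra.

(** * Crossing of a line seen on a grid *)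

Section grid_crossing.
Context (R : realType) (d : measure_display) (T : measurableType d).
Variables (P : probability T R) (B : R -> T -> R).
Hypothesis hB : brownian_motion P B.
Hypothesis B0 : forall w, B 0 w = 0.
Variables (t : nat -> R) (N : nat) (A : set R) (a k : R).
Hypotheses (t00 : t 0%N = 0) (nt : nondecreasing_seq t).
Hypotheses (mA : measurable A) (Ak : forall b, A b -> b < k).

Let ti i : 0 <= t i. Proof. by rewrite -t00; exact: nt. Qed.

Let past j := increment_system B t [set i | (i < j)%N].
Let line j := k - a * (t N - t j).

Let past_threshold i j (x : R) : (i <= j)%N -> <<s past j >> [set w | x < B (t i) w].
Proof.
move=> ij; have := @measurable_increments _ _ _ B t [set i | (i < j)%N] 0 i isT.
have Di l : (0 <= l < i)%N -> (l < j)%N by move=> /= li; exact: leq_trans li ij.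
move=> /(_ Di)/(_ measurableT `]x, +oo[%classic (measurable_itv _)).
rewrite setTI t00; congr (smallest _ _ _); apply/seteqP.
by split => w /=; rewrite in_itv/= andbT B0 subr0.
Qed.

Let mBA : measurable (B (t N) @^-1` A).
Proof. by apply: measurable_preimage => //; exact: (brownian_measurable hB). Qed.

Let mref : measurable_fun setT (fun w => (reflected A a k (B (t N) w))%:E).
Proof.
apply/measurable_EFinP; apply: (measurableT_comp (measurable_reflected a k mA)).
exact: (brownian_measurable hB).
Qed.

Let mpast j E : <<s past j >> E -> measurable E.
Proof. by move=> sE; exact: (increment_system_measurable hB) sE. Qed.

(** The line is lowered by [e]. As the sets are empty beyond [N], [seqDU] splits the crossing event
    by the index of the first crossing, and each piece is known from the increments before that
    index. *)
Let crossing (e : R) i :=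
  if (i <= N)%N then [set w | line i - e < B (t i) w] else set0.

Let first_crossing (e : R) := seqDU (crossing e).

Let first_crossing_past e j : <<s past j >> (first_crossing e j).
Proof.
have h i : (i <= j)%N ->
    @measurable _ (g_sigma_algebraType (past j))
    (crossing e i).
  by move=> ij; rewrite /crossing; case: ifP => _; [exact: past_threshold|exact: measurable0].
apply: (@measurableD _ (g_sigma_algebraType (past j))); first exact: h.
by apply: bigsetU_measurable => i _; apply: h; exact: ltnW.
Qed.

(** At the first grid point above the line the path has overshot it, which is the side on which
    [crossing_event_le] holds; the bounds are summed over the first index. *)
Lemma grid_crossing_le :
  (P ([set w | exists2 j, (j <= N)%N & (line j < B (t j) w)%R] `&` B (t N) @^-1` A) <=
   \int[P]_w (reflected A a k (B (t N) w))%:E)%E.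
Proof.
have -> : [set w | exists2 j, (j <= N)%N & line j < B (t j) w] =
    \bigcup_j first_crossing 0 j.
  rewrite -seqDU_bigcup_eq; apply/seteqP; split => w /=.
    by move=> [j jN lj]; exists j => //; rewrite /crossing jN /= subr0.
  by move=> [j _]; rewrite /crossing; case: ifP => //= jN; rewrite subr0 => lj; exists j.
have tE : trivIset setT (first_crossing 0) by exact: trivIset_seqDU.
have mE j : measurable (first_crossing 0 j) by apply: mpast; exact: first_crossing_past.
rewrite setI_bigcupl measure_bigcup//; last 2 first.
- by move=> j _; exact: measurableI.
- exact: trivIset_setIr.
apply: (@le_trans _ _ (\sum_(j <oo) \int[P]_(w in first_crossing 0 j)
    (reflected A a k (B (t N) w))%:E)%E); last first.
  rewrite -ge0_integral_bigcup//.
  - apply: ge0_subset_integral => //; first exact: bigcupT_measurable.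
    by move=> w _; rewrite lee_fin reflected_ge0.
  - exact: measurable_funTS.
  - by move=> w _; rewrite lee_fin reflected_ge0.
rewrite (eq_eseriesl (Q := xpredT)); last by move=> j; rewrite in_setT.
apply: lee_nneseries => // j _.
rewrite -integral_indicM//.
have [jN|Nj] := leqP j N; last first.
  rewrite /first_crossing /seqDU /crossing leqNgt Nj/= set0D set0I measure0.
  by apply: integral_ge0 => w _; rewrite mule_ge0// lee_fin ?reflected_ge0// indicE ler0n.
apply: (crossing_event_le hB B0 t00 nt jN) => //; first exact: first_crossing_past.
by move=> w [+ _] /=; rewrite /crossing jN /= subr0 => /ltW.
Qed.

(** The domain of integration holds the paths that are still not above the line itself when they
    first pass the lowered one, so that [crossing_event_ge] applies at that index. *)
Lemma grid_crossing_ge (e : R) :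
  (\int[P]_(w in [set w | exists2 j, (j <= N)%N &
       (line j - e < B (t j) w <= line j)%R /\
       forall i, (i < j)%N -> (B (t i) w <= line i - e)%R])
     (reflected A a k (B (t N) w))%:E <=
   P ([set w | exists2 j, (j <= N)%N & (line j - e < B (t j) w)%R] `&` B (t N) @^-1` A))%E.
Proof.
pose E j := first_crossing e j `&` [set w | B (t j) w <= line j].
have pE j : <<s past j >> (E j).
  apply: (@measurableI _ (g_sigma_algebraType (past j))).
    exact: first_crossing_past.
  rewrite (_ : [set w | _] = ~` [set w | line j < B (t j) w]); last first.
    by apply/seteqP; split => w /=; rewrite leNgt => /negP.
  by apply: (@measurableC _ (g_sigma_algebraType (past j))); exact: past_threshold.
have mE j : measurable (E j) by exact: mpast (pE j).
have tE : trivIset setT E.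
  by apply: trivIset_setIr; exact: trivIset_seqDU.
rewrite (_ : [set w | exists2 j, _ & _ /\ _] = \bigcup_j E j); last first.
  apply/seteqP; split => w /=.
    move=> [j jN [/andP[lj jl] ij]]; exists j => //; split => //; split; first by rewrite /crossing jN.
    rewrite -bigcup_mkord => -[i /= ilj]; rewrite /crossing; case: ifP => //= iN.
    by rewrite ltNge ij.
  move=> [j _ [[+ nij] jl]]; rewrite /crossing; case: ifP => //= jN lj; exists j => //; split; first by rewrite lj.
  move=> i ij; rewrite leNgt; apply/negP => li; apply: nij.
  by rewrite -bigcup_mkord; exists i => //=; rewrite /crossing (leq_trans (ltnW ij)).
rewrite ge0_integral_bigcup//; last 2 first.
- exact: measurable_funTS.
- by move=> w _; rewrite lee_fin reflected_ge0.
apply: (@le_trans _ _ (P (\bigcup_j E j `&` B (t N) @^-1` A))); last first.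
  apply: le_measure; rewrite ?inE.
  - by apply: measurableI => //; exact: bigcupT_measurable.
  - apply: measurableI => //.
    rewrite (_ : [set w | _] = \bigcup_j first_crossing e j); last first.
      rewrite -seqDU_bigcup_eq; apply/seteqP; split => w /=.
        by move=> [j jN lj]; exists j => //; rewrite /crossing jN.
      by move=> [j _]; rewrite /crossing; case: ifP => //= jN lj; exists j.
    by apply: bigcupT_measurable => j; apply: mpast; exact: first_crossing_past.
  - apply: setSI => w [j _ [[+ _] _]]; rewrite /crossing; case: ifP => //= jN lj; by exists j.
rewrite setI_bigcupl measure_bigcup//; last 2 first.
- by move=> j _; exact: measurableI.
- exact: trivIset_setIr.
rewrite [leRHS](eq_eseriesl (Q := xpredT)); last by move=> j; rewrite in_setT.
apply: lee_nneseries => j _.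
  by move=> _; apply: integral_ge0 => w _; rewrite lee_fin reflected_ge0.
rewrite -integral_indicM//.
have [jN|Nj] := leqP j N; last first.
  rewrite integral0_eq// => w _; rewrite indicE memNset ?mul0e//.
  by move=> [[+ _] _]; rewrite /crossing leqNgt Nj.
apply: (crossing_event_ge hB B0 t00 nt jN) => //; first exact: pE.
by move=> w [].
Qed.

End grid_crossing.

(** * Crossing of a line in continuous time *)

Section line_crossing.
Context (R : realType) (d : measure_display) (T : measurableType d).
Variables (P : probability T R) (B : R -> T -> R).
Hypothesis hB : brownian_motion P B.
Hypothesis B0 : forall w, B 0 w = 0.
Implicit Types (a k t s e : R) (A : set R) (C : set T).

(* P(B(t) in A and B(s) > k - a (t - s) for some s <= t), provided that
   A is contained in ]-oo, k[ and k - a t >= 0. *)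
Definition crossing_mass (A : set R) (a k t : R) : \bar R :=
  (\int[lebesgue_measure]_b ((\1_A b)%:E * (normal_pdf 0 (Num.sqrt t) b *
    expR (- (2 / t * (k - b) * (k - a * t))))%R%:E))%E.

Lemma brownian_law t A : 0 < t -> measurable A ->
  P (B t @^-1` A) = normal_prob 0 (Num.sqrt t) A.
Proof.
move=> t0 mA; case: hB => _ _ _ law _.
have := law 0 t (lexx 0) t0 A mA; rewrite subr0 => <-.
by congr (P (_ @^-1` A)); apply/funext => w; rewrite B0 subr0.
Qed.

(** This is [integral_reflected] with [x = 0] and [s ^+ 2 = t]. The bounds on a grid thus have a
    value that does not depend on the grid, and they pass to the limit. *)
Lemma integral_reflected_brownian A a k t : 0 < t -> measurable A ->
  (\int[P]_w (reflected A a k (B t w))%:E = crossing_mass A a k t)%E.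
Proof.
move=> t0 mA; have s0 : Num.sqrt t != 0 by rewrite gt_eqF// sqrtr_gt0.
have mref : measurable_fun setT (fun b => (reflected A a k b)%:E).
  by apply/measurable_EFinP; exact: measurable_reflected.
rewrite (ge0_integral_normal_law (m := 0) (s := Num.sqrt t) (f := fun b => (reflected A a k b)%:E))//.
- have := integral_reflected a k 0 mA s0; under eq_integral do rewrite add0r.
  move=> ->; apply: eq_integral => b _; rewrite add0r sqr_sqrtr ?ltW// subr0.
  by congr (_ * (_ * expR _)%R%:E)%E; ring.
- by apply: (brownian_measurable hB); exact: ltW.
- by move=> C mC; exact: brownian_law.
- by move=> b; rewrite lee_fin reflected_ge0.
Qed.

Let measurable_cross t a k : 0 <= t -> forall s, 0 <= s ->
  measurable [set w | k - a * (t - s) < B s w].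
Proof.
move=> t0 s s0; rewrite (_ : [set w | _] = B s @^-1` `]k - a * (t - s), +oo[%classic).
  apply: measurable_preimage => //; exact: (brownian_measurable hB).
by apply/seteqP; split => w /=; rewrite in_itv/= andbT.
Qed.

Let grid_crossed t a k n :=
  [set w | exists2 j, (j <= 2 ^ n)%N & k - a * (t - dyadic t n j) < B (dyadic t n j) w].

Let measurable_grid_crossed t a k n : 0 <= t -> measurable (grid_crossed t a k n).
Proof.
move=> t0; rewrite (_ : grid_crossed _ _ _ _ = \bigcup_(j in [set j | (j <= 2 ^ n)%N])
    [set w | k - a * (t - dyadic t n j) < B (dyadic t n j) w]).
  by apply: bigcup_measurable => j _; apply: measurable_cross => //; exact: dyadic_ge0.
by apply/seteqP; split => w /= [j]; exists j.
Qed.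

Let grid_crossed_nd t a k : nondecreasing_seq (grid_crossed t a k).
Proof.
apply/nondecreasing_seqP => n; apply/subsetPset => w [j jN jw].
by exists (2 * j)%N; rewrite ?dyadicS// expnS leq_mul2l.
Qed.

Let crossed_grid t a k w : {within `[0, +oo[, continuous (B ^~ w)} -> 0 < t ->
  (exists s, 0 <= s <= t /\ k - a * (t - s) < B s w) ->
  exists n, grid_crossed t a k n w.
Proof.
by move=> cw t0 /(crossed_dyadic cw t0)[n [j [jn jB]]]; exists n, j.
Qed.

(** A measurable [C] stands for the crossing event because the latter, over uncountably many times,
    need not be measurable. By continuity a crossing is seen on some dyadic grid, and the grids
    increase. *)
Lemma line_crossing_le A C a k t : 0 < t -> measurable A -> (forall b, A b -> b < k) ->
  measurable C ->
  {ae P, forall w, C w -> A (B t w) /\ exists s, 0 <= s <= t /\ k - a * (t - s) < B s w} ->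
  (P C <= crossing_mass A a k t)%E.
Proof.
move=> t0 mA Ak mC CA.
have mBA : measurable (B t @^-1` A).
  by apply: measurable_preimage => //; exact: (brownian_measurable hB) (ltW t0).
apply: (@le_trans _ _ (P (\bigcup_n (grid_crossed t a k n `&` B t @^-1` A)))).
  apply: le_measure_ae => //.
    apply: bigcupT_measurable => n; apply: measurableI => //.
    by apply: measurable_grid_crossed; exact: ltW.
  case: hB => _ _ _ _ cB; apply: filterS2 CA cB => w CA cw /CA[Aw ksw].
  by have [n nw] := crossed_grid cw t0 ksw; exists n.
apply: measure_bigcup_le.
- move=> m n mn; apply/subsetPset; apply: setSI; exact/subsetPset/grid_crossed_nd.
- by move=> n; apply: measurableI => //; apply: measurable_grid_crossed; exact: ltW.
- move=> n; rewrite -integral_reflected_brownian//.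
  have := grid_crossing_le hB B0 (t := dyadic t n) (2 ^ n) a (dyadic0 t n)
    (dyadic_nondecreasing n (ltW t0)) mA Ak.
  by rewrite dyadic_last.
Qed.

Let shallow_crossing t a k e n := [set w | exists2 j, (j <= 2 ^ n)%N &
  k - a * (t - dyadic t n j) - e < B (dyadic t n j) w <= k - a * (t - dyadic t n j) /\
  forall i, (i < j)%N ->
    B (dyadic t n i) w <= k - a * (t - dyadic t n i) - e].

Let measurable_shallow_crossing t a k e n : 0 <= t ->
  measurable (shallow_crossing t a k e n).
Proof.
move=> t0; have mBn x j : measurable [set w | x < B (dyadic t n j) w].
  rewrite (_ : [set w | _] = B (dyadic t n j) @^-1` `]x, +oo[%classic).
    by apply: measurable_preimage => //; apply: (brownian_measurable hB); exact: dyadic_ge0.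
  by apply/seteqP; split => w /=; rewrite in_itv/= andbT.
have mBn' x j : measurable [set w | B (dyadic t n j) w <= x].
  rewrite (_ : [set w | _] = ~` [set w | x < B (dyadic t n j) w]); first exact: measurableC.
  by apply/seteqP; split => w /=; rewrite leNgt => /negP.
rewrite (_ : shallow_crossing _ _ _ _ _ = \bigcup_(j in [set j | (j <= 2 ^ n)%N])
    ([set w | k - a * (t - dyadic t n j) - e < B (dyadic t n j) w] `&`
     [set w | B (dyadic t n j) w <= k - a * (t - dyadic t n j)] `&`
     \bigcap_(i in [set i | (i < j)%N])
        [set w | B (dyadic t n i) w <= k - a * (t - dyadic t n i) - e])).
  apply: bigcup_measurable => j _; apply: measurableI; first exact: measurableI.
  by apply: bigcap_measurableType => i _.
apply/seteqP; split => w /= [j jn].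
  by move=> [/andP[lj jl] ij]; exists j.
by move=> [[/= lj jl] ij]; exists j => //; split; [rewrite lj|].
Qed.

(** The path does not start above the lowered line, and it ends above [k]. On a fine grid its
    increments relative to the line are less than [e], so the first passage of the lowered line
    cannot jump over the line. *)
Let crossed_shallow t a k e w : {within `[0, +oo[, continuous (B ^~ w)} ->
  0 < t -> 0 < e -> e <= k - a * t -> k < B t w ->
  exists m, forall n, (m <= n)%N -> shallow_crossing t a k e n w.
Proof.
move=> cw t0 e0 ekt kB.
have [m Hm] := dyadic_uniform (subr_affine_continuous a k t cw) (ltW t0) e0.
exists m => n mn.
have ex_cross : exists j, (j <= 2 ^ n)%N && (k - a * (t - dyadic t n j) - e < B (dyadic t n j) w).
  by exists (2 ^ n)%N; rewrite leqnn/= dyadic_last subrr mulr0 subr0; lra.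
case: (ex_minnP ex_cross) => j /andP[jn lj] j_min.
have ij i : (i < j)%N -> B (dyadic t n i) w <= k - a * (t - dyadic t n i) - e.
  move=> ij; rewrite leNgt; apply/negP => li.
  by have := j_min i; rewrite (leq_trans (ltnW ij) jn) li => /(_ isT); rewrite leqNgt ij.
exists j => //; split => //; rewrite lj/=.
case: j => [|j] in jn lj j_min ij *; first by rewrite dyadic0 B0 subr0 subr_ge0; lra.
have := Hm n mn j jn; have := ij j (ltnSn j).
by rewrite ltr_norml => ? /andP[_ ?]; lra.
Qed.

Let line_crossing_ge_strict A C a k t e : 0 < t -> 0 < e -> e <= k - a * t ->
  measurable A -> (forall b, A b -> b < k) -> measurable C ->
  {ae P, forall w, (exists s, 0 <= s <= t /\ k - a * (t - s) - e < B s w) ->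
     A (B t w) -> C w} ->
  (crossing_mass A a k t <= P C)%E.
Proof.
move=> t0 e0 ekt mA Ak mC CA; rewrite -integral_reflected_brownian//.
have mBt := brownian_measurable hB (ltW t0).
have mref : measurable_fun setT (fun w => (reflected A a k (B t w))%:E).
  by apply/measurable_EFinP; apply: (measurableT_comp (measurable_reflected a k mA)).
have ref0 w : (0 <= (reflected A a k (B t w))%:E)%E by rewrite lee_fin reflected_ge0.
pose G m := \bigcap_(n in [set n | (m <= n)%N]) shallow_crossing t a k e n.
have mG m : measurable (G m).
  by apply: bigcap_measurableType => n _; apply: measurable_shallow_crossing; exact: ltW.
(* For [A] below [k], [reflected] vanishes unless [B t w > k], and almost every such path is a
   shallow crossing at all fine levels; hence the union of the [G m] carries the whole integral. *)
apply: (@le_trans _ _ (\int[P]_(w in \bigcup_m G m) (reflected A a k (B t w))%:E)%E).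
  rewrite [leRHS]integral_mkcond.
  apply: ae_ge0_le_integral => //.
  - by move=> w _; apply: erestrict_ge0.
  - by apply/(measurable_restrictT _ _).1; [exact: bigcupT_measurable|exact: measurable_funTS].
  case: hB => _ _ _ _ cB; apply: filterS cB => w cw _.
  rewrite patchE; case: ifPn => // /negP nG.
  rewrite /reflected indicE memNset ?mul0r// => /Ak kB; apply: nG.
  have [|m Hm] := crossed_shallow cw t0 e0 ekt; first by lra.
  by rewrite inE; exists m => // n /= /Hm.
apply: integral_bigcup_le => //.
  move=> m n mn; apply/subsetPset => w Gw i /= ni; apply: Gw => /=.
  exact: leq_trans mn ni.
move=> m.
apply: (@le_trans _ _ (\int[P]_(w in shallow_crossing t a k e m) (reflected A a k (B t w))%:E)%E).
  apply: ge0_subset_integral => //.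
  - by apply: measurable_shallow_crossing; exact: ltW.
  - exact: measurable_funTS.
  - by move=> w /(_ m); apply => /=.
have := grid_crossing_ge hB B0 (t := dyadic t m) (2 ^ m) a (dyadic0 t m)
    (dyadic_nondecreasing m (ltW t0)) mA Ak e.
rewrite dyadic_last => /le_trans; apply.
have mBA : measurable (B t @^-1` A) by exact: measurable_preimage.
apply: le_measure_ae => //.
  apply: measurableI => //; have := measurable_grid_crossed a (k - e) m (ltW t0).
  congr (measurable _); apply/seteqP; split => w /= [j jm]; exists j => //; lra.
apply: filterS CA => w CA [[j jm lj] Aw]; apply: CA => //.
by exists (dyadic t m j); rewrite dyadic_ge0 ?dyadic_le// ltW.
Qed.

(** The strict version is applied at height [k + e n], whose line lowered by [e n] is the given one;
    the masses increase to that of [k] as [e n] tends to 0. This also covers a line through the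
    starting point, [k = a * t]. *)
Lemma line_crossing_ge A C a k t : 0 < t -> 0 <= k - a * t ->
  measurable A -> (forall b, A b -> b < k) -> measurable C ->
  {ae P, forall w, (exists s, 0 <= s <= t /\ k - a * (t - s) < B s w) ->
     A (B t w) -> C w} ->
  (crossing_mass A a k t <= P C)%E.
Proof.
move=> t0 kt0 mA Ak mC CA.
pose e (n : nat) : R := n.+1%:R^-1.
have e0 n : 0 < e n by rewrite invr_gt0 ltr0Sn.
pose f n b := ((\1_A b)%:E * (normal_pdf 0 (Num.sqrt t) b *
    expR (- (2 / t * (k + e n - b) * (k + e n - a * t))))%R%:E)%E.
have mf n : measurable_fun setT (f n).
  apply/measurable_EFinP; apply: measurable_funM; first exact: measurable_indic.
  apply: measurable_funM; first exact: measurable_normal_pdf.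
  apply: measurableT_comp => //; apply: measurableT_comp => //.
  by apply: measurable_funM => //; apply: measurable_funM => //; apply: measurable_funB.
have f0 n b : (0 <= f n b)%E.
  by rewrite /f -EFinM lee_fin mulr_ge0 ?indicE ?ler0n// mulr_ge0 ?normal_pdf_ge0 ?expR_ge0.
have nf b : nondecreasing_seq (f ^~ b).
  move=> m n mn; rewrite /f -!EFinM lee_fin indicE.
  case: (boolP (b \in A)) => [|_];
    last by rewrite !mul0r.
  rewrite inE => /Ak bk; rewrite !mul1r ler_wpM2l ?normal_pdf_ge0// ler_expR lerN2.
  have em : e n <= e m by rewrite /e lef_pV2 ?posrE ?ltr0Sn// ler_nat ltnS.
  have en0 := e0 n.
  apply: ler_pM; [|lra| |lra].
  - by rewrite mulr_ge0 ?divr_ge0 ?(ltW t0)//; lra.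
  - by rewrite ler_wpM2l ?divr_ge0 ?(ltW t0)//; lra.
have cf b : f n b @[n --> \oo] --> ((\1_A b)%:E * (normal_pdf 0 (Num.sqrt t) b *
    expR (- (2 / t * (k - b) * (k - a * t))))%R%:E)%E.
  have ce : e n @[n --> \oo] --> 0 by exact: cvg_harmonic.
  have cke : (k + e n) @[n --> \oo] --> k.
    by rewrite -[X in _ --> X]addr0; apply: cvgD => //; exact: cvg_cst.
  rewrite -EFinM; apply: cvg_EFin; first exact: nearW.
  apply: cvgM; first exact: cvg_cst.
  apply: cvgM; first exact: cvg_cst.
  apply: (cvg_comp _ expR); last exact: continuous_expR.
  apply: cvgN; apply: cvgM; last by apply: cvgB => //; exact: cvg_cst.
  by apply: cvgM; [exact: cvg_cst|apply: cvgB => //; exact: cvg_cst].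
have -> : crossing_mass A a k t = (\int[lebesgue_measure]_b limn (f ^~ b))%E.
  by apply: eq_integral => b _; apply/esym/cvg_lim => //; exact: cf.
rewrite (monotone_convergence lebesgue_measure)//.
apply: lime_le.
  apply: ereal_nondecreasing_is_cvgn => m n mn.
  apply: ge0_le_integral => //.
  - exact: mf.
  - exact: mf.
  - by move=> b _; exact: nf.
apply: nearW => n; have en0 := e0 n.
apply: (@line_crossing_ge_strict A C a (k + e n) t (e n)) => //.
- by lra.
- by move=> b /Ak; lra.
apply: filterS CA => w CA [s [st Bs]]; apply: CA; exists s; split => //.
by rewrite (le_lt_trans _ Bs)//; lra.
Qed.

End line_crossing.

(** * The crossing of a half-line *)

Section half_line_crossing.
Context (R : realType) (d : measure_display) (T : measurableType d).
Variables (P : probability T R) (B : R -> T -> R).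
Hypothesis hB : brownian_motion P B.
Hypothesis B0 : forall w, B 0 w = 0.
Implicit Types (a k t s y l : R).

Lemma normal_pdf_tilt s l b : s != 0 ->
  normal_pdf 0 s b * expR (l * b) =
  normal_pdf (l * s ^+ 2) s b * expR (l ^+ 2 * s ^+ 2 / 2) :> R.
Proof.
move=> s0; rewrite !normal_pdfE// /normal_fun -!mulrA -!expRD.
by congr (_ * expR _); field.
Qed.

Lemma integral_normal_exp s l k : s != 0 ->
  (\int[lebesgue_measure]_b (expR (l * (b - k)) * normal_pdf 0 s b)%R%:E =
   (expR (l ^+ 2 * s ^+ 2 / 2 - l * k))%:E :> \bar R)%E.
Proof.
move=> s0.
transitivity (\int[lebesgue_measure]_b
    ((expR (l ^+ 2 * s ^+ 2 / 2 - l * k))%:E * (normal_pdf (l * s ^+ 2) s b)%:E))%E.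
  apply: eq_integral => b _; rewrite -EFinM; congr EFin.
  rewrite mulrBr expRD mulrC mulrA normal_pdf_tilt// expRD; ring.
rewrite ge0_integralZl//.
- by rewrite integral_normal_pdf mule1.
- by apply/measurable_EFinP; exact: measurable_normal_pdf.
- by move=> b _; rewrite lee_fin normal_pdf_ge0.
Qed.

(** The expectation of [exp (a (B m - (y + a m)))]: a Chernoff bound for the path being above the
    line at time [m], and the error made by stopping at that time. *)
Let small a y (m : nat) : R := expR (- (a * y) - a ^+ 2 * m%:R / 2).

Let small_lt a y e : 0 < a -> 0 <= y -> 0 < e -> exists m, (0 < m)%N /\ small a y m < e.
Proof.
move=> a0 y0 e0; exists (Num.truncn (2 / (a ^+ 2 * e))).+1; split => //.
set m := _.+1; have a20 : 0 < a ^+ 2 by rewrite exprn_gt0.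
have : 2 / (a ^+ 2 * e) < m%:R by exact: truncnS_gt.
rewrite ltr_pdivrMr ?mulr_gt0// => am.
have m0 : 0 < a ^+ 2 * m%:R / 2 by rewrite divr_gt0// mulr_gt0// ltr0Sn.
rewrite /small -opprD expRN invf_plt ?posrE ?expR_gt0//.
apply: (@lt_le_trans _ _ (1 + (a * y + a ^+ 2 * m%:R / 2))); last exact: expR_ge1Dx.
have : 0 <= a * y by rewrite mulr_ge0// ltW.
suff : e^-1 < a ^+ 2 * m%:R / 2 by lra.
by rewrite -[_^-1]mul1r ltr_pdivrMr//; nra.
Qed.

Let barrier a y (m : nat) := y + a * m%:R.

(** The expectation of [exp (2 a (B m - k))] is exactly [exp (- 2 a y)]. Restriction to [b > k]
    gives [reflected]; on [b <= k] the integrand is at most [exp (a (b - k))], whose expectation is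
    [small]. *)
Let crossing_mass_barrier a y (m : nat) : 0 < a -> 0 <= y -> (0 < m)%N ->
  let k := barrier a y m in
  (crossing_mass `]-oo, k[%classic a k m%:R <= (expR (- (2 * a * y)))%:E)%E /\
  ((expR (- (2 * a * y)))%:E <= crossing_mass `]-oo, k[%classic a k m%:R + (small a y m)%:E)%E.
Proof.
move=> a0 y0 m0 k; have mR : 0 < m%:R :> R by rewrite ltr0n.
have s0 : Num.sqrt m%:R != 0 :> R by rewrite gt_eqF// sqrtr_gt0.
rewrite -(integral_reflected_brownian hB B0)//.
have mref : measurable_fun setT (fun b : R => (reflected `]-oo, k[%classic a k b)%:E).
  by apply/measurable_EFinP; exact: measurable_reflected.
rewrite (ge0_integral_normal_law (m := 0) (s := Num.sqrt m%:R)
    (f := fun b => (reflected `]-oo, k[%classic a k b)%:E))//; last 3 first.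
- by apply: (brownian_measurable hB); exact: ltW.
- by move=> C mC; exact: (brownian_law hB B0).
- by move=> b; rewrite lee_fin reflected_ge0.
have mpdf : measurable_fun setT (normal_pdf 0 (Num.sqrt m%:R) : R -> R).
  exact: measurable_normal_pdf.
have mexp l : measurable_fun setT (fun b : R => expR (l * (b - k)) * normal_pdf 0 (Num.sqrt m%:R) b).
  apply: measurable_funM => //; apply: measurableT_comp => //.
  by apply: measurable_funM => //; exact: measurable_funB.
have pexp l (b : R) : 0 <= expR (l * (b - k)) * normal_pdf 0 (Num.sqrt m%:R) b.
  by rewrite mulr_ge0 ?expR_ge0 ?normal_pdf_ge0.
have -> : - (2 * a * y) = (2 * a) ^+ 2 * (Num.sqrt m%:R) ^+ 2 / 2 - (2 * a) * k.
  by rewrite sqr_sqrtr ?(ltW mR)// /k /barrier; field.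
have -> : small a y m = expR (a ^+ 2 * (Num.sqrt m%:R) ^+ 2 / 2 - a * k).
  by rewrite /small sqr_sqrtr ?(ltW mR)// /k /barrier; congr expR; field.
rewrite -!integral_normal_exp//; split.
  apply: ge0_le_integral => //.
  - by move=> b _; rewrite mule_ge0// lee_fin ?reflected_ge0 ?normal_pdf_ge0.
  - by apply: emeasurable_funM => //; apply/measurable_EFinP; exact: mpdf.
  - by apply/measurable_EFinP; exact: mexp.
  - move=> b _; rewrite -EFinM lee_fin ler_wpM2r ?normal_pdf_ge0// /reflected.
    by rewrite ler_piMl ?expR_ge0// indicE lern1 leq_b1.
rewrite -ge0_integralD//; last 4 first.
- by move=> b _; rewrite mule_ge0// lee_fin ?reflected_ge0 ?normal_pdf_ge0.
- by apply: emeasurable_funM => //; apply/measurable_EFinP; exact: mpdf.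
- by move=> b _; rewrite lee_fin.
- by apply/measurable_EFinP; exact: mexp.
apply: ge0_le_integral => //.
- by move=> b _; rewrite lee_fin.
- by apply/measurable_EFinP; exact: mexp.
- apply: emeasurable_funD; last by apply/measurable_EFinP; exact: mexp.
  by apply: emeasurable_funM => //; apply/measurable_EFinP; exact: mpdf.
- move=> b _; rewrite -EFinM -EFinD lee_fin -mulrDl ler_wpM2r ?normal_pdf_ge0//.
  rewrite /reflected indicE; have [kb|bk] := ltP k b.
    rewrite mem_set; last by rewrite /= in_itv/=; lra.
    by rewrite mul1r lerDl expR_ge0.
  rewrite memNset ?mul0r ?add0r; last by rewrite /= in_itv/= => ?; lra.
  by rewrite ler_expR; nra.
Qed.

Let high_end a y (m : nat) : 0 < a -> 0 <= y -> (0 < m)%N ->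
  (P [set w | (barrier a y m <= B m%:R w)%R] <= (small a y m)%:E)%E.
Proof.
move=> a0 y0 m0; have mR : 0 < m%:R :> R by rewrite ltr0n.
have s0 : Num.sqrt m%:R != 0 :> R by rewrite gt_eqF// sqrtr_gt0.
set k := barrier a y m.
have -> : [set w | k <= B m%:R w] = B m%:R @^-1` `[k, +oo[%classic.
  by apply/seteqP; split => w /=; rewrite in_itv/= andbT.
rewrite (brownian_law hB B0)// /normal_prob integral_mkcond.
have -> : small a y m = expR (a ^+ 2 * (Num.sqrt m%:R) ^+ 2 / 2 - a * k).
  by rewrite /small sqr_sqrtr ?(ltW mR)// /k /barrier; congr expR; field.
rewrite -integral_normal_exp//; apply: ge0_le_integral => //.
- by move=> b _; apply: erestrict_ge0 => x _; rewrite lee_fin normal_pdf_ge0.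
- apply/(measurable_restrictT _ _).1 => //; apply: measurable_funTS.
  by apply/measurable_EFinP; exact: measurable_normal_pdf.
- apply/measurable_EFinP; apply: measurable_funM; last exact: measurable_normal_pdf.
  apply: measurableT_comp => //.
  by apply: measurable_funM => //; exact: measurable_funB.
- move=> b _; rewrite patchE; case: ifPn; last first.
    by rewrite lee_fin mulr_ge0 ?expR_ge0 ?normal_pdf_ge0.
  rewrite inE/= in_itv/= andbT => kb; rewrite lee_fin ler_peMl ?normal_pdf_ge0//.
  by rewrite -expR0 ler_expR mulr_ge0 ?subr_ge0// ltW.
Qed.

(** The half-line is exhausted by [[0, m]]. A crossing before [m] followed by an end point below the
    barrier has the mass just estimated; an end point above it costs at most [small], which tends to
    0. *)
Lemma half_line_crossing a y (C : set T) : 0 < a -> 0 <= y -> measurable C ->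
  {ae P, forall w, C w <-> exists2 u, 0 <= u & y + a * u < B u w} ->
  P C = (expR (- (2 * a * y)))%:E.
Proof.
move=> a0 y0 mC CE; apply/eqP; rewrite eq_le; apply/andP; split; last first.
  apply/lee_addgt0Pr => e e0; have [m [m0 me]] := small_lt a0 y0 e0.
  have mR : 0 < m%:R :> R by rewrite ltr0n.
  have [_ /le_trans] := crossing_mass_barrier a0 y0 m0; apply.
  apply: leeD; last by rewrite lee_fin ltW.
  apply: (line_crossing_ge hB B0) => //.
  - by rewrite /barrier; lra.
  - apply: filterS CE => w CE [s [/andP[s1 s2] sB]] _; apply/CE; exists s => //.
    by move: sB; rewrite /barrier; lra.
pose D (m : nat) := [set w | exists n i, dyadic (1 : R) n i <= m%:R /\
   y + a * dyadic 1 n i < B (dyadic 1 n i) w].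
have mD m : measurable (D m).
  rewrite (_ : D m = \bigcup_n \bigcup_(i in [set i | dyadic (1 : R) n i <= m%:R])
     (B (dyadic 1 n i) @^-1` `]y + a * dyadic 1 n i, +oo[%classic)).
    apply: bigcupT_measurable => n; apply: bigcup_measurable => i _.
    apply: measurable_preimage => //; apply: (brownian_measurable hB).
    exact: dyadic_ge0.
  apply/seteqP; split => w /=.
    by move=> [n [i [im iB]]]; exists n => //; exists i => //=; rewrite in_itv/= andbT.
  by move=> [n _ [i im /=]]; rewrite in_itv/= andbT => iB; exists n, i.
have nD m n : (m <= n)%N -> D m `<=` D n.
  move=> mn w [i [j [jm jB]]]; exists i, j; split => //.
  by rewrite (le_trans jm)// ler_nat.
apply/lee_addgt0Pr => e e0; have [m0 [m00 me]] := small_lt a0 y0 e0.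
(* The shift by [m0] keeps the Chernoff error below [e] for every term of the union. *)
apply: (@le_trans _ _ (P (\bigcup_m D (m + m0)%N))).
  apply: le_measure_ae => //; first exact: bigcupT_measurable.
  case: hB => _ _ _ _ cB; apply: filterS2 CE cB => w CE cw /CE[u u0 uB].
  have cX : {within `[0, +oo[, continuous (fun v => B v w - (y + a * v))}.
    rewrite (_ : (fun _ => _) = (fun v => B v w - (y - a * (0 - v)))).
      exact: subr_affine_continuous.
    by apply/funext => v; ring.
  have [|n [i [_ iB]]] := dyadic_positive cX ltr01 u0 ltr01; first by rewrite subr_gt0.
  exists (Num.truncn (dyadic (1 : R) n i)).+1 => //; exists n, i; split.
    rewrite (le_trans (ltW (truncnS_gt _)))// ler_nat leq_addr//.
  by move: iB; rewrite subr_gt0.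
apply: measure_bigcup_le => //.
  by move=> m n mn; apply/subsetPset; apply: nD; rewrite leq_add2r.
move=> n; set m := (n + m0)%N.
have m_gt0 : (0 < m)%N by rewrite addn_gt0 m00 orbT.
have mR : 0 < m%:R :> R by rewrite ltr0n.
have mBm : measurable [set w | barrier a y m <= B m%:R w].
  rewrite (_ : [set w | _] = B m%:R @^-1` `[barrier a y m, +oo[%classic).
    apply: measurable_preimage => //; apply: (brownian_measurable hB); exact: ltW.
  by apply/seteqP; split => w /=; rewrite in_itv/= andbT.
rewrite (measureDI P (mD m) mBm); apply: leeD.
  have [mass_le _] := crossing_mass_barrier a0 y0 m_gt0.
  apply: le_trans mass_le.
  apply: (line_crossing_le hB B0) => //.
  - exact: measurableD.
  - apply: aeW => w [Dw nBw]; split.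
      by rewrite /= in_itv/= ltNge; apply/negP => kB; exact: nBw.
    have [p [q [qm qB]]] := Dw; exists (dyadic 1 p q); rewrite qm dyadic_ge0//; split => //.
    by move: qB; rewrite /barrier; lra.
apply: (@le_trans _ _ (P [set w | (barrier a y m <= B m%:R w)%R])).
  by apply: le_measure; rewrite ?inE//; exact: measurableI.
apply: (le_trans (high_end a0 y0 m_gt0)); rewrite lee_fin (le_trans _ (ltW me))//.
rewrite /small ler_expR lerD2l lerN2 ler_pM2r// ler_pM2l ?exprn_gt0//.
by rewrite ler_nat leq_addl.
Qed.

End half_line_crossing.

(** * Concave majorants *)

Section concave_majorant_theory.
Context (R : realType).
Implicit Types (f b : R -> R) (t k s v : R).

Lemma concave_on_nonnegP f : concave_on_nonneg f <->
  (forall p x y : R, 0 <= p <= 1 -> 0 <= x -> 0 <= y ->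
    p * f x + (1 - p) * f y <= f (p * x + (1 - p) * y)).
Proof.
split=> [cf p x y p01 x0 y0|cf p x y].
  have := cf (Itv01 (andP p01).1 (andP p01).2) x y.
  rewrite !inE/= !in_itv/= !andbT x0 y0 => /(_ isT isT).
  by rewrite !convRE/= /unstable.onem => ?; lra.
rewrite !inE/= !in_itv/= !andbT => x0 y0; rewrite !convRE/= /unstable.onem.
have p01 : 0 <= (p%:num : R) <= 1 by apply/andP; split.
have h : p%:num * f x + (1 - p%:num) * f y <= f (conv p x y) := cf p%:num x y p01 x0 y0.
by rewrite !mulrN -opprD lerN2.
Qed.

Lemma affine_concave (k a t : R) : concave_on_nonneg (fun v => k + a * (v - t)).
Proof. by apply/concave_on_nonnegP => p x y *; rewrite le_eqVlt; apply/orP; left; apply/eqP; ring. Qed.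

(** The pointwise infimum of the dominating concave functions is concave; the affine bound makes the
    family nonempty. *)
Lemma concave_majorantP b :
  (exists c a, forall s, 0 <= s -> b s <= c + a * s) ->
  is_concave_majorant b (concave_majorant b).
Proof.
move=> [c [a bca]].
suff : exists k : R -> R, is_concave_majorant b k.
  by move=> [k bk]; apply: (xgetPex (P := is_concave_majorant b) (fun=> 0)); exists k.
pose M f := concave_on_nonneg f /\ forall t, 0 <= t -> b t <= f t.
have Ma : M (fun v => c + a * (v - 0)).
  by split; [exact: affine_concave|move=> s s0; rewrite subr0; exact: bca].
pose V t := [set x | exists2 f, M f & x = f t].
have V0 t : V t !=set0 by exists (c + a * (t - 0)), (fun v => c + a * (v - 0)).
have Vlb t : 0 <= t -> has_lbound (V t).
  by move=> t0; exists (b t) => _ [f [_ fb] ->]; exact: fb.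
have infV t f : 0 <= t -> M f -> inf (V t) <= f t.
  by move=> t0 Mf; apply: ge_inf; [exact: Vlb|exists f].
exists (fun t => inf (V t)); split.
- apply/concave_on_nonnegP => p x y p01 x0 y0; have /andP[p0 p1] := p01.
  apply: lb_le_inf => // _ [f Mf ->].
  have [/concave_on_nonnegP cf _] := Mf.
  apply: (le_trans _ (cf p x y p01 x0 y0)); apply: lerD.
    by apply: ler_wpM2l => //; exact: infV.
  by apply: ler_wpM2l; [rewrite subr_ge0|exact: infV].
- by move=> t t0; apply: lb_le_inf => // _ [f [_ fb] ->]; exact: fb.
- by move=> f cf fb t t0; apply: infV.
Qed.

(* The graph of b lies below some line through (t, k) iff every chord of b
   over t passes below (t, k). *)
Lemma concave_majorant_leP b t k : 0 < t ->
  (exists c a, forall s, 0 <= s -> b s <= c + a * s) ->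
  concave_majorant b t <= k <->
  (forall s v, 0 <= s < t -> t <= v -> (t - s) * (b v - k) <= (v - t) * (k - b s)).
Proof.
move=> t0 bca; have [cK bK minK] := concave_majorantP bca.
split=> [Kk s v /andP[s0 st] tv|H].
  have vs0 : 0 < v - s by lra.
  have v0 : 0 <= v by lra.
  have p01 : 0 <= (v - t) / (v - s) <= 1.
    by rewrite divr_ge0 ?subr_ge0//= ?ler_pdivrMr//; lra.
  have := (concave_on_nonnegP _).1 cK _ s v p01 s0 v0.
  have -> : (v - t) / (v - s) * s + (1 - (v - t) / (v - s)) * v = t.
    by field; rewrite gt_eqF.
  have := bK s s0; have := bK v v0.
  set Kt := concave_majorant b t in Kk *; set Ks := concave_majorant b s; set Kv := concave_majorant b v.
  move=> bv bs.
  have -> : (v - t) / (v - s) * Ks + (1 - (v - t) / (v - s)) * Kv =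
     ((v - t) * Ks + (t - s) * Kv) / (v - s) by field; rewrite gt_eqF.
  rewrite ler_pdivrMr// => Kle.
  have h1 : (v - t) * b s <= (v - t) * Ks by apply: ler_wpM2l => //; lra.
  have h2 : (t - s) * b v <= (t - s) * Kv by apply: ler_wpM2l => //; lra.
  have h3 : Kt * (v - s) <= k * (v - s) by apply: ler_wpM2r => //; lra.
  by lra.
(* [S] holds the slopes from earlier points of the graph to [(t, k)]. Its infimum serves on both
   sides of [t]: it is at most each of these slopes and, by [Slb], at least each slope from [(t, k)]
   to a later point. *)
pose S := [set x | exists2 s, 0 <= s < t & x = (k - b s) / (t - s)].
have S0 : S !=set0 by exists ((k - b 0) / (t - 0)), 0; rewrite ?lexx.
have Slb v : t < v -> lbound S ((b v - k) / (v - t)).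
  move=> tv _ [s /andP[s0 st] ->].
  rewrite ler_pdivrMr ?subr_gt0// mulrAC ler_pdivlMr ?subr_gt0//.
  by rewrite mulrC [leRHS]mulrC; apply: H; rewrite ?s0// ltW.
have hlS : has_lbound S by exists ((b (t + 1) - k) / (t + 1 - t)); apply: Slb; lra.
have btk : b t <= k.
  have := H 0 t; rewrite lexx t0 lexx subrr mul0r subr0 => /(_ isT isT).
  by rewrite pmulr_rle0// subr_le0.
have := minK (fun v => k + inf S * (v - t)) (affine_concave _ _ _).
rewrite -[X in _ -> _ <= X](addr0 k) => /(_ _ t (ltW t0)).
rewrite subrr mulr0; apply => v v0.
case: (ltgtP v t) => [vt|tv|->]; last by rewrite subrr mulr0 addr0.
- have : inf S <= (k - b v) / (t - v) by apply: ge_inf => //; exists v => //; rewrite v0.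
  by rewrite ler_pdivlMr ?subr_gt0//; lra.
- have : (b v - k) / (v - t) <= inf S by apply: lb_le_inf => //; exact: Slb.
  by rewrite ler_pdivrMr ?subr_gt0//; lra.
Qed.

(** With one end of the chord fixed, a violation says that the path is strictly above a line at the
    other end, an open condition that moves to a dyadic time. This is done first for the end after
    [t], then for the end before it. *)
Lemma chord_dyadicP b t k : {within `[0, +oo[, continuous b} -> 0 < t ->
  (forall s v, 0 <= s < t -> t <= v -> (t - s) * (b v - k) <= (v - t) * (k - b s)) <->
  (forall n i m j, (i < 2 ^ n)%N ->
    (t - dyadic t n i) * (b (t + dyadic t m j) - k) <=
    dyadic t m j * (k - b (dyadic t n i))).
Proof.
move=> cb t0; have t0' := ltW t0; split=> [H n i m j i2|H s v /andP[s0 st] tv].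
  have := H (dyadic t n i) (t + dyadic t m j).
  rewrite dyadic_ge0// dyadic_lt// lerDl dyadic_ge0//.
  by rewrite (_ : t + dyadic t m j - t = dyadic t m j); [exact|ring].
have Hs n i u : (i < 2 ^ n)%N -> 0 <= u ->
    (t - dyadic t n i) * (b (t + u) - k) <= u * (k - b (dyadic t n i)).
  move=> i2 u0; rewrite leNgt; apply/negP => neg.
  have it : 0 < t - dyadic t n i.
    by rewrite subr_gt0 dyadic_lt.
  set x := dyadic t n i in it neg *.
  have cbt : {within `[0, +oo[, continuous (fun u => b (t + u))}.
    move/within_nonneg_continuousP : cb => cb; apply/within_nonneg_continuousP => y y0 e e0.
    have [r r0 yr] := cb (t + y) (addr_ge0 t0' y0) e e0; exists r => // z z0 zy.
    by apply: yr; rewrite ?addr_ge0// (_ : _ - _ = z - y)//; ring.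
  have := subr_affine_continuous ((k - b x) / (t - x)) k 0 cbt.
  move=> /dyadic_positive/(_ t0 u0 ltr01)[|m [j [_]]].
    rewrite subr_gt0 sub0r mulrN opprK -ltrBrDl mulrAC ltr_pdivrMr//.
    by lra.
  rewrite subr_gt0 sub0r mulrN opprK -ltrBrDl mulrAC ltr_pdivrMr//.
  by have := H n i m j i2; rewrite -/x; lra.
have [u u0 ->] : exists2 u, 0 <= u & v = t + u.
  by exists (v - t); [rewrite subr_ge0|rewrite addrC subrK].
rewrite (_ : t + u - t = u); last by ring.
(* The case [u = 0] is set apart because the slope used below divides by [u]. *)
move: u0; rewrite le_eqVlt => /predU1P[<-|u0].
  rewrite mul0r addr0.
  have := Hs 0%N 0%N 0; rewrite dyadic0 subr0 lexx mul0r addr0 => /(_ isT isT).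
  by rewrite pmulr_rle0// => btk; rewrite pmulr_rle0// subr_gt0.
rewrite leNgt; apply/negP => neg.
have := subr_affine_continuous ((b (t + u) - k) / u) k t cb.
move=> /dyadic_positive/(_ t0 s0 (_ : 0 < t - s))[||n [i [/andP[si it] +]]].
- by rewrite subr_gt0.
- rewrite subr_gt0 ltrBlDr -ltrBlDl mulrAC ltr_pdivlMr//.
  by lra.
rewrite subr_gt0 ltrBlDr -ltrBlDl mulrAC ltr_pdivlMr//.
have i2 : (i < 2 ^ n)%N.
  rewrite ltnNge; apply/negP => ni; move: it; rewrite addrC subrK; apply/negP; rewrite -leNgt.
  by rewrite -[leLHS](dyadic_last t n); apply: (dyadic_nondecreasing n t0').
by have := Hs n i u i2 (ltW u0); lra.
Qed.

End concave_majorant_theory.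

(** * The sum of the squares of two normal variables *)

Section sum_of_two_squares.
Context (R : realType).
Local Notation leb := (@lebesgue_measure R).

Lemma integral_tail_sqr_exp (c r : R) : 0 < c -> 0 <= r ->
  (\int[leb]_(z in `[r, +oo[) (z * expR (- (c * z ^+ 2)))%:E =
   ((2 * c)^-1 * expR (- (c * r ^+ 2)))%:E)%E.
Proof.
move=> c0 r0.
pose g (z : R) := - (c * z ^+ 2).
pose F (z : R) := - (2 * c)^-1 * expR (g z).
have dg (z : R) : is_derive z (1 : R) g (- (c * (2 * z))).
  rewrite (_ : g = - (c *: (@GRing.exp R ^~ 2)))//.
  apply: is_derive_eq.
  by rewrite /GRing.scale/=; ring.
have dF (z : R) : is_derive z (1 : R) F (z * expR (- (c * z ^+ 2))).
  have := is_derive1_comp (is_derive_expR (g z)) (dg z) => de.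
  apply: (is_derive_eq (is_deriveZ (- (2 * c)^-1) de)).
  rewrite /GRing.scale/= -/(g z); field.
  by rewrite gt_eqF.
have cF : continuous F.
  by move=> z; apply/differentiable_continuous/derivable1_diffP; case: (dF z).
have cg : continuous g.
  by move=> z; apply/differentiable_continuous/derivable1_diffP; case: (dg z).
rewrite (@ge0_continuous_FTC2y R _ F r 0).
- by rewrite /F /g sub0e -EFinN mulNr opprK.
- by move=> x rx; rewrite mulr_ge0 ?expR_ge0// (le_trans r0).
- apply: continuous_subspaceT => z; apply: cvgM; first exact: cvg_id.
  by apply: (cvg_comp _ expR); [exact: cg|exact: continuous_expR].
- rewrite -(mulr0 (- (2 * c)^-1)); apply: cvgM; first exact: cvg_cst.
  apply/cvgrPdist_lt => e e0; near=> z.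
  rewrite sub0r normrN ger0_norm ?expR_ge0// /g expRN invf_plt ?posrE ?expR_gt0//.
  apply: (@lt_le_trans _ _ (1 + c * z ^+ 2)); last exact: expR_ge1Dx.
  have z1 : 1 <= z by near: z; apply: nbhs_pinfty_ge; rewrite num_real.
  have z2 : z <= z ^+ 2 by rewrite expr2 ler_peMl// (le_trans ler01).
  apply: (@lt_le_trans _ _ (c * z)).
    by rewrite mulrC -ltr_pdivrMr//; near: z; apply: nbhs_pinfty_gt; rewrite num_real.
  by rewrite (le_trans (ler_wpM2l (ltW c0) z2))// lerDr.
- by move=> x _; case: (dF x).
- by apply: cvg_at_right_filter; exact: cF.
- by move=> x _; rewrite derive1E; exact: derive_val.
Unshelve. all: by end_near. Qed.

End sum_of_two_squares.

Lemma normal_prob_set1 (R : realType) (m s x : R) : normal_prob m s [set x] = 0%E.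
Proof.
apply: null_set_integral => //; last exact: lebesgue_measure_set1.
by apply/measurable_EFinP; apply: measurable_funTS; exact: measurable_normal_pdf.
Qed.

Section sum_of_two_squares_law.
Context (R : realType).
Local Notation leb := (@lebesgue_measure R).

Lemma integral_sqr_gt_exp (c q : R) : 0 < c -> 0 <= q ->
  (\int[leb]_z (\1_[set z : R | (q < z ^+ 2)%R] z * (`|z| * expR (- (c * z ^+ 2))))%R%:E =
   (c^-1 * expR (- (c * q)))%:E)%E.
Proof.
move=> c0 q0; pose r := Num.sqrt q.
have r0 : 0 <= r by exact: sqrtr_ge0.
have rq : r ^+ 2 = q by exact: sqr_sqrtr.
pose h (z : R) : R := \1_`]r, +oo[%classic z * (z * expR (- (c * z ^+ 2))).
have h0 z : (0 <= (h z)%:E)%E.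
  rewrite lee_fin /h indicE; case: (boolP (z \in _)) => [|_]; last by rewrite mul0r.
  by rewrite inE/= in_itv/= andbT => rz; rewrite mul1r mulr_ge0 ?expR_ge0// (le_trans r0)// ltW.
have mh : measurable_fun setT h.
  apply: measurable_funM; first exact: measurable_indic.
  apply: measurable_funM => //; apply: measurableT_comp => //.
  apply: measurableT_comp => //; apply: measurable_funM => //; exact: measurable_funX.
have mhE : measurable_fun setT (fun z => (h z)%:E) by exact/measurable_EFinP.
have Ih : (\int[leb]_z (h z)%:E = ((2 * c)^-1 * expR (- (c * q)))%:E)%E.
  rewrite -rq -(integral_tail_sqr_exp c0 r0) -integral_itv_obnd_cbnd.
    rewrite -[RHS]integral_indicM//; apply: eq_integral => z _; exact: EFinM.
  apply/measurable_EFinP/measurable_funTS; apply: measurable_funM => //.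
  apply: measurableT_comp => //; apply: measurableT_comp => //.
  by apply: measurable_funM => //; exact: measurable_funX.
transitivity (\int[leb]_z ((h z)%:E + (h (- z))%:E))%E.
  apply: eq_integral => z _; rewrite -EFinD; congr EFin.
  have sq x : 0 <= x -> (q < x ^+ 2) = (r < x).
    by move=> x0; rewrite -rq ltr_pXn2r ?nnegrE.
  rewrite /h !indicE; have [z0|z0] := leP 0 z.
    rewrite [X in _ = _ + X](_ : _ = 0) ?addr0; last first.
      by rewrite memNset ?mul0r//= in_itv/= andbT => rz; have := le_lt_trans r0 rz; lra.
    rewrite ger0_norm//; congr (_%:R * _); congr (nat_of_bool _).
    by apply/idP/idP; rewrite !inE/= in_itv/= andbT sq.
  rewrite [X in _ = X + _](_ : _ = 0) ?add0r; last first.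
    by rewrite memNset ?mul0r//= in_itv/= andbT => rz; have := le_lt_trans r0 rz; lra.
  rewrite sqrrN ltr0_norm//; congr (_%:R * _); congr (nat_of_bool _).
  by apply/idP/idP; rewrite !inE/= in_itv/= andbT -sq ?sqrrN// oppr_ge0 ltW.
have mhN : measurable_fun setT (fun z : R => (h (- z))%:E).
  by apply/measurable_EFinP; apply: (measurableT_comp mh).
rewrite ge0_integralD//.
have -> : (\int[leb]_z (h (- z))%:E = \int[leb]_z (h z)%:E)%E.
  rewrite (@ge0_integral_affine _ (-1) 0 (fun z => (h z)%:E)) ?oppr_eq0 ?oner_eq0//.
  by rewrite normrN1 mul1e; apply: eq_integral => z _; rewrite mulN1r addr0.
rewrite Ih -EFinD; congr EFin; field.
by rewrite gt_eqF.
Qed.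

(** After the substitution [y = x * u], integrating in [x] first leaves [exp (- c q)] times a
    constant made of an integral [mass] over [u]. That integral is never evaluated: the case
    [q = 0], of probability one, fixes the constant. *)
Lemma sum_two_squares_tail d (T : measurableType d) (P : probability T R)
    (X Y : T -> R) (s q : R) : 0 < s ->
  measurable_fun setT X -> measurable_fun setT Y ->
  (forall A C, measurable A -> measurable C ->
    P (X @^-1` A `&` Y @^-1` C) = (P (X @^-1` A) * P (Y @^-1` C))%E) ->
  (forall A, measurable A -> P (X @^-1` A) = normal_prob 0 s A) ->
  (forall A, measurable A -> P (Y @^-1` A) = normal_prob 0 s A) ->
  0 <= q ->
  P [set w | q < X w ^+ 2 + Y w ^+ 2] = (expR (- (q / (2 * s ^+ 2))))%:E.
Proof.
move=> s0 mX mY XY lX lY; move: q.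
have sn0 : s != 0 by rewrite gt_eqF.
pose c : R := (2 * s ^+ 2)^-1.
have c0 : 0 < c by rewrite invr_gt0 mulr_gt0// exprn_gt0.
pose S (q : R) := [set xy : R * R | q < xy.1 ^+ 2 + xy.2 ^+ 2].
have mS q : measurable (S q).
  have : measurable_fun setT (fun xy : R * R => xy.1 ^+ 2 + xy.2 ^+ 2).
    apply: measurable_funD; apply: measurable_funX; [exact: measurable_fst|exact: measurable_snd].
  move=> /measurable_preimage/(_ (measurable_itv `]q, +oo[)).
  by congr measurable; apply/seteqP; split => xy /=; rewrite in_itv/= andbT.
pose mass := (\int[leb]_u ((normal_peak s ^+ 2)%:E * ((1 + u ^+ 2)^-1)%:E))%E.
have mass0 : (0 <= mass)%E.
  apply: integral_ge0 => u _; rewrite -EFinM lee_fin mulr_ge0 ?sqr_ge0// invr_ge0.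
  by rewrite addr_ge0// sqr_ge0.
have key q : 0 <= q ->
    (P [set w | S q (X w, Y w)] = mass * (c^-1 * expR (- (c * q)))%:E)%E.
  move=> q0.
  have mXY : measurable_fun setT (fun w => (X w, Y w)) by exact: measurable_fun_pair.
  rewrite measure_integral_indic; last exact: (measurable_preimage mXY (mS q)).
  have mf : measurable_fun setT (fun x : R * R => (\1_(S q) x)%:E : \bar R).
    by apply/measurable_EFinP; exact: measurable_indic.
  have f0 (x : R * R) : (0 <= (\1_(S q) x)%:E :> \bar R)%E by rewrite lee_fin indicE ler0n.
  rewrite (integral_independent_pair mX mY XY mf f0).
  have law_int (Z : T -> R) (g : R -> \bar R) : measurable_fun setT Z ->
      (forall A, measurable A -> P (Z @^-1` A) = normal_prob 0 s A) ->
      measurable_fun setT g -> (forall x, (0 <= g x)%E) ->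
      (\int[P]_w g (Z w) = \int[leb]_x (g x * (normal_pdf 0 s x)%:E))%E.
    by move=> mZ lZ mg g0; exact: ge0_integral_normal_law.
  have mf1 x : measurable_fun setT (fun y : R => (\1_(S q) (x, y))%:E : \bar R).
    exact: (measurableT_comp mf (pair1_measurable x)).
  under eq_integral => w _ do rewrite (law_int Y (fun y => (\1_(S q) (X w, y))%:E))//.
  have mpdf : measurable_fun setT (normal_pdf 0 s : R -> R) by exact: measurable_normal_pdf.
  have mg2 : measurable_fun setT (fun xy : R * measurableTypeR R =>
      ((\1_(S q) (xy.1, xy.2 : R))%:E * (normal_pdf 0 s xy.2)%:E)%E : \bar R).
    apply: emeasurable_funM; first by have -> :
        (fun xy : R * measurableTypeR R => (\1_(S q) (xy.1, xy.2 : R))%:E : \bar R) =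
        (fun xy => (\1_(S q) xy)%:E) by apply/funext => -[].
    by apply/measurable_EFinP; exact: (measurableT_comp mpdf measurable_snd).
  have mconv : measurable_fun setT (fun x : R =>
      \int[leb]_y ((\1_(S q) (x, y))%:E * (normal_pdf 0 s y)%:E))%E.
    apply: (measurable_fun_fubini_tonelli_F (m2 := leb) _ mg2).
    by move=> x; rewrite mule_ge0// lee_fin normal_pdf_ge0.
  rewrite (law_int X (fun x => \int[leb]_y ((\1_(S q) (x, y))%:E * (normal_pdf 0 s y)%:E))%E)//; last first.
    by move=> x; apply: integral_ge0 => y _; rewrite mule_ge0// lee_fin normal_pdf_ge0.
  pose G (x u : R) := (normal_peak s ^+ 2 *
    (\1_(S q) (x, x * u) * (`|x| * expR (- (c * (x ^+ 2 + (x * u) ^+ 2))))))%R.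
  have G0 x u : 0 <= G x u.
    by rewrite mulr_ge0 ?sqr_ge0// mulr_ge0 ?indicE ?ler0n// mulr_ge0 ?expR_ge0.
  have mxu : measurable_fun setT (fun xu : R * R => xu.1 * xu.2).
    by apply: measurable_funM; [exact: measurable_fst|exact: measurable_snd].
  have mG : measurable_fun setT (fun xu : R * R => (G xu.1 xu.2)%:E : \bar R).
    apply/measurable_EFinP; apply: measurable_funM => //; apply: measurable_funM.
      apply: (@measurable_indic_comp _ _ _ _ R (S q) (fun xu : R * R => (xu.1, xu.1 * xu.2))) => //.
      by apply: measurable_fun_pair => //; exact: measurable_fst.
    apply: measurable_funM; first by apply: measurableT_comp => //; exact: measurable_fst.
    apply: measurableT_comp => //; apply: measurableT_comp => //; apply: measurable_funM => //.
    by apply: measurable_funD; apply: measurable_funX => //; exact: measurable_fst.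
  have G0' (xu : measurableTypeR R * measurableTypeR R) : (0 <= (G xu.1 xu.2)%:E :> \bar R)%E.
    by rewrite lee_fin.
  transitivity (\int[leb]_x \int[leb]_u (G x u)%:E)%E.
    apply: ae_eq_integral => //.
    - by apply: emeasurable_funM => //; apply/measurable_EFinP; exact: mpdf.
    - exact: (measurable_fun_fubini_tonelli_F (m2 := leb) (fun xu => (G xu.1 xu.2)%:E) mG G0').
    (* The substitution requires [x] to be nonzero, which fails on a null set only. *)
    - exists [set (0 : R)]; split => //; first exact: lebesgue_measure_set1.
      move=> x /= /not_implyP[_ xG]; apply: contrapT => /eqP x0; apply: xG.
      rewrite (@ge0_integral_affine _ x 0)//; last 2 first.
      + by apply: emeasurable_funM => //; apply/measurable_EFinP; exact: mpdf.
      + by move=> y; rewrite mule_ge0// lee_fin normal_pdf_ge0.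
      rewrite muleAC -ge0_integralZl//; last 3 first.
      + apply: emeasurable_funM; apply/measurable_EFinP.
          apply: (@measurable_indic_comp _ _ _ _ R (S q) (fun u : R => (x, x * u + 0))) => //.
          apply: measurable_fun_pair => //.
          by apply: measurable_funD => //; exact: mulrl_measurable.
        apply: (measurableT_comp mpdf).
        by apply: measurable_funD => //; exact: mulrl_measurable.
      + by move=> u _; rewrite mule_ge0// lee_fin normal_pdf_ge0.
      + by rewrite -EFinM lee_fin mulr_ge0 ?normal_pdf_ge0.
      apply: eq_integral => u _; rewrite -!EFinM addr0; congr EFin.
      rewrite /G !normal_pdfE// /normal_fun !subr0.
      rewrite (_ : expR (- (c * _)) = expR (- x ^+ 2 / (s ^+ 2 *+ 2)) *
        expR (- (x * u) ^+ 2 / (s ^+ 2 *+ 2))); first by ring.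
      by rewrite -expRD /c; congr expR; field.
  have /= -> := fubini_tonelli (m1 := leb) (m2 := leb) (fun xu => (G xu.1 xu.2)%:E) mG G0'.
  have mu1 : measurable_fun setT (fun u : R => (1 + u ^+ 2)^-1).
    apply: continuous_measurable_fun => u; apply: cvgV.
      by rewrite gt_eqF// ltr_pwDl// sqr_ge0.
    by apply: cvgD; [exact: cvg_cst|exact: exprn_continuous].
  rewrite -ge0_integralZr//; last 3 first.
  - by apply: emeasurable_funM => //; exact/measurable_EFinP.
  - by move=> u _; rewrite -EFinM lee_fin mulr_ge0 ?sqr_ge0// invr_ge0 addr_ge0// sqr_ge0.
  - by rewrite lee_fin mulr_ge0 ?expR_ge0// invr_ge0 ltW.
  apply: eq_integral => u _.
  have u1 : 0 < 1 + u ^+ 2 by rewrite ltr_pwDl// sqr_ge0.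
  transitivity (\int[leb]_x ((normal_peak s ^+ 2)%:E *
     (\1_[set x : R | (q / (1 + u ^+ 2) < x ^+ 2)%R] x *
     (`|x| * expR (- (c * (1 + u ^+ 2) * x ^+ 2))))%R%:E))%E.
    apply: eq_integral => x _; rewrite -EFinM; congr EFin; rewrite /G; congr (_ * (_ * (_ * expR _))).
      rewrite !indicE; congr (nat_of_bool _)%:R.
      have e : x ^+ 2 + (x * u) ^+ 2 = x ^+ 2 * (1 + u ^+ 2) by ring.
      by apply/idP/idP; rewrite !inE /S/= e ltr_pdivrMr.
    by ring.
  rewrite ge0_integralZl//; last 2 first.
  - apply/measurable_EFinP; apply: measurable_funM.
      apply: measurable_indic.
      rewrite (_ : [set x | _] = (fun x : R => x ^+ 2) @^-1` `]q / (1 + u ^+ 2), +oo[%classic).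
        by apply: measurable_preimage => //; exact: measurable_funX.
      by apply/seteqP; split => x /=; rewrite in_itv/= andbT.
    have me : measurable_fun setT
        (fun x : R => `|x| * expR (- (c * (1 + u ^+ 2) * x ^+ 2))).
      apply: measurable_funM; first exact: normr_measurable.
      apply: measurableT_comp => //; apply: measurableT_comp => //.
      by apply: measurable_funM => //; exact: measurable_funX.
    exact: me.
  - by rewrite lee_fin sqr_ge0.
  rewrite integral_sqr_gt_exp ?mulr_gt0 ?divr_ge0 ?(ltW u1)// -!EFinM; congr EFin.
  rewrite (_ : c * (1 + u ^+ 2) * (q / (1 + u ^+ 2)) = c * q); last by field; rewrite gt_eqF.
  by field; rewrite !gt_eqF.
move=> q q0; rewrite (key q q0).
have : (mass * (c^-1 * expR (- (c * 0)))%:E)%E = 1%E.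
  have mS0 : measurable [set w | S 0 (X w, Y w)].
    by apply: (measurable_preimage (measurable_fun_pair mX mY)); exact: mS.
  rewrite -key// -(probability_setT P); apply: eq_measure_ae => //.
  exists (X @^-1` [set 0]); split.
  - by apply: measurable_preimage.
  - by transitivity (normal_prob 0 s [set 0 : R]); [exact: lX|exact: normal_prob_set1].
  - move=> w /= nS; apply: contrapT => /eqP X0; apply: nS; split => // _.
    by rewrite /S/= ltr_pwDl ?sqr_ge0// exprn_even_gt0.
rewrite mulr0 oppr0 expR0 mulr1 EFinM muleA => ->; rewrite mul1e.
by congr (expR _)%:E; rewrite /c; field.
Qed.

End sum_of_two_squares_law.

(** * The joint law of the concave majorant and of the path *)

Lemma measurable_fun_superlevel (R : realType) d (T : measurableType d) (f : T -> R) :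
  (forall x, measurable [set w | x <= f w]) -> measurable_fun setT f.
Proof.
move=> mf; apply: (measurability (@RGenCInfty.G R)); first exact: RGenCInfty.measurableE.
move=> _ [_ [x ->] <-]; rewrite setTI (_ : _ @^-1` _ = [set w | x <= f w])//.
by apply/seteqP; split => w /=; rewrite in_itv/= andbT.
Qed.

(** * The largest slope admissible for the past *)

Section past_slope.
Context (R : realType) (d : measure_display) (T : measurableType d).
Variables (P : probability T R) (B : R -> T -> R).
Hypothesis hB : brownian_motion P B.
Hypothesis B0 : forall w, B 0 w = 0.
Variables (t k : R).
Hypothesis t0 : 0 < t.
Implicit Types (a : R) (w : T) (A : set R).

Definition past_below a : set T :=
  [set w | forall n i, (i <= 2 ^ n)%N -> B (dyadic t n i) w <= k - a * (t - dyadic t n i)].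

(** The element 0 keeps the set nonempty and the slope nonnegative. Cutting at 0 loses nothing,
    since the future almost surely exceeds every line of slope at most 0. *)
Definition past_slope w : R := sup [set a | a = 0 \/ 0 < a /\ past_below a w].

Lemma measurable_past_below a : measurable (past_below a).
Proof.
rewrite (_ : past_below a = \bigcap_n \bigcap_(i in [set i | (i <= 2 ^ n)%N])
    (B (dyadic t n i) @^-1` `]-oo, k - a * (t - dyadic t n i)])).
  apply: bigcapT_measurable => n; apply: bigcap_measurableType => i _.
  apply: measurable_preimage => //; apply: (brownian_measurable hB).
  by apply: dyadic_ge0; exact: ltW.
apply/seteqP; split => w h.
  by move=> n _ i /= ni; rewrite in_itv/=; exact: h.
by move=> n i ni; have := h n I i ni; rewrite /= in_itv/=.
Qed.

Lemma past_below_le a w : past_below a w -> a * t <= k.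
Proof. by move/(_ 0%N 0%N isT); rewrite dyadic0 B0 subr0 subr_ge0. Qed.

Lemma past_slope_bounded w :
  has_sup [set a | a = 0 \/ 0 < a /\ past_below a w].
Proof.
split; first by exists 0; left.
exists (Num.max 0 (k / t)) => a [->|[a0 /past_below_le ak]]; rewrite le_max ?lexx//.
by rewrite ler_pdivlMr// ak orbT.
Qed.

Lemma past_slope_ge0 w : 0 <= past_slope w.
Proof. by apply: ub_le_sup; [exact: (past_slope_bounded w).2|left]. Qed.

(** The supremum is attained: if the line of slope [a] is violated at [s], every admissible slope is
    bounded by a number less than [a] read off at [s]. *)
Lemma le_past_slope a w : 0 < a -> a <= past_slope w <-> past_below a w.
Proof.
move=> a0; split=> [aL n i ni|Ha]; last first.
  by apply: ub_le_sup; [exact: (past_slope_bounded w).2|right].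
rewrite leNgt; apply/negP => neg.
have [S0 Sub] := past_slope_bounded w.
set s := dyadic t n i in neg *.
have st : s <= t by apply: dyadic_le => //; exact: ltW.
(* For [s = t] the quotient is 0 by the convention on division; [neg] then reads [k < B t w], and no
   positive slope is admissible. *)
have : past_slope w <= Num.max 0 ((k - B s w) / (t - s)).
  apply: ge_sup => // b [->|[b0 /(_ n i ni) Hb]]; rewrite le_max ?lexx//.
  move: st; rewrite le_eqVlt => /predU1P[ts|st].
    by move: neg Hb; rewrite -/s ts subrr !mulr0 subr0; lra.
  by rewrite ler_pdivlMr ?subr_gt0//; move: Hb; rewrite -/s orbC => ?; apply/orP; left; lra.
move=> /(le_trans aL); rewrite le_max leNgt a0/=.
move: st; rewrite le_eqVlt => /predU1P[ts|st].
  by rewrite -ts subrr invr0 mulr0 leNgt a0.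
by rewrite ler_pdivlMr ?subr_gt0//; lra.
Qed.

Lemma measurable_past_slope : measurable_fun setT past_slope.
Proof.
apply: measurable_fun_superlevel => a; have [a0|a0] := leP a 0.
  rewrite (_ : [set w | _] = setT)//; apply/seteqP; split => // w _.
  exact: le_trans a0 (past_slope_ge0 w).
rewrite (_ : [set w | _] = past_below a); first exact: measurable_past_below.
by apply/seteqP; split => w /(le_past_slope _ a0).
Qed.

Lemma past_below_law a A : measurable A -> (forall b, A b -> b < k) ->
  0 <= k - a * t ->
  P (past_below a `&` B t @^-1` A) =
  (normal_prob 0 (Num.sqrt t) A - crossing_mass A a k t)%E.
Proof.
move=> mA Ak kat.
have mBA : measurable (B t @^-1` A).
  by apply: measurable_preimage => //; exact: (brownian_measurable hB) (ltW t0).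
have mC : measurable (B t @^-1` A `\` past_below a).
  by apply: measurableD => //; exact: measurable_past_below.
have -> : crossing_mass A a k t = P (B t @^-1` A `\` past_below a).
  apply/eqP; rewrite eq_le; apply/andP; split.
    apply: (line_crossing_ge hB B0) => //.
    case: hB => _ _ _ _ cB; apply: filterS cB => w cw sB Aw; split => // Ha.
    have [n [j [jn jB]]] := crossed_dyadic cw t0 sB.
    by have := Ha n j jn; rewrite leNgt jB.
  apply: (line_crossing_le hB B0) => //; apply: aeW => w [Aw nHa]; split => //.
  apply: contrapT => nex; apply: nHa => n i ni; rewrite leNgt; apply/negP => neg.
  apply: nex; exists (dyadic t n i); split => //.
  by rewrite dyadic_ge0 ?dyadic_le// ltW.
rewrite -(brownian_law hB B0 t0 mA).
have E : (P (past_below a `&` B t @^-1` A) + P (B t @^-1` A `\` past_below a) = P (B t @^-1` A))%E.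
  by rewrite addeC (setIC (past_below a)); symmetry; exact: measureDI (measurable_past_below a).
by rewrite -E addeK//; exact: (fin_num_measure P _ mC).
Qed.

End past_slope.

Section comparison_sets.
Context (R : realType) (d : measure_display) (T : measurableType d).
Implicit Types f g : T -> R.

Lemma measurable_lt_set f g : measurable_fun setT f -> measurable_fun setT g ->
  measurable [set w | f w < g w].
Proof.
move=> mf mg; have := measurable_preimage (measurable_funB mg mf) (measurable_itv `]0, +oo[).
by congr measurable; apply/seteqP; split => w /=; rewrite in_itv/= andbT subr_gt0.
Qed.

Lemma measurable_le_set f g : measurable_fun setT f -> measurable_fun setT g ->
  measurable [set w | f w <= g w].
Proof.
move=> mf mg; have := measurable_preimage (measurable_funB mg mf) (measurable_itv `[0, +oo[).
by congr measurable; apply/seteqP; split => w /=; rewrite in_itv/= andbT subr_ge0.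
Qed.

End comparison_sets.

Section past_slope_law.
Context (R : realType) (d : measure_display) (T : measurableType d).
Variables (P : probability T R) (B : R -> T -> R).
Hypothesis hB : brownian_motion P B.
Hypothesis B0 : forall w, B 0 w = 0.
Variable t : R.
Hypothesis t0 : 0 < t.
Context (d' : measure_display) (T' : measurableType d').
Variables (P' : probability T' R) (N E : T' -> R).
Hypotheses (mN : measurable_fun setT N) (mE : measurable_fun setT E).
Hypothesis E_ge0 : forall w, 0 <= E w.
Hypothesis lN : forall A, measurable A -> P' (N @^-1` A) = normal_prob 0 (Num.sqrt t) A.
Hypothesis tailE : forall q, 0 <= q -> P' [set w | q < E w] = (expR (- (q / (2 * t))))%:E.
Hypothesis NE : forall A C, measurable A -> measurable C ->
  P' (N @^-1` A `&` E @^-1` C) = (P' (N @^-1` A) * P' (E @^-1` C))%E.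
Implicit Types (A : set R) (a k : R).

(** The factor 4 makes the tail [exp (- q / (2 t))] at [q = 4 (k - a t) (k - b)] equal to the
    exponential in [crossing_mass]. *)
Let tail_mass A a k : measurable A -> (forall b, A b -> b < k) -> 0 <= k - a * t ->
  P' [set w | A (N w) /\ 4 * (k - a * t) * (k - N w) < E w] = crossing_mass A a k t.
Proof.
move=> mA Ak kat.
pose S := [set z : R * R | A z.1 /\ 4 * (k - a * t) * (k - z.1) < z.2].
have mS : measurable S.
  rewrite (_ : S = fst @^-1` A `&` [set z | 4 * (k - a * t) * (k - z.1) < z.2]); last first.
    by apply/seteqP; split.
  apply: measurableI; first by apply: (measurable_preimage _ mA); exact: measurable_fst.
  apply: measurable_lt_set; last exact: measurable_snd.
  apply: measurable_funM => //; apply: measurable_funB => //; exact: measurable_fst.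
rewrite (probability_independent_pair mN mE NE mS).
transitivity (\int[P']_w ((\1_A (N w) * expR (- (2 / t * (k - N w) * (k - a * t)))))%:E)%E.
  apply: eq_integral => w _; rewrite indicE.
  case: (boolP (N w \in A)) => [/set_mem Nw|/negP Nw].
    rewrite mul1r (_ : [set _ | _] = [set w' | 4 * (k - a * t) * (k - N w) < E w']).
      rewrite tailE; last by rewrite mulr_ge0 ?mulr_ge0// subr_ge0 ltW// Ak.
      by congr (expR (- _))%:E; field; rewrite gt_eqF.
    by apply/seteqP; split => // w' [].
  rewrite mul0r (_ : [set _ | _] = set0) ?measure0//.
  by apply/seteqP; split => // w' [/mem_set].
have mg : measurable_fun setT (fun b => \1_A b * expR (- (2 / t * (k - b) * (k - a * t))) : R).
  apply: measurable_funM => //.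
  apply: measurableT_comp => //; apply: measurableT_comp => //.
  by apply: measurable_funM => //; apply: measurable_funM => //; exact: measurable_funB.
pose g b := (\1_A b * expR (- (2 / t * (k - b) * (k - a * t))) : R)%:E.
transitivity (\int[lebesgue_measure]_b (g b * (normal_pdf 0 (Num.sqrt t) b)%:E))%E.
  apply: (@ge0_integral_normal_law _ _ _ P' N 0 (Num.sqrt t) g) => //.
  - exact/measurable_EFinP.
  - by move=> b; rewrite lee_fin mulr_ge0 ?expR_ge0// indicE ler0n.
by apply: eq_integral => b _; rewrite -!EFinM; congr EFin; ring.
Qed.

Lemma below_tail_law A a k : measurable A -> (forall b, A b -> b < k) -> 0 < a ->
  P (past_below B t k a `&` B t @^-1` A) =
  P' [set w | A (N w) /\ E w <= 4 * (k - a * t) * (k - N w)].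
Proof.
move=> mA Ak a0; have [kat|kat] := leP 0 (k - a * t); last first.
  rewrite (_ : past_below _ _ _ _ `&` _ = set0); last first.
    apply/seteqP; split => // w [/(past_below_le B0) + _].
    by rewrite leNgt; apply/negP; rewrite negbK -subr_lt0.
  rewrite (_ : [set w | _] = set0) ?measure0//.
  apply/seteqP; split => // w [/Ak Nk].
  rewrite leNgt; apply/negP; rewrite negbK; apply: lt_le_trans (E_ge0 w).
  by rewrite pmulr_llt0 ?subr_gt0// pmulr_rlt0.
rewrite (past_below_law hB B0 t0 mA Ak kat) -(tail_mass mA Ak kat) -lN//.
set D := [set w | _ /\ _ < _]; set F := [set w | _].
have mNA : measurable (N @^-1` A) by exact: measurable_preimage.
have mth : measurable_fun setT (fun w => 4 * (k - a * t) * (k - N w)).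
  by apply: measurable_funM => //; exact: measurable_funB.
have mD : measurable D.
  by rewrite (_ : D = N @^-1` A `&` [set w | 4 * (k - a * t) * (k - N w) < E w])//;
    apply: measurableI => //; exact: measurable_lt_set.
have mF : measurable F.
  by rewrite (_ : F = N @^-1` A `&` [set w | E w <= 4 * (k - a * t) * (k - N w)])//;
    apply: measurableI => //; exact: measurable_le_set.
have -> : N @^-1` A = F `|` D.
  apply/seteqP; split => [w Nw|w [[]|[]]//].
  by have [h|h] := leP (E w) (4 * (k - a * t) * (k - N w)); [left|right].
have E1 : P' (F `|` D) = (P' F + P' D)%E.
  apply: measureU => //; apply/seteqP; split => // w [[_ h1] [_]].
  by rewrite ltNge h1.
by rewrite E1 addeK//; exact: (fin_num_measure P' _ mD).
Qed.

(** This slope and [slope_of_normal] are both set to 0 where the end point is not below [k], so that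
    the pairs of slope and end point can be compared in law on the whole space. *)
Definition past_slope_below k w : R := if B t w < k then past_slope B t k w else 0.

(** For [N w < k], the largest [a] with [E w <= 4 * (k - a * t) * (k - N w)], cut at 0. *)
Definition slope_of_normal k w : R :=
  if N w < k then Num.max 0 (k / t - E w / (4 * t * (k - N w))) else 0.

Lemma measurable_past_slope_below k : measurable_fun setT (past_slope_below k).
Proof.
apply: measurable_fun_ifT.
- by apply: measurable_fun_ltr => //; exact: (brownian_measurable hB (ltW t0)).
- exact: (measurable_past_slope hB B0 k t0).
- exact: measurable_cst.
Qed.

Lemma slope_of_normal_ge0 k w : 0 <= slope_of_normal k w.
Proof. by rewrite /slope_of_normal; case: ifP => // _; rewrite le_max lexx. Qed.

Lemma le_slope_of_normal k x w : 0 < x ->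
  x <= slope_of_normal k w <-> N w < k /\ E w <= 4 * (k - x * t) * (k - N w).
Proof.
move=> x0; rewrite /slope_of_normal; case: ifPn => Nk; last first.
  by split=> [|[]//]; rewrite leNgt x0.
rewrite le_max leNgt x0/= lerBrDr -lerBrDl ler_pdivrMr ?mulr_gt0 ?subr_gt0//.
have -> : (k / t - x) * (4 * t * (k - N w)) = 4 * (k - x * t) * (k - N w).
  by field; rewrite gt_eqF.
by split=> [|[]].
Qed.

Lemma measurable_slope_of_normal k : measurable_fun setT (slope_of_normal k).
Proof.
apply: measurable_fun_superlevel => x; have [x0|x0] := leP x 0.
  rewrite (_ : [set w | _] = setT)//; apply/seteqP; split => // w _.
  exact: le_trans x0 (slope_of_normal_ge0 k w).
rewrite (_ : [set w | _] =
    [set w | N w < k] `&` [set w | E w <= 4 * (k - x * t) * (k - N w)]).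
  apply: measurableI; first exact: measurable_lt_set.
  apply: measurable_le_set => //.
  by apply: measurable_funM => //; exact: measurable_funB.
by apply/seteqP; split => w /(le_slope_of_normal k w x0).
Qed.

Lemma past_slope_below_law k x A : measurable A ->
  P ([set w | x <= past_slope_below k w] `&` B t @^-1` A) =
  P' ([set w | x <= slope_of_normal k w] `&` N @^-1` A).
Proof.
move=> mA; have [x0|x0] := leP x 0.
  transitivity (P (B t @^-1` A)).
    congr (P _); apply/seteqP; split => [w []//|w Aw]; split => //=.
    apply: (le_trans x0); rewrite /past_slope_below; case: ifP => // _.
    exact: (past_slope_ge0 B0 k t0).
  transitivity (normal_prob 0 (Num.sqrt t) A); first exact: (brownian_law hB B0 t0 mA).
  rewrite -lN//.
  congr (P' _); apply/seteqP; split => [w Aw|w []//]; split => //=.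
  exact: le_trans x0 (slope_of_normal_ge0 k w).
have xn : x <= 0 = false by apply/negP/negP; rewrite -ltNge.
pose A' := A `&` `]-oo, k[%classic.
have mA' : measurable A' by exact: measurableI.
transitivity (P (past_below B t k x `&` B t @^-1` A')).
  congr (P _); apply/seteqP; split => w /=.
    rewrite /past_slope_below; case: ifPn => [Bk|]; last by rewrite xn => _ [].
    by move=> [/(le_past_slope B0 k t0 w x0) h Aw]; split => //; split => //; rewrite /= in_itv/=.
  move=> [h [Aw]]; rewrite /= in_itv/= => Bk; split => //.
  by rewrite /past_slope_below Bk; apply/(le_past_slope B0 k t0 w x0).
rewrite below_tail_law//; last by move=> b [_]; rewrite /= in_itv.
congr (P' _); apply/seteqP; split => w /=.
  by move=> [[Aw +] h]; rewrite /= in_itv/= => Nk; split => //; apply/(le_slope_of_normal k w x0).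
by move=> [/(le_slope_of_normal k w x0)[Nk h] Aw]; split => //; split => //; rewrite /= in_itv.
Qed.

End past_slope_law.

(** * Independence of the past and the future of [t] *)

Section past_and_future.
Context (R : realType) (d : measure_display) (T : measurableType d).
Variables (P : probability T R) (B : R -> T -> R).
Hypothesis hB : brownian_motion P B.
Hypothesis B0 : forall w, B 0 w = 0.
Variable t : R.
Hypothesis t0 : 0 < t.
Implicit Types D : nat -> set nat.

(** For a refinable [D] the levels increase, so that this union of sigma-algebras is a pi-system and
    any two of its events live on a common grid. *)
Definition dyadic_events D : set (set T) :=
  \bigcup_n <<s increment_system B (dyadic t n) (D n) >>.

Definition past n : set nat := [set i | (i < 2 ^ n)%N].
Definition future n : set nat := [set i | (2 ^ n <= i)%N].

(** The increment [i] of level [n] is the sum of the increments [2 * i] and [2 * i + 1] of level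
    [n + 1]. *)
Definition refinable D := forall n i, D n i -> D n.+1 (2 * i)%N /\ D n.+1 (2 * i).+1.

Lemma refinable_past : refinable past.
Proof. by move=> n i; rewrite /past/= expnS => h; split; lia. Qed.

Lemma refinable_future : refinable future.
Proof. by move=> n i; rewrite /future/= expnS => h; split; lia. Qed.

Lemma dyadic_events_refine D m n : refinable D -> (m <= n)%N ->
  <<s increment_system B (dyadic t m) (D m) >> `<=`
  <<s increment_system B (dyadic t n) (D n) >>.
Proof.
move=> rD; elim: n => [|n ih]; first by rewrite leqn0 => /eqP ->.
rewrite leq_eqVlt => /predU1P[-> //|]; rewrite ltnS => /ih /subset_trans; apply.
apply: smallest_sub; first exact: smallest_sigma_algebra.
move=> _ [i Di [C mC <-]].
have [D1 D2] := rD _ _ Di.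
have H : @measurable_fun _ _
    (g_sigma_algebraType (increment_system B (dyadic t n.+1) (D n.+1))) R setT
    (fun w => B (dyadic t n.+1 (2 * i.+1)) w - B (dyadic t n.+1 (2 * i)) w).
  apply: measurable_increments; first by lia.
  move=> j ij; have [->//|->//] : (j = 2 * i \/ j = (2 * i).+1)%N by lia.
have := H measurableT _ mC; congr (<<s _ >> _); congr (_ `&` _).
by apply/funext => w; rewrite /preimage/= /increment !dyadicS.
Qed.

Lemma dyadic_events_measurable D : dyadic_events D `<=` measurable.
Proof.
move=> A [n _]; apply: (increment_system_measurable hB) => i.
exact: dyadic_ge0 (ltW t0).
Qed.

Lemma dyadic_events_setI D : refinable D -> setI_closed (dyadic_events D).
Proof.
move=> rD A C [m _ Am] [n _ Cn]; exists (maxn m n) => //.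
apply: (@measurableI _ (g_sigma_algebraType
  (increment_system B (dyadic t (maxn m n)) (D (maxn m n))))).
- exact: (dyadic_events_refine rD (leq_maxl m n)).
- exact: (dyadic_events_refine rD (leq_maxr m n)).
Qed.

Lemma past_future_independent :
  independent_systems P <<s dyadic_events past >> <<s dyadic_events future >>.
Proof.
apply: independent_systems_sigma; try exact: dyadic_events_measurable.
- exact: (dyadic_events_setI refinable_past).
- exact: (dyadic_events_setI refinable_future).
move=> A C [m _ Am] [n _ Cn].
apply: (@increment_systems_independent _ _ _ _ _ hB (dyadic t (maxn m n))
  (past (maxn m n)) (future (maxn m n))).
- exact: dyadic_ge0 (ltW t0).
- exact: dyadic_nondecreasing (ltW t0).
- by apply/seteqP; split => // i []; rewrite /past /future/=; lia.
- exact: (dyadic_events_refine refinable_past (leq_maxl m n) Am).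
- exact: (dyadic_events_refine refinable_future (leq_maxr m n) Cn).
Qed.

Lemma measurable_id_dyadic_events D :
  @measurable_fun _ _ T (g_sigma_algebraType (dyadic_events D)) setT id.
Proof.
move=> _ Y mY; rewrite setTI preimage_id.
by apply: (smallest_sub _ (@dyadic_events_measurable D)) mY; exact: sigma_algebra_measurable.
Qed.

Lemma measurable_past n i : (i <= 2 ^ n)%N ->
  @measurable_fun _ _ (g_sigma_algebraType (dyadic_events past)) R setT (B (dyadic t n i)).
Proof.
move=> ni _ C mC.
have H : @measurable_fun _ _
    (g_sigma_algebraType (increment_system B (dyadic t n) (past n))) R setT
    (fun w => B (dyadic t n i) w - B (dyadic t n 0) w).
  by apply: measurable_increments => // j /andP[_ ji]; exact: leq_trans ji ni.
apply: sub_sigma_algebra; exists n => //.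
have := H measurableT _ mC; congr (<<s _ >> _); congr (_ `&` _).
by apply/funext => w; rewrite /preimage/= dyadic0 B0 subr0.
Qed.

Lemma dyadic_beyond m j : dyadic t m (2 ^ m + j) = t + dyadic t m j.
Proof. by rewrite -{2}(dyadic_last t m) /dyadic natrD mulrDr mulrDl. Qed.

Lemma measurable_future m j :
  @measurable_fun _ _ (g_sigma_algebraType (dyadic_events future)) R setT
    (fun w => B (t + dyadic t m j) w - B t w).
Proof.
move=> _ C mC.
have H : @measurable_fun _ _
    (g_sigma_algebraType (increment_system B (dyadic t m) (future m))) R setT
    (fun w => B (dyadic t m (2 ^ m + j)) w - B (dyadic t m (2 ^ m)) w).
  by apply: measurable_increments; [exact: leq_addr|move=> i /andP[]].
apply: sub_sigma_algebra; exists m => //.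
have := H measurableT _ mC; congr (<<s _ >> _); congr (_ `&` _).
by apply/funext => w; rewrite /preimage/= dyadic_beyond dyadic_last.
Qed.

End past_and_future.

Section line_exceeded.
Context (R : realType) (d : measure_display) (T : measurableType d).
Variables (P : probability T R) (B : R -> T -> R).
Hypothesis hB : brownian_motion P B.
Hypothesis B0 : forall w, B 0 w = 0.
Variable t : R.
Hypothesis t0 : 0 < t.
Implicit Types a y : R.

Definition line_exceeded a y : set T :=
  [set w | exists n j, y + a * dyadic t n j < B (dyadic t n j) w].

Lemma measurable_line_exceeded a y : measurable (line_exceeded a y).
Proof.
rewrite (_ : line_exceeded a y = \bigcup_n \bigcup_j
    [set w | y + a * dyadic t n j < B (dyadic t n j) w]).
  apply: bigcupT_measurable => n; apply: bigcupT_measurable => j.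
  apply: measurable_lt_set => //; apply: (brownian_measurable hB).
  exact: dyadic_ge0 (ltW t0).
by apply/seteqP; split => w; [move=> [n [j h]]; exists n => //; exists j|
  move=> [n _ [j _ h]]; exists n, j].
Qed.

Lemma line_exceededP a y w : {within `[0, +oo[, continuous (B ^~ w)} ->
  line_exceeded a y w <-> exists2 u, 0 <= u & y + a * u < B u w.
Proof.
move=> cw; split.
  by move=> [n [j h]]; exists (dyadic t n j) => //; exact: dyadic_ge0 (ltW t0).
move=> [u u0 h].
have H : 0 < B u w - (y - a * (0 - u)) by rewrite subr_gt0; move: h; lra.
have [n [i [_ hi]]] := dyadic_positive (subr_affine_continuous a y 0 cw) t0 u0 ltr01 H.
by exists n, i; move: hi; rewrite subr_gt0; lra.
Qed.

Lemma line_exceeded_law a y : 0 < a -> 0 <= y ->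
  P (line_exceeded a y) = (expR (- (2 * a * y)))%:E.
Proof.
move=> a0 y0; apply: (half_line_crossing hB B0) => //; first exact: measurable_line_exceeded.
by case: hB => _ _ _ _; apply: filterS => w; exact: line_exceededP.
Qed.

End line_exceeded.

(** * The chord condition given the past *)

Section chord_law.
Context (R : realType) (d : measure_display) (T : measurableType d).
Variables (P : probability T R) (B : R -> T -> R).
Hypothesis hB : brownian_motion P B.
Hypothesis B0 : forall w, B 0 w = 0.
Variables (t k : R).
Hypothesis t0 : 0 < t.

Local Notation W := (fun u w => B (t + u) w - B t w).
Local Notation past_space := (g_sigma_algebraType (dyadic_events B t past)).
Local Notation future_space := (g_sigma_algebraType (dyadic_events B t future)).

(* The values up to time [t] are read off the first sample point and the
   increments after time [t] off the second one. *)
Definition chord_below : set (T * T) :=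
  [set z | forall n i m j, (i < 2 ^ n)%N ->
    (t - dyadic t n i) * (B t z.1 + W (dyadic t m j) z.2 - k) <=
    dyadic t m j * (k - B (dyadic t n i) z.1)].

Lemma measurable_chord_below :
  @measurable _ (past_space * future_space)%type chord_below.
Proof.
have mfst n i : (i <= 2 ^ n)%N -> @measurable_fun _ _ (past_space * future_space)%type R setT
    (fun z => B (dyadic t n i) z.1).
  by move=> ni; apply: (measurableT_comp (measurable_past B0 (t := t) ni)); exact: measurable_fst.
have mt : @measurable_fun _ _ (past_space * future_space)%type R setT (fun z => B t z.1).
  by have := mfst 0%N (2 ^ 0)%N (leqnn _); rewrite dyadic_last.
have msnd m j : @measurable_fun _ _ (past_space * future_space)%type R setT
    (fun z => W (dyadic t m j) z.2).
  exact: (measurableT_comp (measurable_future (B := B) (t := t) m j) measurable_snd).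
rewrite (_ : chord_below = \bigcap_n \bigcap_(i in [set i | (i < 2 ^ n)%N])
    \bigcap_m \bigcap_j [set z : past_space * future_space |
      (t - dyadic t n i) * (B t z.1 + W (dyadic t m j) z.2 - k) <=
      dyadic t m j * (k - B (dyadic t n i) z.1)]).
  apply: bigcapT_measurable => n; apply: bigcap_measurableType => i /= ni.
  apply: bigcapT_measurable => m; apply: bigcapT_measurable => j.
  apply: measurable_le_set; apply: measurable_funM => //.
    by apply: measurable_funB => //; apply: measurable_funD => //; exact: msnd.
  by apply: measurable_funB => //; exact: mfst (ltnW ni).
apply/seteqP; split => z h.
  by move=> n _ i ni m _ j _; exact: h.
by move=> n i m j ni; exact: h.
Qed.

Lemma measurable_future_section w : measurable [set w' | chord_below (w, w')].
Proof.
have := measurable_xsection (w : past_space) measurable_chord_below.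
move=> /(measurable_preimage (measurable_id_dyadic_events hB t0 (D := future))).
by congr measurable; apply/seteqP; split => w'; rewrite /preimage/= /xsection/= inE.
Qed.

Let hW : brownian_motion P W := brownian_shift hB (ltW t0).
Let W0 w : W 0 w = 0. Proof. by rewrite /= addr0 subrr. Qed.

Local Notation exceeds := (line_exceeded W t).

Let compl_exceeds_law a y : 0 < a -> 0 <= y ->
  P (~` exceeds a y) = (1 - expR (- (2 * a * y)))%:E.
Proof.
move=> a0 y0; rewrite probability_setC; last exact: (measurable_line_exceeded hW t0).
by rewrite (line_exceeded_law hW W0).
Qed.

(** The past is frozen at [w]. For [B t w < k], the chords ask the Brownian motion formed by the
    increments after [t] to stay below the line that starts at height [k - B t w] with slope
    [past_slope]. *)
Lemma future_section_law w : P [set w' | chord_below (w, w')] =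
  (if B t w < k then 1 - expR (- (2 * past_slope B t k w * (k - B t w))) else 0)%:E.
Proof.
have mS := measurable_future_section w.
have [Bk|kB|Bk] := ltgtP (B t w) k.
- have y0 : 0 < k - B t w by rewrite subr_gt0.
  apply/eqP; rewrite eq_le; apply/andP; split.
    apply/lee_addgt0Pr => e e0.
    (* A larger slope is violated at some time [s] of the past, and the chords from [s] keep the
       future below the line of that slope. The excess over [past_slope] changes the exponent by
       exactly [e]. *)
    pose a := past_slope B t k w + e / (2 * (k - B t w)).
    have ea : 0 < e / (2 * (k - B t w)) by rewrite divr_gt0// mulr_gt0.
    have L0 := past_slope_ge0 B0 k t0 w.
    have a0 : 0 < a by rewrite ltr_wpDl.
    have : ~ past_below B t k a w.
      by move/(le_past_slope B0 k t0 w a0); rewrite /a leNgt ltrDl ea.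
    move=> /existsNP[n /existsNP[i /not_implyP[ni /negP]]]; rewrite -ltNge => Bs.
    (* At index [2 ^ n] the line has height [k > B t w], so the violation occurs strictly before
       [t]. *)
    have {}ni : (i < 2 ^ n)%N.
      move: ni; rewrite leq_eqVlt => /predU1P[iE|//].
      by move: Bs; rewrite iE dyadic_last subrr mulr0 subr0 ltNge (ltW Bk).
    have st := dyadic_lt t0 ni; set s := dyadic t n i in st Bs.
    have sub : [set w' | chord_below (w, w')] `<=` ~` exceeds a (k - B t w).
      move=> w' Sw' [m [j]]; have := Sw' n i m j ni; rewrite /= -/s.
      have u0 := dyadic_ge0 m j (ltW t0); set u := dyadic t m j in u0 *.
      move=> h1 h2.
      have h3 : (t - s) * (k - B t w + a * u) < (t - s) * (B (t + u) w' - B t w').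
        by rewrite ltr_pM2l ?subr_gt0.
      have h4 : u * (k - B s w) <= u * (a * (t - s)) by rewrite ler_wpM2l//; lra.
      by nra.
    apply: (@le_trans _ _ (1 - expR (- (2 * a * (k - B t w))))%:E).
      rewrite -compl_exceeds_law ?(ltW y0)//; apply: le_measure; rewrite ?inE//.
      by apply: measurableC; exact: (measurable_line_exceeded hW t0).
    rewrite -EFinD lee_fin.
    rewrite (_ : - (2 * a * (k - B t w)) =
      - (2 * past_slope B t k w * (k - B t w)) + - e); last first.
      by rewrite /a; field; rewrite gt_eqF.
    rewrite expRD.
    have x1 : expR (- (2 * past_slope B t k w * (k - B t w))) <= 1.
      by rewrite -[leRHS]expR0 ler_expR oppr_le0 mulr_ge0 ?mulr_ge0// ltW.
    have x0 := expR_ge0 (- (2 * past_slope B t k w * (k - B t w))).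
    have := expR_ge1Dx (- e); set x := expR _ in x1 x0 *; set z := expR _.
    by nra.
  have [->|L0] := eqVneq (past_slope B t k w) 0.
    by rewrite mulr0 mul0r oppr0 expR0 subrr.
  have {}L0 : 0 < past_slope B t k w by rewrite lt0r L0 past_slope_ge0.
  rewrite -compl_exceeds_law ?(ltW y0)//.
  have /(le_past_slope B0 k t0 w L0) Hb : past_slope B t k w <= past_slope B t k w by [].
  apply: le_measure; rewrite ?inE//; first by apply: measurableC; exact: (measurable_line_exceeded hW t0).
  move=> w' nex n i m j ni /=.
  have st := dyadic_lt t0 ni; have := Hb n i (ltnW ni).
  set s := dyadic t n i in st * => Bs.
  have u0 := dyadic_ge0 m j (ltW t0).
  have : W (dyadic t m j) w' <= k - B t w + past_slope B t k w * dyadic t m j.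
    by rewrite leNgt; apply/negP => h; apply: nex; exists m, j.
  set u := dyadic t m j in u0 * => h.
  have h3 : (t - s) * (B (t + u) w' - B t w') <= (t - s) * (k - B t w + past_slope B t k w * u).
    by rewrite ler_wpM2l// subr_ge0 ltW.
  have h4 : u * (past_slope B t k w * (t - s)) <= u * (k - B s w).
    by rewrite ler_wpM2l//; lra.
  by nra.
- rewrite (_ : [set w' | _] = set0) ?measure0//.
  apply/seteqP; split => // w' /(_ 0%N 0%N 0%N 0%N isT).
  rewrite /= !dyadic0 addr0 !subrr mul0r subr0 addr0 leNgt pmulr_rgt0// subr_gt0.
  by rewrite kB.
(* When [B t w = k], the chords from time 0 bound the future by a line through its starting point;
   [a] is a positive slope above that of this line, and even the line of slope [a] is exceeded
   almost surely. *)
- pose a := `|k| / t + 1.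
  have a0 : 0 < a by rewrite ltr_wpDl// divr_ge0// ltW.
  have : (P (~` exceeds a 0) = 0%:E)%E.
    by rewrite compl_exceeds_law// mulr0 oppr0 expR0 subrr.
  apply: subset_measure0 => //; first by apply: measurableC; exact: (measurable_line_exceeded hW t0).
  move=> w' Sw' [m [j]]; have := Sw' 0%N 0%N m j isT.
  rewrite /= !dyadic0 B0 !subr0 Bk.
  have u0 := dyadic_ge0 m j (ltW t0); set u := dyadic t m j in u0 *.
  move=> h1 h2.
  have h3 : t * (0 + a * u) < t * (B (t + u) w' - B t w') by rewrite ltr_pM2l.
  have h4 : t * (0 + a * u) = u * `|k| + u * t by rewrite /a; field; rewrite gt_eqF.
  have h5 : u * k <= u * `|k| by rewrite ler_wpM2l// ler_norm.
  have h6 : 0 <= u * t by rewrite mulr_ge0// ltW.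
  by lra.
Qed.

End chord_law.

Section joint_law.
Context (R : realType).
Implicit Types (A : set R).

(** The value in [future_section_law] as a function of slope and end point. The absolute value makes
    it nonnegative on the whole plane and leaves nonnegative slopes unchanged. *)
Definition slope_mass A (k : R) (z : R * R) : \bar R :=
  (\1_A z.2 * (if z.2 < k then 1 - expR (- (2 * `|z.1| * (k - z.2))) else 0))%:E.

Lemma slope_mass_ge0 A k z : (0 <= slope_mass A k z)%E.
Proof.
rewrite lee_fin mulr_ge0//; case: ifPn => // zk; rewrite subr_ge0 -[leRHS]expR0 ler_expR oppr_le0.
by rewrite mulr_ge0 ?mulr_ge0// subr_ge0 ltW.
Qed.

Lemma measurable_slope_mass A k : measurable A -> measurable_fun setT (slope_mass A k).
Proof.
move=> mA; apply/measurable_EFinP; apply: measurable_funM.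
  by apply: measurable_indic_comp => //; exact: measurable_snd.
apply: measurable_fun_ifT => //.
  by apply: measurable_fun_ltr => //; exact: measurable_snd.
apply: measurable_funB => //; apply: measurableT_comp => //; apply: measurableT_comp => //.
apply: measurable_funM; last by apply: measurable_funB => //; exact: measurable_snd.
apply: measurable_funM => //; apply: measurableT_comp => //; exact: measurable_fst.
Qed.

Context (d : measure_display) (T : measurableType d).
Variables (P : probability T R) (B : R -> T -> R).
Hypothesis hB : brownian_motion P B.
Hypothesis B0 : forall w, B 0 w = 0.
Variable t : R.
Hypothesis t0 : 0 < t.

Lemma chord_event_law A k : measurable A ->
  P ([set w | chord_below B t k (w, w)] `&` B t @^-1` A) =
  (\int[P]_w slope_mass A k (past_slope_below B t k w, B t w))%E.
Proof.
move=> mA.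
pose past_space := g_sigma_algebraType (dyadic_events B t past).
pose future_space := g_sigma_algebraType (dyadic_events B t future).
pose S : set (past_space * future_space) :=
  chord_below B t k `&` [set z | A (B t z.1)].
have mS : measurable S.
  apply: measurableI; first exact: (measurable_chord_below B0).
  have := measurable_past (B := B) (t := t) B0 (n := 0%N) (i := (2 ^ 0)%N) (leqnn _).
  rewrite dyadic_last => H.
  exact: (measurable_preimage (measurableT_comp H measurable_fst) mA).
have idp := measurable_id_dyadic_events hB t0 (D := past).
have idf := measurable_id_dyadic_events hB t0 (D := future).
transitivity (P [set w | S (id w : past_space, id w : future_space)]) => //.
rewrite (probability_independent_pair idp idf _ mS); last first.
  by move=> A1 A2 mA1 mA2; apply: (past_future_independent hB t0).
apply: eq_integral => w _; rewrite /slope_mass indicE /=.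
case: (boolP (B t w \in A)) => [/set_mem Aw|/negP nAw].
  rewrite mul1r (_ : [set _ | _] = [set w' | chord_below B t k (w, w')]).
    rewrite (future_section_law hB B0)// /past_slope_below; congr EFin.
    by case: ifPn => // _; rewrite ger0_norm// past_slope_ge0.
  by apply/seteqP; split => // w' [].
rewrite mul0r (_ : [set _ | _] = set0) ?measure0//.
by apply/seteqP; split => // w' [_ /mem_set].
Qed.

Context (d' : measure_display) (T' : measurableType d').
Variables (P' : probability T' R) (N E1 E2 : T' -> R).
Hypotheses (mN : measurable_fun setT N) (mE1 : measurable_fun setT E1)
  (mE2 : measurable_fun setT E2).
Hypotheses (E1_ge0 : forall w, 0 <= E1 w) (E2_ge0 : forall w, 0 <= E2 w).
Hypothesis lN : forall A, measurable A -> P' (N @^-1` A) = normal_prob 0 (Num.sqrt t) A.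
Hypothesis tailE1 : forall q, 0 <= q -> P' [set w | q < E1 w] = (expR (- (q / (2 * t))))%:E.
Hypothesis tailE2 : forall q, 0 <= q -> P' [set w | q < E2 w] = (expR (- (q / (2 * t))))%:E.
Hypothesis NE2 : forall A C, measurable A -> measurable C ->
  P' (N @^-1` A `&` E2 @^-1` C) = (P' (N @^-1` A) * P' (E2 @^-1` C))%E.
Hypothesis NE1 : forall (A : set (R * R)) C, measurable A -> measurable C ->
  P' ((fun w => (N w, E2 w)) @^-1` A `&` E1 @^-1` C) =
  (P' ((fun w => (N w, E2 w)) @^-1` A) * P' (E1 @^-1` C))%E.

(** Given [N] and [E2], the condition is [E1 <= q] with [q] equal to [4 t (k - N)] times the slope,
    so its probability is [1 - exp (- 2 slope (k - N))], the same function of slope and end point as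
    for the path. For [q < 0] the slope is cut at 0 and both sides vanish. *)
Lemma normal_event_law A k : measurable A ->
  P' [set w | A (N w) /\ N w < k /\ E1 w + E2 w <= 4 * k * (k - N w)] =
  (\int[P']_w slope_mass A k (slope_of_normal t N E2 k w, N w))%E.
Proof.
move=> mA.
pose S : set ((R * R) * R) := [set z | A z.1.1 /\ z.1.1 < k /\
  z.2 + z.1.2 <= 4 * k * (k - z.1.1)].
have mf1 : measurable_fun setT (fun z : (R * R) * R => z.1.1).
  exact: (measurableT_comp measurable_fst measurable_fst).
have mf2 : measurable_fun setT (fun z : (R * R) * R => z.1.2).
  exact: (measurableT_comp measurable_snd measurable_fst).
have mS : measurable S.
  rewrite (_ : S = (fun z => z.1.1) @^-1` A `&` ([set z | z.1.1 < k] `&`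
     [set z | z.2 + z.1.2 <= 4 * k * (k - z.1.1)]))//.
  apply: measurableI; first exact: measurable_preimage.
  apply: measurableI; first exact: measurable_lt_set.
  apply: measurable_le_set.
    by apply: measurable_funD => //; exact: measurable_snd.
  by apply: measurable_funM => //; exact: measurable_funB.
have mNE : measurable_fun setT (fun w => (N w, E2 w)) by exact: measurable_fun_pair.
rewrite (probability_independent_pair mNE mE1 NE1 mS).
apply: eq_integral => w _; rewrite /slope_mass indicE /=.
case: (boolP (N w \in A)) => [/set_mem Aw|/negP nAw]; last first.
  rewrite mul0r (_ : [set _ | _] = set0) ?measure0//.
  by apply/seteqP; split => // w' [/mem_set].
rewrite mul1r; case: ifPn => [Nk|/negP nNk]; last first.
  by rewrite (_ : [set _ | _] = set0) ?measure0//; apply/seteqP; split => // w' [_ []].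
pose q := 4 * k * (k - N w) - E2 w.
have kN : 0 < k - N w by rewrite subr_gt0.
have -> : [set w' | S (N w, E2 w, E1 w')] = [set w' | E1 w' <= q].
  apply/seteqP; split => w' /=; first by move=> [_ [_]]; rewrite /= /q lerBrDr.
  by rewrite /q lerBrDr => h; split.
rewrite ger0_norm ?slope_of_normal_ge0// /slope_of_normal Nk.
have -> : k / t - E2 w / (4 * t * (k - N w)) = q / (4 * t * (k - N w)).
  by rewrite /q; field; rewrite !gt_eqF.
have D0 : 0 < 4 * t * (k - N w) by rewrite !mulr_gt0.
have [q0|q0] := leP 0 q; last first.
  rewrite max_l; last by rewrite pmulr_lle0 ?invr_gt0// ltW.
  rewrite mulr0 mul0r oppr0 expR0 subrr (_ : [set _ | _] = set0) ?measure0//.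
  apply/seteqP; split => // w' /=; rewrite leNgt => /negP; apply.
  exact: lt_le_trans q0 (E1_ge0 w').
rewrite max_r; last by rewrite divr_ge0// ltW.
rewrite (_ : [set w' | E1 w' <= q] = ~` [set w' | q < E1 w']); last first.
  by apply/seteqP; split => w' /=; rewrite leNgt => /negP.
rewrite probability_setC; last exact: measurable_lt_set.
rewrite tailE1// -EFinB; congr ((1 - expR (- _))%:E).
by field; rewrite !gt_eqF.
Qed.

Lemma chord_normal_law A k : measurable A ->
  P ([set w | chord_below B t k (w, w)] `&` B t @^-1` A) =
  P' [set w | A (N w) /\ N w < k /\ E1 w + E2 w <= 4 * k * (k - N w)].
Proof.
move=> mA; rewrite chord_event_law// normal_event_law//.
apply: eq_pair_integral; [| | | | |exact: measurable_slope_mass|exact: slope_mass_ge0].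
- exact: (measurable_past_slope_below hB B0 t0).
- exact: (brownian_measurable hB (ltW t0)).
- exact: measurable_slope_of_normal.
- exact: mN.
- by move=> x C mC; apply: past_slope_below_law.
Qed.

End joint_law.

Lemma measurable_sqrt (R : realType) : measurable_fun setT (@Num.sqrt R).
Proof. by apply: continuous_measurable_fun => x; exact: sqrt_continuous. Qed.

Section concave_majorant_law.
Context (R : realType) (d : measure_display) (T : measurableType d).
Variables (P : probability T R) (B : R -> T -> R).
Hypothesis hB : brownian_motion P B.
Hypothesis B0 : forall w, B 0 w = 0.
Variable t : R.
Hypothesis t0 : 0 < t.

(** The line of slope 1 starting at [n] is exceeded with probability [exp (- 2 n)], so almost surely
    one of these lines is not. Such a bound is what makes the concave majorant exist. *)
Lemma linear_bound_ae :
  {ae P, forall w, exists c a, forall s, 0 <= s -> B s w <= c + a * s}.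
Proof.
have mE n : measurable (line_exceeded B t 1 n%:R).
  exact: (measurable_line_exceeded hB t0).
have null : P (\bigcap_n line_exceeded B t 1 n%:R) = 0%E.
  apply/eqP; rewrite eq_le measure_ge0 andbT; apply/lee_addgt0Pr => e e0; rewrite add0e.
  pose n := (Num.truncn e^-1).+1.
  have ne : e^-1 < n%:R by rewrite truncnS_gt.
  have n0 : 0 < n%:R :> R by rewrite ltr0n.
  apply: (@le_trans _ _ (expR (- (2 * 1 * n%:R)))%:E).
    rewrite -(line_exceeded_law hB B0 t0) ?ltr01 ?ler0n//.
    apply: le_measure; rewrite ?inE//; first exact: bigcapT_measurable.
    by move=> w; exact.
  rewrite lee_fin expRN invf_ple ?posrE ?expR_gt0//.
  apply: (le_trans (ltW ne)); apply: le_trans (expR_ge1Dx _).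
  by lra.
have good : {ae P, forall w, ~ (\bigcap_n line_exceeded B t 1 n%:R) w}.
  exists (\bigcap_n line_exceeded B t 1 n%:R); split; [exact: bigcapT_measurable|exact: null|].
  by move=> w /= /contrapT.
case: hB => _ _ _ _ cB; apply: filterS2 cB good => w cw /existsNP[n /not_implyP[_ nex]].
exists n%:R, 1 => s s0; rewrite leNgt; apply/negP => h; apply: nex.
by apply/(line_exceededP t0 _ _ cw); exists s.
Qed.

Lemma chord_belowP k w : {within `[0, +oo[, continuous (B ^~ w)} ->
  (exists c a, forall s, 0 <= s -> B s w <= c + a * s) ->
  chord_below B t k (w, w) <-> concave_majorant (B ^~ w) t <= k.
Proof.
move=> cw bw; rewrite concave_majorant_leP// chord_dyadicP//.
by split=> h n i m j ni; have := h n i m j ni; rewrite /= subrKC.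
Qed.

Lemma measurable_chord_diag k : measurable [set w | chord_below B t k (w, w)].
Proof.
have idp := measurable_id_dyadic_events hB t0 (D := past).
have idf := measurable_id_dyadic_events hB t0 (D := future).
exact: (measurable_preimage (measurable_fun_pair idp idf) (measurable_chord_below B0 k)).
Qed.

(** A measurable null set [Z] contains the discontinuous paths and those without a linear bound. Off
    [Z] the sublevel sets of the majorant are chord events, which are measurable; on [Z] the version
    is 0. *)
Lemma concave_majorant_version : exists2 K : T -> R, measurable_fun setT K &
  {ae P, forall w, K w = concave_majorant (B ^~ w) t /\
     forall k, chord_below B t k (w, w) <-> K w <= k}.
Proof.
case: (hB) => _ _ _ _ cB; have lB := linear_bound_ae.
have [Z [mZ Z0 sZ]] := filterI cB lB.
have {}sZ w : ~ Z w -> {within `[0, +oo[, continuous (B ^~ w)} /\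
    exists c a, forall s, 0 <= s -> B s w <= c + a * s.
  by move=> nZ; apply: contrapT => h; apply: nZ; exact: sZ.
exists (fun w => if w \in Z then 0 else concave_majorant (B ^~ w) t); last first.
  exists Z; split => // w /= nK; apply: contrapT => nZ; apply: nK.
  by have [cw bw] := sZ w nZ; rewrite memNset//; split => // k; exact: chord_belowP.
pose K w := if w \in Z then 0 else concave_majorant (B ^~ w) t.
have KE : (fun w => if w \in Z then 0 else concave_majorant (B ^~ w) t) = \- (\- K).
  by apply/funext => w /=; rewrite opprK.
(* Taking opposites turns the sublevel sets into the superlevel sets expected by
   [measurable_fun_superlevel]. *)
rewrite KE; apply: measurableT_comp => //.
apply: measurable_fun_superlevel => x.
rewrite (_ : [set w | _] = (Z `&` [set _ | x <= 0]) `|`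
   (~` Z `&` [set w | chord_below B t (- x) (w, w)])); last first.
  apply/seteqP; split => w /=; rewrite /K lerNr.
    have [/set_mem Zw|/negP nZw] := boolP (w \in Z); first by rewrite oppr_ge0; left.
    have {}nZw : ~ Z w by move/mem_set.
    by have [cw bw] := sZ w nZw; move=> h; right; split => //; exact/chord_belowP.
  move=> [[Zw x0]|[nZw]]; first by rewrite mem_set// oppr_ge0.
  by have [cw bw] := sZ w nZw; rewrite memNset// => /chord_belowP; exact.
apply: measurableU; last first.
  by apply: measurableI; [exact: measurableC|exact: measurable_chord_diag].
apply: measurableI => //; have [x0|x0] := boolP (x <= 0).
  by rewrite (_ : [set _ | _] = setT)//; apply/seteqP; split.
by rewrite (_ : [set _ | _] = set0)//; apply/seteqP; split.
Qed.

Context (d' : measure_display) (T' : measurableType d').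
Variables (P' : probability T' R) (N E1 E2 : T' -> R).
Hypotheses (mN : measurable_fun setT N) (mE1 : measurable_fun setT E1)
  (mE2 : measurable_fun setT E2).
Hypotheses (E1_ge0 : forall w, 0 <= E1 w) (E2_ge0 : forall w, 0 <= E2 w).
Hypothesis lN : forall A, measurable A -> P' (N @^-1` A) = normal_prob 0 (Num.sqrt t) A.
Hypothesis tailE1 : forall q, 0 <= q -> P' [set w | q < E1 w] = (expR (- (q / (2 * t))))%:E.
Hypothesis tailE2 : forall q, 0 <= q -> P' [set w | q < E2 w] = (expR (- (q / (2 * t))))%:E.
Hypothesis NE2 : forall A C, measurable A -> measurable C ->
  P' (N @^-1` A `&` E2 @^-1` C) = (P' (N @^-1` A) * P' (E2 @^-1` C))%E.
Hypothesis NE1 : forall (A : set (R * R)) C, measurable A -> measurable C ->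
  P' ((fun w => (N w, E2 w)) @^-1` A `&` E1 @^-1` C) =
  (P' ((fun w => (N w, E2 w)) @^-1` A) * P' (E1 @^-1` C))%E.

Let radius w := Num.sqrt (N w ^+ 2 + E1 w + E2 w).

Let measurable_radius : measurable_fun setT radius.
Proof.
apply: measurableT_comp => //; first exact: measurable_sqrt.
by apply: measurable_funD => //; apply: measurable_funD => //; exact: measurable_funX.
Qed.

(** Squaring [radius w <= 2 k - N w]. Strictness of [N w < k] rests on [0 < E1 w]: if [E1] and [E2]
    vanish and [N w = k >= 0], the left side holds. *)
Let half_radiusP k w : 0 < E1 w ->
  ((N w + radius w) / 2 <= k) = (N w < k) && (E1 w + E2 w <= 4 * k * (k - N w)).
Proof.
move=> E1w; have E2w := E2_ge0 w.
rewrite ler_pdivrMr// -lerBrDl.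
have r0 : 0 <= N w ^+ 2 + E1 w + E2 w by rewrite !addr_ge0 ?sqr_ge0.
have [h|h] := leP 0 (k * 2 - N w); last first.
  rewrite leNgt (lt_le_trans h (sqrtr_ge0 _))/=.
  by apply/esym/negP => /andP[h1 h2]; nra.
rewrite -(ler_pXn2r (n := 2)) ?nnegrE ?sqrtr_ge0// sqr_sqrtr//.
apply/idP/andP => [h1|[h1 h2]]; last by nra.
have h2 : E1 w + E2 w <= 4 * k * (k - N w) by nra.
by split => //; rewrite ltNge; apply/negP => h3; nra.
Qed.

Theorem concave_majorant_radius_law :
  eq_in_law P (fun w => 2 * concave_majorant (B ^~ w) t - B t w) P' radius.
Proof.
have [K mK Kae] := concave_majorant_version.
have mBt := brownian_measurable hB (ltW t0).
pose K' w := (N w + radius w) / 2.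
have mK' : measurable_fun setT K'.
  by apply: measurable_funM => //; exact: measurable_funD.
have m1 : measurable_fun setT (\- K) by exact: measurableT_comp.
have m2 : measurable_fun setT (\- K') by exact: measurableT_comp.
have law := eq_pair_law (P := P) (P' := P') m1 mBt m2 mN _.
have {}law : forall S : set (R * R), measurable S ->
    P [set w | S (- K w, B t w)] = P' [set w | S (- K' w, N w)].
  apply: law => x A mA.
  transitivity (P ([set w | chord_below B t (- x) (w, w)] `&` B t @^-1` A)).
    apply: eq_measure_ae.
    - apply: measurableI; last exact: measurable_preimage.
      exact: measurable_le_set.
    - by apply: measurableI; [exact: measurable_chord_diag|exact: measurable_preimage].
    - apply: filterS Kae => w [_ /(_ (- x)) h]; rewrite /= lerNr.
      by split => -[/h].
  rewrite (chord_normal_law hB B0 t0 mN mE1 mE2 E1_ge0 E2_ge0 lN tailE1 tailE2 NE2 NE1)//.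
  apply: eq_measure_ae.
  - have mc : measurable_fun setT (fun w => 4 * - x * (- x - N w)).
      by apply: measurable_funM => //; exact: measurable_funB.
    rewrite (_ : [set w | _] = N @^-1` A `&` ([set w | N w < - x] `&`
      [set w | E1 w + E2 w <= 4 * - x * (- x - N w)]))//.
    apply: measurableI; first exact: measurable_preimage.
    apply: measurableI; first exact: measurable_lt_set.
    by apply: measurable_le_set => //; exact: measurable_funD.
  - by apply: measurableI; [exact: measurable_le_set|exact: measurable_preimage].
  (* The tail of [E1] at 0 is one, which supplies the hypothesis of [half_radiusP] almost surely. *)
  - have E1pos : {ae P', forall w, 0 < E1 w}.
      exists (~` [set w | 0 < E1 w]); split => //.
        by apply: measurableC; exact: measurable_lt_set.
      rewrite probability_setC; last exact: measurable_lt_set.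
      by rewrite tailE1// mul0r oppr0 expR0 subee.
    apply: filterS E1pos => w /(half_radiusP (- x)) h.
    rewrite /= lerNr /K' h; split; first by move=> [Aw [-> ->]].
    by move=> [/andP[-> ->]].
pose Y w := 2 * K w - B t w.
have mY : measurable_fun setT Y by apply: measurable_funB => //; exact: measurable_funM.
pose Y_ : {RV P >-> R} := HB.pack Y (isMeasurableFun.Build _ _ _ _ _ mY).
pose Y'_ : {RV P' >-> R} := HB.pack radius (isMeasurableFun.Build _ _ _ _ _ measurable_radius).
exists Y_, Y'_; split; first by apply: filterS Kae => w [KE _]; rewrite /= /Y KE.
  exact: aeW.
(* The first coordinates are [- K] and [- K'], hence the sign; on the second space [2 K' - N] is the
   radius. *)
move=> A mA; pose S := [set z : R * R | A (- (2 * z.1) - z.2)].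
have mS : measurable S.
  have mf : measurable_fun setT (fun z : R * R => - (2 * z.1) - z.2).
    apply: measurable_funB; last exact: measurable_snd.
    by apply: measurableT_comp => //; apply: measurable_funM => //; exact: measurable_fst.
  exact: (measurable_preimage mf mA).
have := law S mS; rewrite /distribution/= /pushforward.
rewrite (_ : [set w | S (- K w, B t w)] = Y @^-1` A); last first.
  by apply/seteqP; split => w; rewrite /S/= /Y mulrN opprK.
rewrite (_ : [set w | S (- K' w, N w)] = radius @^-1` A) => [-> //|].
by apply/seteqP; split => w; rewrite /S/= /K' mulrN opprK mulrC divfK// addrC addKr.
Qed.

End concave_majorant_law.

(** * Five independent normal variables and the conclusion *)

Section independent_blocks.
Context (R : realType) (d : measure_display) (T : measurableType d).
Variables (P : probability T R) (I : choiceType) (X : I -> T -> R).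
Hypothesis mX : forall i, measurable_fun setT (X i).
Hypothesis iX : independent_functions P X.

Definition block_events (J : set I) := \bigcup_(i in J) sigma_of_fun (X i).

Lemma measurable_block (J : set I) i : J i ->
  @measurable_fun _ _ (g_sigma_algebraType (block_events J)) R setT (X i).
Proof. by move=> Ji _ C mC; apply: sub_sigma_algebra; exists i => //; exists C. Qed.

Lemma blocks_independent (J1 J2 : set I) d1 d2 (S1 : measurableType d1)
    (S2 : measurableType d2) (f : T -> S1) (g : T -> S2) :
  J1 `&` J2 = set0 ->
  @measurable_fun _ _ (g_sigma_algebraType (block_events J1)) S1 setT f ->
  @measurable_fun _ _ (g_sigma_algebraType (block_events J2)) S2 setT g ->
  forall A C, measurable A -> measurable C ->
    P (f @^-1` A `&` g @^-1` C) = (P (f @^-1` A) * P (g @^-1` C))%E.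
Proof.
move=> J12 mf mg A C mA mC.
apply: (independent_functions_systems mX iX J12).
- by have := mf measurableT _ mA; rewrite setTI.
- by have := mg measurableT _ mC; rewrite setTI.
Qed.

End independent_blocks.

Section eq_in_law_theory.
Context (R : realType) (d : measure_display) (T : measurableType d).
Context (d' : measure_display) (T' : measurableType d').
Variables (P : probability T R) (P' : probability T' R).

Lemma eq_in_law_ae (X1 X2 : T -> R) (X' : T' -> R) : {ae P, forall w, X1 w = X2 w} ->
  eq_in_law P X1 P' X' -> eq_in_law P X2 P' X'.
Proof.
move=> X12 [Y [Y' [YX YX' YY']]]; exists Y, Y'; split => //.
by apply: filterS2 X12 YX => w <-.
Qed.

Lemma eq_in_law_sym (X : T -> R) (X' : T' -> R) :
  eq_in_law P X P' X' -> eq_in_law P' X' P X.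
Proof. by move=> [Y [Y' [YX YX' YY']]]; exists Y', Y; split => // A /YY'. Qed.

Lemma eq_in_law_comp (f : R -> R) (X : T -> R) (X' : T' -> R) :
  measurable_fun setT f ->
  eq_in_law P X P' X' -> eq_in_law P (fun w => f (X w)) P' (fun w => f (X' w)).
Proof.
move=> mf [Y [Y' [YX YX' YY']]].
have mY : measurable_fun setT (f \o Y) by exact: measurableT_comp.
have mY' : measurable_fun setT (f \o Y') by exact: measurableT_comp.
pose Y_ : {RV P >-> R} := HB.pack (f \o Y) (isMeasurableFun.Build _ _ _ _ _ mY).
pose Y'_ : {RV P' >-> R} := HB.pack (f \o Y') (isMeasurableFun.Build _ _ _ _ _ mY').
exists Y_, Y'_; split.
- by apply: filterS YX => w /= ->.
- by apply: filterS YX' => w /= ->.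
- by move=> A mA; apply: (YY' (f @^-1` A)); exact: measurable_preimage.
Qed.

End eq_in_law_theory.

(** The two measurable versions of [X2] may differ, but they agree almost everywhere and so have the
    same law. *)
Lemma eq_in_law_trans (R : realType) d1 (T1 : measurableType d1) d2 (T2 : measurableType d2)
    d3 (T3 : measurableType d3) (P1 : probability T1 R) (P2 : probability T2 R)
    (P3 : probability T3 R) (X1 : T1 -> R) (X2 : T2 -> R) (X3 : T3 -> R) :
  eq_in_law P1 X1 P2 X2 -> eq_in_law P2 X2 P3 X3 -> eq_in_law P1 X1 P3 X3.
Proof.
move=> [Y1 [Y2 [YX1 YX2 Y12]]] [Z2 [Z3 [ZX2 ZX3 Z23]]]; exists Y1, Z3; split => // A mA.
transitivity (distribution P2 Y2 A); first exact: Y12.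
transitivity (distribution P2 Z2 A); last exact: Z23.
rewrite /distribution/= /pushforward; apply: eq_measure_ae.
- exact: measurable_preimage.
- exact: measurable_preimage.
- by apply: filterS2 YX2 ZX2 => w /= -> ->.
Qed.

Section five_normals.
Context (R : realType) (d : measure_display) (T : measurableType d).
Variables (P : probability T R) (B : R -> T -> R).
Hypothesis hB : brownian_motion P B.
Variable t : R.
Hypothesis t0 : 0 < t.

Lemma brownian_start_ae : {ae P, forall w u, B (0 + u) w - B 0 w = B u w}.
Proof. by case: hB => _ + _ _ _; apply: filterS => w B0 u; rewrite add0r B0 subr0. Qed.

Lemma brownian_marginal A : measurable A ->
  P (B t @^-1` A) = normal_prob 0 (Num.sqrt t) A.
Proof.
move=> mA; have hB' := brownian_shift hB (lexx 0).
rewrite -(brownian_law hB' _ t0 mA); last by move=> w; rewrite addr0 subrr.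
apply: eq_measure_ae.
- by apply: measurable_preimage => //; exact: (brownian_measurable hB (ltW t0)).
- by apply: measurable_preimage => //; exact: (brownian_measurable hB' (ltW t0)).
- by apply: filterS brownian_start_ae => w H; rewrite /= H.
Qed.

Context (d' : measure_display) (T' : measurableType d').
Variables (P' : probability T' R) (X : 'I_5 -> T' -> R).
Hypothesis mX : forall i, measurable_fun setT (X i).
Hypothesis iX : independent_functions P' X.
Hypothesis lX : forall i A, measurable A -> P' (X i @^-1` A) = normal_prob 0 (Num.sqrt t) A.

Lemma concave_majorant_normals_law :
  eq_in_law P (fun w => 2 * concave_majorant (B ^~ w) t - B t w)
    P' (fun w => Num.sqrt (\sum_(i < 5) X i w ^+ 2)).
Proof.
(* This Brownian motion starts at 0 everywhere and almost surely has the same path as [B]. *)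
pose B' u w := B (0 + u) w - B 0 w.
have hB' : brownian_motion P B' := brownian_shift hB (lexx 0).
have B'0 w : B' 0 w = 0 by rewrite /B' addr0 subrr.
apply: (@eq_in_law_ae _ _ _ _ _ _ _ (fun w => 2 * concave_majorant (B' ^~ w) t - B' t w)).
  apply: filterS brownian_start_ae => w H.
  by rewrite (_ : B' ^~ w = B ^~ w) ?/B' ?H//; apply/funext => u; exact: H.
(* [x0] provides the end point, [x1] and [x2] the future term [E1], [x3] and [x4] the past term
   [E2]. *)
pose x0 : 'I_5 := ord0. pose x1 : 'I_5 := lift ord0 ord0.
pose x2 : 'I_5 := lift ord0 (lift ord0 ord0).
pose x3 : 'I_5 := lift ord0 (lift ord0 (lift ord0 ord0)).
pose x4 : 'I_5 := lift ord0 (lift ord0 (lift ord0 (lift ord0 ord0))).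
pose E1 w := X x1 w ^+ 2 + X x2 w ^+ 2.
pose E2 w := X x3 w ^+ 2 + X x4 w ^+ 2.
have -> : (fun w => Num.sqrt (\sum_(i < 5) X i w ^+ 2)) =
    (fun w => Num.sqrt (X x0 w ^+ 2 + E1 w + E2 w)).
  by apply/funext => w; rewrite !big_ord_recl big_ord0 addr0 /E1 /E2 !addrA.
have pair_indep i j : i != j -> forall A C, measurable A -> measurable C ->
    P' (X i @^-1` A `&` X j @^-1` C) = (P' (X i @^-1` A) * P' (X j @^-1` C))%E.
  move=> ij; apply: (blocks_independent mX iX (J1 := [set i]) (J2 := [set j])).
  - by apply/seteqP; split => // k /= [-> ji]; move: ij; rewrite ji eqxx.
  - exact: measurable_block.
  - exact: measurable_block.
have tail i j q : i != j -> 0 <= q ->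
    P' [set w | q < X i w ^+ 2 + X j w ^+ 2] = (expR (- (q / (2 * t))))%:E.
  move=> ij q0; rewrite (@sum_two_squares_tail _ _ _ P' _ _ (Num.sqrt t))//.
  - by rewrite sqr_sqrtr// ltW.
  - by rewrite sqrtr_gt0.
  - exact: pair_indep.
  - exact: lX.
  - exact: lX.
apply: (concave_majorant_radius_law hB' B'0 t0).
- exact: mX.
- by apply: measurable_funD; apply: measurable_funX.
- by apply: measurable_funD; apply: measurable_funX.
- by move=> w; rewrite addr_ge0// sqr_ge0.
- by move=> w; rewrite addr_ge0// sqr_ge0.
- exact: lX.
- by move=> q; exact: tail.
- by move=> q; exact: tail.
- apply: (blocks_independent mX iX (J1 := [set x0]) (J2 := [set x3; x4])).
  + by apply/seteqP; split => // k /= [->] [].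
  + exact: measurable_block.
  + by apply: measurable_funD; apply: measurable_funX; apply: measurable_block; [left|right].
- apply: (blocks_independent mX iX (J1 := [set x0; x3; x4]) (J2 := [set x1; x2])).
  + by apply/seteqP; split => // k /= [[[]|] ->] [].
  + apply: measurable_fun_pair; first by apply: measurable_block; left; left.
    apply: measurable_funD; apply: measurable_funX; apply: measurable_block; last by right.
    by left; right.
  + by apply: measurable_funD; apply: measurable_funX; apply: measurable_block; [left|right].
Qed.

End five_normals.

Theorem mainTheorem2 (R : realType) (d : measure_display)
    (T : measurableType d) (P : probability T R) (B : R -> T -> R)
    (hB : brownian_motion P B) :
  let K := fun (t : R) (w : T) => concave_majorant (B ^~ w) t in
  (forall (d' : measure_display) (T' : measurableType d')
      (P' : probability T' R) (R5 : R -> T' -> R),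
    bessel_process P' 5 R5 ->
    forall t : R, 0 < t ->
      eq_in_law P (fun w => 2 * K t w - B t w) P' (R5 t)) /\
  (forall (d' : measure_display) (T' : measurableType d')
      (P' : probability T' R) (V : {RV P' >-> R}),
    chi_squared P' 5 V ->
    eq_in_law P (fun w => 2 * K 1 w - B 1 w) P' (fun w => Num.sqrt (V w))).
Proof.
split=> [d' T' P' R5 [W [hW iW] R5E] t t0|d' T' P' V [d0 [T0 [P0 [G [[mG iG lG] VG]]]]]].
  rewrite (_ : R5 t = fun w => Num.sqrt (\sum_(i < 5) W i t w ^+ 2)); last first.
    by apply/funext => w; rewrite R5E// ltW.
  apply: (concave_majorant_normals_law hB t0 (X := fun i => W i t)).
  - by move=> i; exact: (brownian_measurable (hW i) (ltW t0)).
  (* Independence of the coordinate processes passes to their values at [t], whose sigma-algebras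
     are smaller. *)
  - move=> J E JE; apply: iW => i iJ; apply: sub_sigma_algebra.
    by exists t; [rewrite /= in_itv/= andbT ltW|exact: JE].
  - by move=> i A mA; exact: (brownian_marginal (hW i) t0 mA).
(* The normal variables behind [V] live on their own space [T0]; they serve as the five variables
   for [t = 1], and the law is then carried over to the square root of [V]. *)
apply: eq_in_law_trans (eq_in_law_sym (eq_in_law_comp (@measurable_sqrt R) VG)).
apply: (concave_majorant_normals_law hB ltr01) => //.
by move=> i A mA; rewrite sqrtr1; exact: lG.
Qed.
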